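(* Let $\hat\Delta$ be a $B\times B$ stochastic matrix and $\Phi:\{1,\dots,B\}\to\{1,\dots,A\}$. Suppose that at $\Delta=\hat\Delta$: (1) $1$ is a simple eigenvalue of $\hat\Delta$; (2) for every $a\in\{1,\dots,A\}$ and all $w\in L$, $r_a(w)>0$; (3) for every $b\in\{1,\dots,A\}$, $\{f_a: a\in\{1,\dots,A\}\}$ is eventually contracting at all $w$ in the convex hull of $L\cap W_b$. (Here $r_a$, $f_a$ and $L$ are those associated with $\hat\Delta$ and $\Phi$.) Then the entropy rate $H(Z)$ of the hidden Markov chain $Z$ determined by $\Delta$ and $\Phi$ is analytic, as a function of $\Delta$, at $\Delta=\hat\Delta$.
   Context: For a $B\times B$ stochastic matrix $\Delta$, let $Y$ be the stationary Markov chain on $\{1,\dots,B\}$ with $\Delta(i,j)=p(y_1=j|y_0=i)$; the hidden Markov chain is $Z=\Phi(Y)$, with entropy rate $H(Z)=\lim_{n\to\infty}-E_p(\log p(z_0|z_{-n}^{-1}))$. $W=\{w\in\mathbb{R}^B: w_i\ge 0,\ \sum_i w_i=1\}$ (row vectors), and $W_b=\{w\in W: w_i=0 \text{ whenever } \Phi(i)\ne b\}$. $\Delta_a$ is the $B\times B$ matrix with $\Delta_a(i,j)=\Delta(i,j)$ if $\Phi(j)=a$ and $\Delta_a(i,j)=0$ otherwise. For $w\in W$, $r_a(w)=w\Delta_a\mathbf{1}$ ($\mathbf 1$ the all-ones column vector) and $f_a(w)=w\Delta_a/r_a(w)$ (defined where $r_a(w)\neq 0$). $\vec s$ denotes the stationary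 vector of $\hat\Delta$, unique since $1$ is a simple eigenvalue. $L$ denotes the limit set of $\{(f_{a_n}\circ f_{a_{n-1}}\circ\cdots\circ f_{a_0})(\vec s)\}$, i.e. the set of all limits, along sequences $n_k\to\infty$, of points $(f_{a_{n_k}^{(k)}}\circ\cdots\circ f_{a_0^{(k)}})(\vec s)$ over arbitrary words $a_0^{(k)},\dots,a_{n_k}^{(k)}$ (for which the composition is defined). For a mapping $f$ from $W_b$ to $W$ and $w\in W_b$, $f'(w)$ is the first derivative of $f$ at $w$ restricted to the subspace spanned by directions parallel to the simplex $W_b$, and $\|\cdot\|$ is the Euclidean (operator) norm of a linear mapping. $\{f_a\}$ is eventually contracting at $w\in W_b$ if there exists $n$ such that for any $a_0,a_1,\dots,a_n\in\{1,\dots,A\}$, $\|(f_{a_n}\circ f_{a_{n-1}}\circ\cdots\circ f_{a_0})'(w)\|<1$. Analyticity at $\hat\Delta$: $H(Z)$ is regarded as a function of $\Delta$ in the natural parametrization, where the real parameters are any $B-1$ chosen entries of each row of $\Delta$ (the remaining entry being determined by row sum $1$). Analytic at $\hat\Delta$ means that there is a power series in these parameters, centered at and convergent near $\hat\Delta$, whose sum equals $H(Z)$ at all stochastic $\Delta$ near $\hat\Delta$. *)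

(* Defs.v *)
From HB Require Import structures.
From mathcomp Require Import all_boot all_order all_algebra.
From mathcomp Require Import all_classical all_reals all_analysis.

Set Implicit Arguments.
Unset Strict Implicit.
Unset Printing Implicit Defensive.

Import Order.TTheory GRing.Theory Num.Theory.
Import numFieldNormedType.Exports.

Local Open Scope classical_set_scope.
Local Open Scope ring_scope.

(* States and symbols are numbered from 0: {1,..,B} is 'I_B, {1,..,A} is 'I_A. *)

Section MarkovChain.
Variables (R : realType) (B : nat).
Implicit Types (D : 'M[R]_B) (w : 'rV[R]_B).

Definition simplex : set 'rV[R]_B :=
  [set w | (forall i, 0 <= w 0 i) /\ \sum_i w 0 i = 1].

Definition stochastic D : Prop :=
  (forall i j, 0 <= D i j) /\ (forall i, \sum_j D i j = 1).

(* For matrices, mup 1 (char_poly D) is the algebraic multiplicity of 1. *)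
Definition simple_eigenvalue D (x : R) : Prop := mup x (char_poly D) = 1%N.

Definition stationary D w : Prop := simplex w /\ w *m D = w.

(* A stationary vector exists for every stochastic D (lemma below), and it is
   unique when 1 is a simple eigenvalue of D; otherwise this is one of them. *)
Definition stationary_vec D : 'rV[R]_B := xget 0 [set w | stationary D w].

Lemma stationary_vecP D :
  (0 < B)%N -> stochastic D -> stationary D (stationary_vec D).
Proof.
move=> B0 [D0 D1]; rewrite /stationary_vec.
have [v v0 vD] : exists2 v : 'rV[R]_B, v != 0 & v *m D = v.
  suff /det0P[v v0 vD] : \det (D - 1%:M) == 0.
    exists v => //; apply/eqP; rewrite -subr_eq0 -{2}(mulmx1 v) -mulmxBr.
    exact/eqP.
  rewrite -det_tr; apply/det0P; exists (const_mx 1).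
    by apply/negP => /eqP/matrixP/(_ 0 (Ordinal B0))/eqP; rewrite !mxE oner_eq0.
  apply/rowP => i; rewrite !mxE.
  under eq_bigr do rewrite !mxE mul1r.
  rewrite sumrB D1 (bigD1 i)//= eqxx big1 ?addr0 ?subrr// => j ji.
  by rewrite eq_sym (negPf ji).
have Dv j : `|v 0 j| <= \sum_i `|v 0 i| * D i j.
  rewrite -[in leLHS]vD mxE (le_trans (ler_norm_sum _ _ _))//.
  by apply: ler_sum => i _; rewrite normrM (ger0_norm (D0 _ _)).
have eqv j : `|v 0 j| = \sum_i `|v 0 i| * D i j.
  apply/esym/eqP; rewrite -subr_eq0; apply/eqP.
  suff : \sum_j (\sum_i `|v 0 i| * D i j - `|v 0 j|) == 0.
    rewrite psumr_eq0 => [/allP/(_ j)|i _]; last by rewrite subr_ge0.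
    by rewrite mem_index_enum => /(_ isT)/eqP.
  rewrite sumrB exchange_big/=.
  by under eq_bigr do rewrite -mulr_sumr D1 mulr1; rewrite subrr.
pose S := \sum_i `|v 0 i|.
have S0 : 0 < S.
  rewrite lt_neqAle sumr_ge0// andbT eq_sym; apply/negP.
  rewrite psumr_eq0// => /allP vi; case/negP: v0; apply/eqP/rowP => i.
  by rewrite mxE; apply/eqP; rewrite -normr_eq0; apply: vi; rewrite mem_index_enum.
apply: (@xgetPex _ 0 [set w | stationary D w]).
exists (\row_i (`|v 0 i| / S)); split; first split.
- by move=> i; rewrite mxE divr_ge0// ltW.
- by under eq_bigr do rewrite mxE; rewrite -mulr_suml divff// gt_eqF.
- apply/rowP => j; rewrite !mxE eqv mulr_suml; apply: eq_bigr => i _.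
  by rewrite mxE mulrAC.
Qed.

Fixpoint transition_prob D (i : 'I_B) (y : seq 'I_B) : R :=
  if y is j :: y' then D i j * transition_prob D j y' else 1.

(* p(y_0, .., y_n) for the stationary chain with transition matrix D *)
Definition chain_prob D (y : seq 'I_B) : R :=
  if y is i :: y' then stationary_vec D 0 i * transition_prob D i y' else 1.

End MarkovChain.

Section HiddenMarkovChain.
Variables (R : realType) (A B : nat) (Phi : 'I_B -> 'I_A).
Implicit Types (D : 'M[R]_B) (w : 'rV[R]_B) (a b : 'I_A).

(* By stationarity, a word z of length n is read as the values of n consecutive
   letters of Z = Phi(Y), wherever the window starts. *)
Definition hidden_prob D (z : seq 'I_A) : R :=
  \sum_(y : (size z).-tuple 'I_B | map Phi y == z) chain_prob D y.

(* - E_p (log p(z_0 | z_{-n}^{-1})): the tuple z is z_{-n}^0, and take n z is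
   z_{-n}^{-1}. Words of probability 0 contribute 0. *)
Definition cond_entropy D (n : nat) : R :=
  - \sum_(z : n.+1.-tuple 'I_A)
      hidden_prob D z * ln (hidden_prob D z / hidden_prob D (take n z)).

Definition entropy_rate D : R := limn (cond_entropy D).

Definition face b : set 'rV[R]_B :=
  simplex (B := B) `&` [set w | forall i, Phi i != b -> w 0 i = 0].

Definition symbol_mx D a : 'M[R]_B :=
  \matrix_(i, j) (if Phi j == a then D i j else 0).

Definition r_ D a w : R := (w *m symbol_mx D a *m (const_mx 1 : 'cV_B)) 0 0.

(* Total on row vectors; meaningful where r_ D a w != 0. *)
Definition f_ D a w : 'rV[R]_B := (r_ D a w)^-1 *: (w *m symbol_mx D a).

(* For u = [:: a_0; ..; a_n], this is f_(a_n) \o .. \o f_(a_0). *)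
Definition f_word D (u : seq 'I_A) w : 'rV[R]_B :=
  foldl (fun w' a => f_ D a w') w u.

Fixpoint f_word_defined D (u : seq 'I_A) w : bool :=
  if u is a :: u' then (r_ D a w != 0) && f_word_defined D u' (f_ D a w)
  else true.

Definition limit_set D : set 'rV[R]_B :=
  [set w | exists u : nat -> seq 'I_A,
    [/\ size (u k) @[k --> \oo] --> \oo,
        forall k, f_word_defined D (u k) (stationary_vec D) &
        f_word D (u k) (stationary_vec D) @[k --> \oo] --> w]].

Definition l2norm w : R := Num.sqrt (\sum_i w 0 i ^+ 2).

(* Directions parallel to the simplex face b. *)
Definition face_direction b : set 'rV[R]_B :=
  [set v | (forall i, Phi i != b -> v 0 i = 0) /\ \sum_i v 0 i = 0].

(* Euclidean operator norm of the restriction of l to face_direction b. *)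
Definition face_opnorm b (l : 'rV[R]_B -> 'rV[R]_B) : R :=
  sup [set l2norm (l v) | v in face_direction b `&` [set v | l2norm v <= 1]].

Definition eventually_contracting D b w : Prop :=
  exists n : nat, forall u : n.+1.-tuple 'I_A,
    differentiable (f_word D u) w /\
    face_opnorm b ('d (f_word D u) w) < 1.

End HiddenMarkovChain.

Definition convex_hull (R : realType) (V : lmodType R) (X : set V) : set V :=
  smallest (@convex_set R V) X.

Section Analyticity.
Variables (R : realType) (B : nat).
Implicit Types (D : 'M[R]_B).

(* k i is the column of the entry of row i that is determined by the others. *)
Definition free_entries (k : 'I_B -> 'I_B) D : 'M[R]_(B, B.-1) :=
  \matrix_(i, j) D i (lift (k i) j).

(* Term of multi-index m of the power series with coefficients c. *)
Definition series_term (c : 'M[nat]_(B, B.-1) -> R) (x : 'M[R]_(B, B.-1))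
    (m : 'M[nat]_(B, B.-1)) : \bar R :=
  (c m * \prod_i \prod_j x i j ^+ m i j)%:E.

(* Sum of a (summable) family of real numbers. *)
Definition family_sum (I : choiceType) (t : I -> \bar R) : R :=
  fine (\esum_(m in [set: I]) t^\+ m - \esum_(m in [set: I]) t^\- m)%E.

Definition analytic_at (F : 'M[R]_B -> R) D0 : Prop :=
  forall k : 'I_B -> 'I_B, exists c : 'M[nat]_(B, B.-1) -> R,
    (\forall x \near (0 : 'M[R]_(B, B.-1)), summable setT (series_term c x)) /\
    (\forall D \near D0, stochastic D ->
       F D = family_sum (series_term c (free_entries k D - free_entries k D0))).

End Analyticity.

(* Main.v *)
Require Import Defs.
From HB Require Import structures.
From mathcomp Require Import all_boot all_order all_algebra.
From mathcomp Require Import all_classical all_reals all_analysis.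
From mathcomp Require Import ring lra zify.

(* Every word has positive probability at Dhat and the maps f_a preserve the
   compact set L, so compactness and the chain rule turn eventual contraction
   into: all derivatives of f_u at points of L are small once u is long. Since
   f_u is projective,
     f_u w - f_u w' = (r_u w' / r_u w) * f_u'(w') (w - w'),
   and as w and w' may be exchanged, small derivatives at w and w' alone make f_u
   contract between them: no information on the segment joining them is needed.
   Complex neighbourhoods are replaced by the l1-norm, on a small cube, of
   power series in the free entries of Delta, a Banach algebra norm: the
   contraction estimate survives for maps and points whose coordinates are power
   series with small non-constant part. Hence the conditional probabilities
   given b z and given z differ by O(lam^|z|) in that norm, while the norms of
   the probabilities of the words of length n add up to O((1 + eps)^n). By
   stationarity the differences of successive conditional entropies are then
   geometrically small, and the entropy rate is a norm limit of power series. *)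

Set Implicit Arguments.
Unset Strict Implicit.
Unset Printing Implicit Defensive.

Import Order.TTheory GRing.Theory Num.Theory.
Import numFieldNormedType.Exports.

Local Open Scope classical_set_scope.
Local Open Scope ring_scope.

(** * Power series and their l1-norms on cubes *)

(** Near [Dhat] the parameters also give matrices with negative entries, so positivity of
    probabilities there has to come from closeness to points of [L]. Perturbed orbits are therefore
    shadowed: over a block of [N] letters the error [e] is halved by contraction, the perturbation
    of the maps adds at most [e / 2], and the reference point moves to its image, which is in [L]
    again. Contraction holds along faces only. The reference point must thus lie in the face of the
    last letter read, and two orbits can be compared only if their words end alike, as [z] and [b z]
    do. The constants are chosen in this order: the lower bound [c] of the [r_a] on [L];
    [eta = 1 / (4 B)], which makes a block halve errors; the block length [N]; the tolerances [e1]
    for matrix words and [e] for points; the length [N1] beyond which orbits are close to [L];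
    [lam < 1] with [lam ^ N >= 1 / 2]; last the radius [d]. Absolute values destroy the cancellation
    that keeps total probability equal to 1, so the norms of the words of length [n] add up to a
    multiple of [g ^ n] with [g = 1 + B ^ 2 d]. As [lam] is fixed before [d], [g * lam < 1] can be
    arranged. *)

Lemma cvgn_le (R : realType) (u : nat -> R) (l K : R) :
  u n @[n --> \oo] --> l -> (forall n, u n <= K) -> l <= K.
Proof. by move=> ul uK; apply: (ler_cvg_to ul (cvg_cst K)); apply: nearW. Qed.

Section Majorants.
Variables (R : realType) (p q : nat).
Implicit Types (x : 'M[R]_(p, q)) (m : 'M[nat]_(p, q)) (d K L : R).

Definition monom x m : R := \prod_i \prod_j x i j ^+ m i j.

Lemma monomD x m m' : monom x (m + m') = monom x m * monom x m'.
Proof.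
rewrite /monom -big_split; apply: eq_bigr => i _ /=.
by rewrite -big_split; apply: eq_bigr => j _ /=; rewrite mxE exprD.
Qed.

Lemma monom0 x : monom x 0 = 1.
Proof. by rewrite /monom !big1// => i _; rewrite big1// => j _; rewrite mxE expr0. Qed.

Lemma monom_delta x i j : monom x (\matrix_(k, l) ((k == i) && (l == j) : nat)) = x i j.
Proof.
rewrite /monom (bigD1 i)//= (bigD1 j)//= !mxE !eqxx expr1 big1 ?mulr1.
  rewrite big1 ?mulr1// => k ki; rewrite big1// => l _.
  by rewrite mxE (negPf ki).
by move=> l lj; rewrite mxE (negPf lj) andbF.
Qed.

Definition cube d : set 'M[R]_(p, q) := [set x | forall i j, `|x i j| <= d].

Lemma monom_const_ge0 d m : 0 <= d -> 0 <= monom (const_mx d) m.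
Proof.
by move=> d0; do 2!apply: prodr_ge0 => ? _; rewrite mxE exprn_ge0.
Qed.

Lemma monom_const_gt0 d m : 0 < d -> 0 < monom (const_mx d) m.
Proof. by move=> d0; do 2!apply: prodr_gt0 => ? _; rewrite mxE exprn_gt0. Qed.

Lemma norm_monom_le d x m : cube d x -> `|monom x m| <= monom (const_mx d) m.
Proof.
move=> xd; rewrite /monom normr_prod; apply: ler_prod => i _.
rewrite normr_ge0/= normr_prod; apply: ler_prod => j _.
by rewrite normr_ge0 mxE normrX lerXn2r// nnegrE (le_trans _ (xd i j)).
Qed.

(* A finite sum of monomials, with repetitions of a monomial allowed. *)
Definition fpoly := seq (R * 'M[nat]_(p, q)).

Definition peval x (P : fpoly) : R := \sum_(t <- P) t.1 * monom x t.2.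

Definition pnorm d (P : fpoly) : R :=
  \sum_(t <- P) `|t.1| * monom (const_mx d) t.2.

Definition pmul (P Q : fpoly) : fpoly :=
  [seq (t.1 * u.1, t.2 + u.2) | t <- P, u <- Q].

Lemma peval_cat x P Q : peval x (P ++ Q) = peval x P + peval x Q.
Proof. by rewrite /peval big_cat. Qed.

Lemma pnorm_cat d P Q : pnorm d (P ++ Q) = pnorm d P + pnorm d Q.
Proof. by rewrite /pnorm big_cat. Qed.

Lemma peval_pmul x P Q : peval x (pmul P Q) = peval x P * peval x Q.
Proof.
rewrite /peval /pmul big_allpairs_dep big_distrlr/=; apply: eq_bigr => t _.
by apply: eq_bigr => u _; rewrite monomD mulrACA.
Qed.

Lemma pnorm_pmul d P Q : pnorm d (pmul P Q) = pnorm d P * pnorm d Q.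
Proof.
rewrite /pnorm /pmul big_allpairs_dep big_distrlr/=; apply: eq_bigr => t _.
by apply: eq_bigr => u _; rewrite monomD normrM mulrACA.
Qed.

Lemma pnorm_ge0 d P : 0 <= d -> 0 <= pnorm d P.
Proof.
by move=> d0; apply: sumr_ge0 => t _; rewrite mulr_ge0// monom_const_ge0.
Qed.

Lemma norm_peval_le d x P : cube d x -> `|peval x P| <= pnorm d P.
Proof.
move=> xd; rewrite (le_trans (ler_norm_sum _ _ _))//; apply: ler_sum => t _.
by rewrite normrM ler_wpM2l// norm_monom_le.
Qed.

Definition pflatten (P : nat -> fpoly) n : fpoly :=
  flatten [seq P k | k <- index_iota 0 n].

Lemma peval_flatten x P n :
  peval x (pflatten P n) = \sum_(0 <= k < n) peval x (P k).
Proof. by rewrite /peval /pflatten big_flatten/= big_map. Qed.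

Lemma pnorm_flatten d P n :
  pnorm d (pflatten P n) = \sum_(0 <= k < n) pnorm d (P k).
Proof. by rewrite /pnorm /pflatten big_flatten/= big_map. Qed.

(* [F] is the sum on the cube of radius [d] of a power series whose l1-norm,
   the sum of the [`|c_m| * d ^ |m|], is at most [K]. *)
Definition majorized d (F : 'M[R]_(p, q) -> R) K := exists P : nat -> fpoly,
  (forall n, \sum_(0 <= k < n) pnorm d (P k) <= K) /\
  (forall x, cube d x -> \sum_(0 <= k < n) peval x (P k) @[n --> \oo] --> F x).

Lemma majorized_ge0 d F K : majorized d F K -> 0 <= K.
Proof. by move=> [P [/(_ 0%N)]]; rewrite big_geq. Qed.

Lemma majorized_norm d F K x : majorized d F K -> cube d x -> `|F x| <= K.
Proof.
move=> [P [PK PF]] xd.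
apply: (cvgn_le (cvg_norm (PF _ xd))) => n.
rewrite -peval_flatten (le_trans (norm_peval_le _ xd))// pnorm_flatten.
exact: PK.
Qed.

End Majorants.

Lemma cvgn_split (R : realType) (u v : nat -> R) (l : R) :
  u n @[n --> \oo] --> l -> v n - u n @[n --> \oo] --> 0 -> v n @[n --> \oo] --> l.
Proof.
move=> ul vu; rewrite -[l]addr0.
have -> : v = (fun n => u n + (v n - u n)) by apply/funext => n; rewrite subrKC.
exact: cvgD.
Qed.

(* Sums over growing squares: the n-th L-shaped layer is added at step n. *)
Lemma sum_square_layers (V : zmodType) (a : nat -> nat -> V) N :
  \sum_(0 <= n < N) (\sum_(0 <= i < n.+1) a n i + \sum_(0 <= k < n) a k n) =
  \sum_(0 <= k < N) \sum_(0 <= i < N) a k i.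
Proof.
elim: N => [|N IH]; first by rewrite !big_geq.
rewrite big_nat_recr//= IH [in RHS]big_nat_recr//= [in LHS]addrA addrAC.
congr (_ + _); rewrite -big_split/=; apply: eq_bigr => k _.
by rewrite big_nat_recr.
Qed.

Lemma nonneg_series_tail (R : realType) (K : nat -> R) (B e : R) :
  (forall k, 0 <= K k) -> (forall n, \sum_(0 <= k < n) K k <= B) -> 0 < e ->
  exists m, forall n, \sum_(m <= k < n) K k <= e.
Proof.
move=> K0 KB e0.
have ndK : nondecreasing_seq (fun n => \sum_(0 <= k < n) K k).
  by apply: nondecreasing_series => n _ _; exact: K0.
have cK : cvgn (fun n => \sum_(0 <= k < n) K k).
  by apply: nondecreasing_is_cvgn => //; exists B => _ [n _ <-].
have /cvgrPdist_le/(_ _ e0)[m _ /(_ m (leqnn m))/=] := cK.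
move=> mE; exists m => n; have [nm|/ltnW mn] := leqP n m.
  by rewrite big_geq// ltW.
have := nondecreasing_cvgn_le ndK cK n; rewrite (big_cat_nat (n := m))//=.
move: mE; rewrite ler_norml => /andP[_]; lra.
Qed.

(** Tannery's argument: the summable bounds [K] make the rows from [m] on negligible uniformly in
    [n], and the finitely many remaining rows converge one by one. *)
Lemma cvg_square_sum (R : realType) (a : nat -> nat -> R) (f K : nat -> R) (F B : R) :
  (forall k n, `|\sum_(0 <= i < n) a k i| <= K k) ->
  (forall n, \sum_(0 <= k < n) K k <= B) ->
  (forall k, \sum_(0 <= i < n) a k i @[n --> \oo] --> f k) ->
  \sum_(0 <= k < n) f k @[n --> \oo] --> F ->
  \sum_(0 <= k < n) \sum_(0 <= i < n) a k i @[n --> \oo] --> F.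
Proof.
move=> aK KB af fF; apply: (cvgn_split fF).
have K0 k : 0 <= K k by exact: le_trans (aK k 0%N).
have fK k : `|f k| <= K k by exact: (cvgn_le (cvg_norm (af k))).
apply/cvgrPdist_le => e e0.
have e40 : 0 < e / 4 by lra.
have [m mK] := nonneg_series_tail K0 KB e40.
have : \sum_(0 <= k < m) (\sum_(0 <= i < n) a k i - f k) @[n --> \oo] --> 0.
  rewrite [X in _ --> X](_ : 0 = \sum_(0 <= k < m) (f k - f k)); last first.
    by rewrite big1// => k _; rewrite subrr.
  by apply: cvg_big => [|k _]; [exact: add_continuous|apply: cvgB => //; exact: cvg_cst].
have e20 : 0 < e / 2 by lra.
move=> /cvgrPdist_le/(_ _ e20) near1.
near=> n.
have mn : (m <= n)%N by near: n; exact: nbhs_infty_ge.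
rewrite -sumrB (big_cat_nat (n := m))//= sub0r normrN.
have H1 : `|0 - \sum_(0 <= k < m) (\sum_(0 <= i < n) a k i - f k)| <= e / 2.
  by near: n.
rewrite sub0r normrN in H1.
apply: le_trans (ler_normD _ _) _; rewrite [leRHS](splitr e); apply: lerD => //.
apply: le_trans (ler_norm_sum _ _ _) _.
apply: (@le_trans _ _ (\sum_(m <= k < n) (K k + K k))).
  apply: ler_sum => k _; apply: le_trans (ler_normB _ _) _.
  exact: lerD.
rewrite big_split/=; have := mK n; lra.
Unshelve. all: by end_near. Qed.

Section MajorizedAlgebra.
Variables (R : realType) (p q : nat) (d : R).
Hypothesis d0 : 0 < d.
Implicit Types (F G : 'M[R]_(p, q) -> R) (K L : R).

Local Notation majorized := (@majorized R p q d).

Lemma majorized_ext F G K :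
  (forall x, cube d x -> F x = G x) -> majorized F K -> majorized G K.
Proof. by move=> FG [P [PK PF]]; exists P; split=> // x xd; rewrite -FG//; exact: PF. Qed.

Lemma majorized_le F K L : K <= L -> majorized F K -> majorized F L.
Proof. by move=> KL [P [PK PF]]; exists P; split=> // n; exact: le_trans KL. Qed.

Lemma majorized_fpoly (P : fpoly R p q) : majorized (fun x => peval x P) (pnorm d P).
Proof.
exists (fun n => if n is 0%N then P else [::]).
have E (phi : fpoly R p q -> R) : phi [::] = 0 -> forall n,
    \sum_(0 <= k < n.+1) phi (if k is 0%N then P else [::]) = phi P.
  by move=> phi0 n; rewrite big_nat_recl//= big1 ?addr0.
have e0 (x : 'M[R]_(p, q)) : peval x [::] = 0 by rewrite /peval big_nil.
have n0 : pnorm d ([::] : fpoly R p q) = 0 by rewrite /pnorm big_nil.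
split=> [[|n]|x xd].
- by rewrite big_geq// pnorm_ge0// ltW.
- by rewrite (E (pnorm d)).
- rewrite -(cvg_shiftS (fun n => \sum_(0 <= k < n) _))/=.
  under eq_fun do rewrite (E (peval x))//.
  exact: cvg_cst.
Qed.

Lemma majorized_cst (c : R) : majorized (fun=> c) `|c|.
Proof.
have := majorized_fpoly [:: (c, 0)].
rewrite /pnorm big_seq1 monom0 mulr1; apply: majorized_ext => x _.
by rewrite /peval big_seq1 monom0 mulr1.
Qed.

Lemma majorized0 K : 0 <= K -> majorized (fun=> 0) K.
Proof. by move=> K0; apply: majorized_le (majorized_cst 0); rewrite normr0. Qed.

Lemma majorized_coord i j : majorized (fun x => x i j) d.
Proof.
have := majorized_fpoly [:: (1, \matrix_(k, l) ((k == i) && (l == j) : nat))].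
rewrite /pnorm big_seq1 monom_delta mxE normr1 mul1r; apply: majorized_ext.
by move=> x _; rewrite /peval big_seq1 monom_delta mul1r.
Qed.

Lemma majorizedD F G K L :
  majorized F K -> majorized G L -> majorized (fun x => F x + G x) (K + L).
Proof.
move=> [P [PK PF]] [Q [QL QG]]; exists (fun n => P n ++ Q n); split=> [n|x xd].
  by under eq_bigr do rewrite pnorm_cat; rewrite big_split/= lerD.
under eq_fun do (under eq_bigr do rewrite peval_cat); under eq_fun do rewrite big_split/=.
by apply: cvgD; [exact: PF|exact: QG].
Qed.

Lemma majorizedM F G K L :
  majorized F K -> majorized G L -> majorized (fun x => F x * G x) (K * L).
Proof.
move=> [P [PK PF]] [Q [QL QG]].
exists (fun n => pmul (P n) (pflatten Q n.+1) ++ pmul (pflatten P n) (Q n)).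
(* Telescoping: P_(n+1) Q_(n+1) - P_n Q_n = p_n Q_(n+1) + P_n q_n. *)
have E (phi : fpoly R p q -> R) :
    (forall P1 P2, phi (P1 ++ P2) = phi P1 + phi P2) ->
    (forall P1 P2, phi (pmul P1 P2) = phi P1 * phi P2) ->
    (forall P1 n, phi (pflatten P1 n) = \sum_(0 <= k < n) phi (P1 k)) ->
    forall n, \sum_(0 <= k < n)
      phi (pmul (P k) (pflatten Q k.+1) ++ pmul (pflatten P k) (Q k)) =
    (\sum_(0 <= k < n) phi (P k)) * (\sum_(0 <= k < n) phi (Q k)).
  move=> phiD phiM phif; elim=> [|n IH]; first by rewrite !big_geq// mul0r.
  rewrite big_nat_recr//= IH phiD !phiM !phif !big_nat_recr//=.
  ring.
split=> [n|x xd].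
  rewrite (E (pnorm d)); [|exact: pnorm_cat|exact: pnorm_pmul|exact: pnorm_flatten].
  by apply: ler_pM => //; apply: sumr_ge0 => k _; rewrite pnorm_ge0// ltW.
under eq_fun do
  rewrite (E (peval x) (peval_cat x) (peval_pmul x) (peval_flatten x)).
by apply: cvgM; [exact: PF|exact: QG].
Qed.

Lemma majorizedZ c F K : majorized F K -> majorized (fun x => c * F x) (`|c| * K).
Proof. by move=> FK; apply: majorizedM => //; exact: majorized_cst. Qed.

Lemma majorizedN F K : majorized F K -> majorized (fun x => - F x) K.
Proof.
move=> /(majorizedZ (-1)); rewrite normrN1 mul1r.
by apply: majorized_ext => x _; rewrite mulN1r.
Qed.

Lemma majorizedB F G K L :
  majorized F K -> majorized G L -> majorized (fun x => F x - G x) (K + L).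
Proof. by move=> FK /majorizedN; exact: majorizedD. Qed.

Lemma majorized_sum (I : Type) (r : seq I) (P : pred I) (F : I -> _ -> R) (K : I -> R) :
  (forall i, P i -> majorized (F i) (K i)) ->
  majorized (fun x => \sum_(i <- r | P i) F i x) (\sum_(i <- r | P i) K i).
Proof.
move=> FK; elim: r => [|i r IH].
  rewrite big_nil; apply: majorized_ext (majorized0 (lexx 0)) => x _.
  by rewrite big_nil.
rewrite big_cons; case: ifP => Pi; last first.
  by apply: majorized_ext IH => x _; rewrite big_cons Pi.
by apply: majorized_ext (majorizedD (FK i Pi) IH) => x _; rewrite big_cons Pi.
Qed.

Lemma majorizedX F K n : majorized F K -> majorized (fun x => F x ^+ n) (K ^+ n).
Proof.
move=> FK; elim: n => [|n IH].
  rewrite expr0 -[in X in majorized _ X](normr1 R).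
  by apply: majorized_ext (majorized_cst 1) => x _; rewrite expr0.
by rewrite exprS; apply: majorized_ext (majorizedM FK IH) => x _; rewrite exprS.
Qed.

(** Completeness of the norm. [majorized] asks for a single sequence of polynomials, so the double
    family is enumerated by growing squares, whose partial sums are finite. *)
Lemma majorized_series (f : nat -> _ -> R) F (K : nat -> R) L :
  (forall k, majorized (f k) (K k)) ->
  (forall n, \sum_(0 <= k < n) K k <= L) ->
  (forall x, cube d x -> \sum_(0 <= k < n) f k x @[n --> \oo] --> F x) ->
  majorized F L.
Proof.
move=> fK KL fF; have [P PP] := choice fK.
exists (fun n => pflatten (P n) n.+1 ++ pflatten (fun k => P k n) n); split=> [N|x xd].
  under eq_bigr do rewrite pnorm_cat !pnorm_flatten.
  rewrite (sum_square_layers (fun k i => pnorm d (P k i))) (le_trans _ (KL N))//.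
  by apply: ler_sum => k _; case: (PP k).
under eq_fun do (under eq_bigr do rewrite peval_cat !peval_flatten).
under eq_fun do rewrite (sum_square_layers (fun k i => peval x (P k i))).
apply: (@cvg_square_sum _ _ (fun k => f k x) K _ L) => // [k n|k|].
- rewrite -peval_flatten (le_trans (norm_peval_le _ xd))// pnorm_flatten.
  by case: (PP k).
- by case: (PP k) => _; apply.
- exact: fF.
Qed.

Lemma majorized_lim (f : nat -> _ -> R) F K0 (K : nat -> R) L :
  majorized (f 0%N) K0 ->
  (forall k, majorized (fun x => f k.+1 x - f k x) (K k)) ->
  (forall n, \sum_(0 <= k < n) K k <= L) ->
  (forall x, cube d x -> f n x @[n --> \oo] --> F x) ->
  majorized F (K0 + L).
Proof.
move=> f0 fK KL fF.
suff : majorized (fun x => F x - f 0%N x) L.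
  by move=> /(majorizedD f0); apply: majorized_ext => x _; rewrite subrKC.
apply: (majorized_series fK KL) => x xd.
under eq_fun do rewrite telescope_sumr//.
by apply: cvgB; [exact: fF|exact: cvg_cst].
Qed.

End MajorizedAlgebra.

(** * Inverses and logarithms in the norm *)

Lemma ln1p_taylor (R : realType) (n : nat) (y : R) : `|y| <= 2^-1 ->
  `|ln (1 + y) - \sum_(k < n) (- 1) ^+ k * y ^+ k.+1 / k.+1%:R| <= 2^-1 ^+ n.
Proof.
move=> y2.
pose P : {poly R} := \sum_(k < n) ((- 1) ^+ k / k.+1%:R) *: 'X^(k.+1).
have PE t : P.[t] = \sum_(k < n) (- 1) ^+ k * t ^+ k.+1 / k.+1%:R.
  by rewrite horner_sum; apply: eq_bigr => k _; rewrite hornerZ hornerXn mulrAC.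
have dPE t : P^`().[t] = \sum_(k < n) (- t) ^+ k.
  rewrite raddf_sum horner_sum; apply: eq_bigr => k _.
  rewrite /= derivZ hornerZ derivXn hornerMn hornerXn/= -[in RHS]mulN1r exprMn.
  by rewrite -mulr_natr; field; rewrite nat1r pnatr_eq0.
pose g : R -> R := (@ln R \o (fun t => 1 + t)) - horner P.
(* Summing the geometric series leaves this derivative of the remainder. It is at most [2 / 2 ^ n],
   and the mean value theorem is applied on a length of at most [1 / 2]. *)
have dg (t : R) : `|t| <= 2^-1 -> is_derive t (1 : R) g ((- t) ^+ n / (1 + t)).
  rewrite ler_norml => /andP[t1 t2].
  have t0 : 0 < 1 + t by lra.
  have d1 : is_derive t (1 : R) (fun t : R => 1 + t) 1.
    by have := is_deriveD (is_derive_cst (1 : R) t 1) (is_derive_id t (1 : R)); rewrite add0r.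
  have d2 := is_derive1_comp (is_derive1_ln t0) d1.
  have := is_deriveB d2 (is_derive_poly P t); rewrite dPE mulr1.
  congr (is_derive _ _ _ _).
  have := subrX1 (- t) n; have -> : - t - 1 = - (1 + t) by ring.
  move=> E; apply: (mulfI (lt0r_neq0 t0)).
  rewrite mulrBr divff ?lt0r_neq0// mulrC.
  rewrite [in RHS]mulrC mulrVK ?unitfE ?lt0r_neq0//.
  by rewrite mulrC -(opprK (_ * \sum_(_ < _) _)) -mulNr -E; ring.
have gE : ln (1 + y) - \sum_(k < n) (- 1) ^+ k * y ^+ k.+1 / k.+1%:R = g y - g 0.
  rewrite /g !fctE/= addr0 ln1 !PE [X in _ - (0 - X)]big1 ?subr0// => k _.
  by rewrite expr0n/= mulr0 mul0r.
have bnd a b : a <= b -> - 2^-1 <= a -> b <= 2^-1 -> `|g b - g a| <= 2^-1 ^+ n * 2 * (b - a).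
  move=> ab a2 b2.
  have ninab t : t \in `[a, b] -> `|t| <= 2^-1.
    by rewrite in_itv/= => /andP[at_ tb]; rewrite ler_norml; apply/andP; split; lra.
  have [||t tab ->] := @MVT_segment R g (fun t => (- t) ^+ n / (1 + t)) a b ab.
  - by move=> t /subset_itv_oo_cc tab; exact/dg/ninab.
  - apply: derivable_within_continuous => t tab.
    by have [] := dg t (ninab _ tab).
  - have t2 := ninab _ tab.
    rewrite !normrM normrX normrN (ger0_norm (_ : 0 <= b - a)) ?subr_ge0//.
    apply: ler_wpM2r; first by rewrite subr_ge0.
    apply: ler_pM => //.
      by rewrite lerXn2r ?nnegrE.
    move: t2; rewrite ler_norml => /andP[t1 t2].
    rewrite normfV ger0_norm; last lra.
    by rewrite -[leRHS]invrK lef_pV2 ?posrE; lra.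
have n0 : 0 <= 2^-1 ^+ n :> R by rewrite exprn_ge0.
move: y2; rewrite gE ler_norml => /andP[y1 y2].
have [y0|/ltW y0] := leP 0 y.
  by apply: le_trans (bnd 0 y _ _ _) _ => //; try lra; rewrite -mulrA ler_piMr//; lra.
rewrite distrC.
by apply: le_trans (bnd y 0 _ _ _) _ => //; try lra; rewrite -mulrA ler_piMr//; lra.
Qed.

Lemma cvg_ln1p (R : realType) (y : R) : `|y| <= 2^-1 ->
  \sum_(0 <= k < n) (- 1) ^+ k * y ^+ k.+1 / k.+1%:R @[n --> \oo] --> ln (1 + y).
Proof.
move=> y2; apply/cvgrPdist_le => e e0.
have : (2^-1 : R) ^+ n @[n --> \oo] --> 0.
  have := @cvg_geometric R 1 2^-1; rewrite ger0_norm// invf_lt1// ltr1n => /(_ isT).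
  by rewrite /geometric/=; under eq_fun do rewrite mul1r.
move=> /cvgrPdist_le/(_ _ e0); apply: filterS => n.
rewrite sub0r normrN ger0_norm ?exprn_ge0// big_mkord; apply: le_trans.
exact: ln1p_taylor.
Qed.

Section MajorizedFunctions.
Variables (R : realType) (p q : nat) (d : R).
Hypothesis d0 : 0 < d.
Implicit Types (F G : 'M[R]_(p, q) -> R) (K L : R).

Local Notation majorized := (@majorized R p q d).

Lemma geometric_sum_le (z : R) n : 0 <= z < 1 ->
  \sum_(0 <= k < n) z ^+ k <= (1 - z)^-1.
Proof.
move=> /andP[z0 z1]; rewrite big_mkord.
have z10 : 0 < 1 - z by lra.
rewrite -(ler_pM2l z10) divff ?lt0r_neq0//.
by rewrite -[in leLHS](opprB z 1) mulNr -subrX1 opprB lerBlDr lerDl exprn_ge0.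
Qed.

(** Neumann series around the constant [c]; the bound is the sum of [c^-1 * (K / c) ^ k]. *)
Lemma majorized_inv F (c K : R) : K < c -> majorized (fun x => F x - c) K ->
  majorized (fun x => (F x)^-1) (c - K)^-1.
Proof.
move=> Kc FK; have K0 := majorized_ge0 FK.
have c0 : 0 < c by apply: le_lt_trans Kc.
have z1 : 0 <= K / c < 1 by rewrite ltr_pdivrMr// mul1r Kc divr_ge0// ltW.
apply: (@majorized_series _ _ _ d (fun k x => c^-1 * (- c^-1 * (F x - c)) ^+ k) _
   (fun k => c^-1 * (K / c) ^+ k)).
- move=> k; apply: majorized_le (majorizedZ d0 c^-1 (majorizedX d0 k (majorizedZ d0 (-
  c^-1) FK))).
  by rewrite normrN gtr0_norm ?invr_gt0// (mulrC _ K).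
- move=> n; rewrite -mulr_sumr.
  rewrite [leRHS](_ : _ = c^-1 * (1 - K / c)^-1); last first.
    by rewrite -invfM mulrBr mulr1 mulrCA divff ?mulr1// gt_eqF.
  by rewrite ler_pM2l ?invr_gt0// geometric_sum_le.
- move=> x xd; pose z := - c^-1 * (F x - c).
  have zK : `|z| < 1.
    have /andP[_] := z1; apply: le_lt_trans.
    rewrite /z mulNr normrN normrM normfV (gtr0_norm c0) mulrC.
    by rewrite ler_pM2r ?invr_gt0// (majorized_norm FK).
  have := cvg_geometric_series (a := c^-1) zK.
  rewrite [X in _ --> X -> _](_ : _ = (F x)^-1); last first.
    rewrite -invfM; congr _^-1; rewrite /z; field; by rewrite gt_eqF.
  by apply: cvg_trans; apply: near_eq_cvg; apply: nearW => n; rewrite /series/=.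
Qed.

(** The coefficients of the logarithmic series are at most 1 in absolute value, so the norm is at
    most [K / (1 - K)]. *)
Lemma majorized_ln1p F K : K <= 2^-1 -> majorized F K ->
  majorized (fun x => ln (1 + F x)) (2 * K).
Proof.
move=> K2 FK; have K0 := majorized_ge0 FK.
apply: (@majorized_series _ _ _ d
  (fun k x => ((- 1) ^+ k / k.+1%:R) * F x ^+ k.+1) _ (fun k => K * K ^+ k)).
- move=> k; apply: majorized_le (majorizedZ d0 _ (majorizedX d0 k.+1 FK)).
  rewrite normrM normrX normrN1 expr1n mul1r exprS ger0_norm// ler_piMl//.
    by rewrite mulr_ge0// exprn_ge0.
  by rewrite invf_le1// ler1n.
- move=> n; rewrite -mulr_sumr mulrC ler_wpM2r//.
  apply: le_trans (geometric_sum_le _ _) _; first by apply/andP; split; lra.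
  by rewrite -[leRHS]invrK lef_pV2 ?posrE; lra.
- move=> x xd.
  have := @cvg_ln1p _ (F x) (le_trans (majorized_norm FK xd) K2).
  by under eq_fun do under eq_bigr do rewrite mulrAC.
Qed.

Lemma majorized_ln F (c K : R) : 0 < c -> K <= c / 2 -> majorized (fun x => F x - c) K ->
  majorized (fun x => ln (F x)) (`|ln c| + 1).
Proof.
move=> c0 Kc FK.
have K1 : `|c^-1| * K <= 2^-1.
  rewrite gtr0_norm ?invr_gt0// mulrC ler_pdivrMr//; lra.
have := majorizedD (majorized_cst p q d0 (ln c)) (majorized_ln1p K1 (majorizedZ d0 c^-1 FK)).
move=> /(majorized_le (L := `|ln c| + 1))H; apply: majorized_ext (H _) => [x xd|]; last lra.
have Fx : 0 < F x.
  have := majorized_norm FK xd; rewrite ler_norml => /andP[]; lra.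
have -> : 1 + c^-1 * (F x - c) = F x / c by field; rewrite gt_eqF.
by rewrite ln_div ?posrE// subrKC.
Qed.

End MajorizedFunctions.

(** * Unconditional sums and regrouping into a power series *)

Lemma cvgn_addl (R : realType) (n : nat) (u : nat -> R) (l : R) :
  u N @[N --> \oo] --> l -> u (n + N)%N @[N --> \oo] --> l.
Proof.
have -> : (fun N => u (n + N)%N) = (fun N => u (N + n)%N).
  by apply/funext => N; rewrite addnC.
by rewrite (cvg_shiftn n u).
Qed.

Section FamilySum.
Variables (R : realType) (I : choiceType).
Local Open Scope ereal_scope.

Lemma esum_uniq_le (a : I -> \bar R) (J : seq I) : uniq J ->
  \sum_(m <- J) a m <= \esum_(m in setT) a m.
Proof.
move=> uJ; apply: esum_ge; exists [set` J]; last by rewrite fsbig_seq.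
by split=> //; exact/finite_seqP.
Qed.

Lemma esum_uniq_ub (a : I -> \bar R) (B : \bar R) :
  (forall J, uniq J -> \sum_(m <- J) a m <= B) -> \esum_(m in setT) a m <= B.
Proof.
move=> aB; apply: ge_ereal_sup => _ [X [fX _]] <-.
by rewrite fsbig_finite//= aB.
Qed.

Lemma esum_uniq_adherent (a : I -> R) (e : R) : (0 < e)%R ->
  (forall m, 0 <= a m)%R -> \esum_(m in setT) (a m)%:E < +oo ->
  exists J0 : seq I, forall J, uniq J -> {subset J0 <= J} ->
    (`|fine (\esum_(m in setT) (a m)%:E) - \sum_(m <- J) a m| <= e)%R.
Proof.
move=> e0 a0 aoo.
have afin : \esum_(m in setT) (a m)%:E \is a fin_num.
  by rewrite ge0_fin_numE// esum_ge0// => m _; rewrite lee_fin.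
have := ub_ereal_sup_adherent e0 afin; move=> [_ [X [fX _]] <-].
rewrite fsbig_finite//= -[ereal_sup _]/(\esum_(m in setT) (a m)%:E) -(fineK afin) sumEFin.
rewrite -EFinB lte_fin => lt1.
pose J0 : seq I := finmap.enum_fset (fset_set X).
rewrite -/J0 in lt1; exists J0 => J uJ sJ.
have : \sum_(m <- J) (a m)%:E <= \esum_(m in setT) (a m)%:E by exact: esum_uniq_le.
rewrite -[leRHS](fineK afin) sumEFin lee_fin => le2.
have le3 : (\sum_(m <- J0) a m <= \sum_(m <- J) a m)%R.
  rewrite [leRHS](perm_big ([seq m <- J | m \in J0] ++ [seq m <- J | m \notin J0]))/=; last
    first.
    by rewrite perm_sym perm_filterC.
  rewrite big_cat/= -[leLHS]addr0 lerD ?sumr_ge0// le_eqVlt; apply/orP; left.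
  apply/eqP/perm_big/uniq_perm; rewrite ?filter_uniq//; first exact: finmap.fset_uniq.
  move=> m; rewrite mem_filter; case: (boolP (m \in J0)) => //= mX.
  by rewrite sJ.
rewrite ler_norml; apply/andP; split; lra.
Qed.

(* Unconditional convergence: along the directed set of finite index sets. *)
Lemma family_sumE (t : I -> R) (S K : R) :
  (forall J, uniq J -> \sum_(m <- J) `|t m| <= K)%R ->
  (forall e : R, 0 < e -> exists J0 : seq I, forall J, uniq J -> {subset J0 <= J} ->
     `|S - \sum_(m <- J) t m| <= e)%R ->
  summable setT (fun m => (t m)%:E) /\ family_sum (fun m => (t m)%:E) = S.
Proof.
move=> tK tS.
have sumt : summable setT (fun m => (t m)%:E).
  apply: (@le_lt_trans _ _ K%:E); last exact: ltry.
  by apply: esum_uniq_ub => J uJ; rewrite sumEFin lee_fin; exact: tK.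
split=> //.
pose tp m : R := Num.max (t m) 0%R; pose tn m : R := Num.max (- t m)%R 0%R.
have pE : (fun m => (t m)%:E)^\+ = (fun m => (tp m)%:E).
  by apply/funext => m; rewrite funeposE -EFin_max.
have nE : (fun m => (t m)%:E)^\- = (fun m => (tn m)%:E).
  by apply/funext => m; rewrite funenegE -EFinN -EFin_max.
have tp0 m : (0 <= tp m)%R by rewrite le_max lexx orbT.
have tn0 m : (0 <= tn m)%R by rewrite le_max lexx orbT.
have poo : \esum_(m in setT) (tp m)%:E < +oo.
  apply: le_lt_trans sumt; apply: le_esum => m _; rewrite lee_fin ge_max normr_ge0.
  by rewrite ler_norm.
have noo : \esum_(m in setT) (tn m)%:E < +oo.
  apply: le_lt_trans sumt; apply: le_esum => m _; rewrite lee_fin ge_max normr_ge0.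
  by rewrite -normrN ler_norm.
rewrite /family_sum pE nE fineB; last 2 first.
  by rewrite ge0_fin_numE// esum_ge0// => m _; rewrite lee_fin.
  by rewrite ge0_fin_numE// esum_ge0// => m _; rewrite lee_fin.
apply/eqP; rewrite -subr_eq0 -normr_le0; apply/ler_addgt0Pl => e e0; rewrite addr0.
have e30 : (0 < e / 3)%R by lra.
have [J1 H1] := esum_uniq_adherent e30 tp0 poo.
have [J2 H2] := esum_uniq_adherent e30 tn0 noo.
have [J3 H3] := tS _ e30.
pose J := undup (J1 ++ J2 ++ J3).
have uJ : uniq J by exact: undup_uniq.
have {}H1 : _ := H1 J uJ _; have {}H2 : _ := H2 J uJ _; have {}H3 : _ := H3 J uJ _.
have : {subset J1 <= J} by move=> m mJ; rewrite mem_undup !mem_cat mJ.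
have : {subset J2 <= J} by move=> m mJ; rewrite mem_undup !mem_cat mJ orbT.
have : {subset J3 <= J} by move=> m mJ; rewrite mem_undup !mem_cat mJ !orbT.
move=> /H3{}H3 /H2{}H2 /H1{}H1.
have E : (\sum_(m <- J) t m = \sum_(m <- J) tp m - \sum_(m <- J) tn m)%R.
  rewrite -sumrB; apply: eq_bigr => m _; rewrite /tp /tn.
  by case: (lerP (t m) 0); case: (lerP (- t m) 0); lra.
rewrite E in H3; move: H1 H2 H3; rewrite !ler_norml.
move=> /andP[? ?] /andP[? ?] /andP[? ?]; apply/andP; split; lra.
Qed.

End FamilySum.

Section Regrouping.
Variables (R : realType) (p q : nat) (d : R).
Hypothesis d0 : 0 < d.
Implicit Types (x : 'M[R]_(p, q)) (m : 'M[nat]_(p, q)) (P : fpoly R p q).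

Definition pcoef P m : R := \sum_(t <- P | t.2 == m) t.1.

Lemma sum_pcoef_le P (J : seq 'M[nat]_(p, q)) : uniq J ->
  \sum_(m <- J) `|pcoef P m| * monom (const_mx d) m <= pnorm d P.
Proof.
have d0' := ltW d0; move=> uJ; elim: P => [|t P IH].
  by rewrite /pnorm big_nil big1// => m _; rewrite /pcoef big_nil normr0 mul0r.
apply: (@le_trans _ _ (\sum_(m <- J) ((if t.2 == m then `|t.1| else 0) * monom (const_mx d) m +
    `|pcoef P m| * monom (const_mx d) m))).
  apply: ler_sum => m _; rewrite -mulrDl ler_wpM2r ?monom_const_ge0//.
  by rewrite /pcoef big_cons; case: eqP => _; [exact: ler_normD|rewrite add0r].
rewrite big_split/= /pnorm big_cons lerD//.
have [tJ|tJ] := boolP (t.2 \in J); last first.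
  rewrite big_seq big1 ?mulr_ge0 ?monom_const_ge0// => m mJ.
  by case: eqP => [tm|]; [move: tJ; rewrite tm mJ|rewrite mul0r].
rewrite (bigD1_seq _ tJ uJ)/= eqxx big1 ?addr0// => m.
by rewrite eq_sym => /negPf ->; rewrite mul0r.
Qed.

Lemma pevalE x P (J : seq 'M[nat]_(p, q)) : uniq J ->
  {subset [seq t.2 | t <- P] <= J} -> peval x P = \sum_(m <- J) pcoef P m * monom x m.
Proof.
move=> uJ; elim: P => [|t P IH] sJ.
  by rewrite /peval big_nil big1// => m _; rewrite /pcoef big_nil mul0r.
rewrite /peval big_cons -/(peval x P) IH; last first.
  by move=> m mP; apply: sJ; rewrite inE mP orbT.
have tJ : t.2 \in J by apply: sJ; rewrite inE eqxx.
rewrite (bigD1_seq _ tJ uJ)/= [in RHS](bigD1_seq _ tJ uJ)/= addrA -mulrDl.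
congr (_ * _ + _); first by rewrite /pcoef [RHS]big_cons eqxx.
by apply: eq_bigr => m; rewrite eq_sym => /negPf tm; rewrite /pcoef big_cons tm.
Qed.

(** The coefficient of a monomial is collected over the whole sequence of polynomials. It converges
    absolutely because the monomial is positive at [const_mx d] and the norms are summable. *)
Lemma majorized_power_series (F : 'M[R]_(p, q) -> R) K : majorized d F K ->
  exists c : 'M[nat]_(p, q) -> R, forall x, cube d x ->
    summable setT (fun m => (c m * monom x m)%:E) /\
    F x = family_sum (fun m => (c m * monom x m)%:E).
Proof.
move=> [P [PK PF]].
pose C n m := pcoef (pflatten P n) m.
have CE n m : C n m = \sum_(0 <= k < n) pcoef (P k) m.
  by rewrite /C /pcoef /pflatten big_flatten big_map.
have cC m : cvgn (fun n => C n m).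
  have -> : (fun n => C n m) = series (fun k => pcoef (P k) m).
    by apply/funext => n; rewrite CE.
  apply: normed_cvg; apply: nondecreasing_is_cvgn.
    by apply: nondecreasing_series => k _ _ /=.
  exists (K / monom (const_mx d) m) => _ [n _ <-].
  rewrite ler_pdivlMr ?monom_const_gt0// (le_trans _ (PK n))// mulr_suml.
  apply: ler_sum => k _.
  by have := @sum_pcoef_le (P k) [:: m] isT; rewrite big_seq1.
pose c m := limn (fun n => C n m).
have Cc m : C n m @[n --> \oo] --> c m by exact: cC.
have abs_c J : uniq J -> \sum_(m <- J) `|c m| * monom (const_mx d) m <= K.
  move=> uJ.
  apply: (@cvgn_le _ (fun n => \sum_(m <- J) `|C n m| * monom (const_mx d) m)) => [|n].
    apply: cvg_big => [|m _]; first exact: add_continuous.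
    by apply: cvgM; [exact: cvg_norm|exact: cvg_cst].
  by apply: le_trans (sum_pcoef_le _ uJ) _; rewrite pnorm_flatten.
(* The [n]-th partial polynomial approximates the limit series in l1-norm, uniformly over finite
   sets [J] of monomials. *)
have tail_c n e : (forall N, \sum_(n <= k < N) pnorm d (P k) <= e) ->
    forall J, uniq J -> \sum_(m <- J) `|c m - C n m| * monom (const_mx d) m <= e.
  move=> ne J uJ.
  apply: (@cvgn_le _ (fun N => \sum_(m <- J) `|C (n + N)%N m - C n m| * monom (const_mx d)
    m)) => [|N].
    apply: cvg_big => [|m _]; first exact: add_continuous.
    apply: cvgM; last exact: cvg_cst.
    apply: cvg_norm; apply: cvgB; last exact: cvg_cst.
    exact: (cvgn_addl n (Cc m)).
  have -> : \sum_(m <- J) `|C (n + N)%N m - C n m| * monom (const_mx d) m =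
      \sum_(m <- J) `|pcoef (pflatten (fun k => P (n + k)%N) N) m| * monom (const_mx d) m.
    apply: eq_bigr => m _; congr (`|_| * _).
    rewrite !CE (big_cat_nat (n := n)) ?leq_addr//= addrAC subrr add0r.
    rewrite -{1}[n]add0n big_addn addnC addnK.
    by rewrite /pcoef /pflatten big_flatten big_map; apply: eq_bigr => k _; rewrite addnC.
  apply: le_trans (sum_pcoef_le _ uJ) _; rewrite pnorm_flatten.
  apply: le_trans (ne (n + N)%N); rewrite -{2}[n]add0n big_addn (addnC n N) addnK.
  by apply: ler_sum => k _; rewrite addnC.
exists c => x xd.
have [] := @family_sumE _ _ (fun m => c m * monom x m) (F x) K; last by split.
  move=> J uJ; apply: le_trans (abs_c J uJ); apply: ler_sum => m _.
  by rewrite normrM ler_wpM2l// norm_monom_le.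
move=> e e0; have e20 : 0 < e / 2 by lra.
have P0 k : 0 <= pnorm d (P k) by rewrite pnorm_ge0// ltW.
have [n nE] := nonneg_series_tail P0 PK e20.
(* Once [J] contains the monomials of the [n]-th partial polynomial, half of [e] covers the distance
   to [F] and half the distance to the sum over [J]. *)
exists [seq t.2 | t <- pflatten P n] => J uJ sJ.
have FP : `|F x - peval x (pflatten P n)| <= e / 2.
  apply: (@cvgn_le _ (fun N => `|peval x (pflatten P (n + N)%N) - peval x (pflatten P n)|))
    => [|N].
    apply: cvg_norm; apply: cvgB; last exact: cvg_cst.
    apply: (@cvgn_addl _ n (fun n => peval x (pflatten P n))).
    by under eq_fun do rewrite peval_flatten; exact: PF.
  rewrite !peval_flatten (big_cat_nat (n := n)) ?leq_addr//= addrAC subrr add0r.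
  apply: le_trans (ler_norm_sum _ _ _) _; apply: le_trans (nE (n + N)%N).
  by apply: ler_sum => k _; exact: norm_peval_le.
have PS : `|peval x (pflatten P n) - \sum_(m <- J) c m * monom x m| <= e / 2.
  rewrite (pevalE _ uJ sJ) -sumrB; apply: le_trans (ler_norm_sum _ _ _) _.
  apply: le_trans (tail_c n _ nE J uJ); apply: ler_sum => m _.
  by rewrite -mulrBl normrM distrC ler_wpM2l// norm_monom_le.
rewrite (splitr e); apply: le_trans (lerD FP PS).
by rewrite -[X in `|X|](subrKA (peval x (pflatten P n))) ler_normD.
Qed.

End Regrouping.

(** * Words and projective maps *)

Section WordSums.
Variables (T : finType) (V : nmodType).

Lemma sum_tuple_cons n (P : pred (seq T)) (F : seq T -> V) :
  \sum_(z : n.+1.-tuple T | P z) F z =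
  \sum_(a : T) \sum_(z : n.-tuple T | P (a :: z)) F (a :: z).
Proof.
rewrite pair_big_dep/=.
rewrite (reindex (fun p : T * n.-tuple T => [tuple of p.1 :: p.2]))/=.
  by apply: eq_bigl => -[a z].
exists (fun z => (thead z, [tuple of behead z])) => [[a z] _|z _] /=.
  by rewrite theadE; congr (_, _); apply/val_inj.
by rewrite [RHS]tuple_eta; apply/val_inj.
Qed.

Lemma sum_words_cons n (F : seq T -> V) :
  \sum_(z : n.+1.-tuple T) F z = \sum_(a : T) \sum_(z : n.-tuple T) F (a :: z).
Proof. exact: (@sum_tuple_cons n xpredT F). Qed.

Lemma sum_words0 (F : seq T -> V) : \sum_(z : 0.-tuple T) F z = F [::].
Proof.
by rewrite (big_pred1 [tuple])// => z; apply/esym/eqP; exact: tuple0.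
Qed.

Lemma sum_words_rcons n (F : seq T -> V) :
  \sum_(z : n.+1.-tuple T) F z = \sum_(z : n.-tuple T) \sum_(a : T) F (rcons z a).
Proof.
elim: n F => [|n IH] F.
  by rewrite sum_words_cons (sum_words0 (fun z => \sum_a F (rcons z a)));
    under eq_bigr do rewrite (sum_words0 (fun z => F (_ :: z))).
rewrite sum_words_cons [RHS](sum_words_cons _ (fun z => \sum_a F (rcons z a))).
by under eq_bigr do rewrite (IH (fun z => F (_ :: z))).
Qed.

End WordSums.

Section Words.
Variables (R : realType) (A B : nat) (Phi : 'I_B -> 'I_A).
Implicit Types (D : 'M[R]_B) (v w : 'rV[R]_B) (a b : 'I_A) (u : seq 'I_A).

Definition mass w : R := \sum_j w 0 j.

(** The linear map behind [f_word]: normalizing once at the end, as in [nword], agrees with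
    normalizing after each letter, and linearity remains available until then. *)
Definition wordm D u w : 'rV[R]_B := foldl (fun v a => v *m symbol_mx Phi D a) w u.

Definition nword D u w : 'rV[R]_B := (mass (wordm D u w))^-1 *: wordm D u w.

(* The derivative at [w], in the direction [v], of [nword D u]. *)
Definition dword D u w v : 'rV[R]_B :=
  (mass (wordm D u w))^-1 *: (wordm D u v - mass (wordm D u v) *: nword D u w).

Lemma massD v w : mass (v + w) = mass v + mass w.
Proof. by rewrite /mass -big_split; apply: eq_bigr => j _; rewrite mxE. Qed.

Lemma massZ k v : mass (k *: v) = k * mass v.
Proof. by rewrite /mass mulr_sumr; apply: eq_bigr => j _; rewrite mxE. Qed.

Lemma massN v : mass (- v) = - mass v.
Proof. by rewrite -scaleN1r massZ mulN1r. Qed.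

Lemma massB v w : mass (v - w) = mass v - mass w.
Proof. by rewrite massD massN. Qed.

Lemma wordm_cat D u u' w : wordm D (u ++ u') w = wordm D u' (wordm D u w).
Proof. exact: foldl_cat. Qed.

Lemma wordm_rcons D u a w : wordm D (rcons u a) w = wordm D u w *m symbol_mx Phi D a.
Proof. by rewrite -cats1 wordm_cat. Qed.

Lemma wordmD D u v w : wordm D u (v + w) = wordm D u v + wordm D u w.
Proof. by elim: u v w => //= a u IH v w; rewrite mulmxDl IH. Qed.

Lemma wordmZ D u k v : wordm D u (k *: v) = k *: wordm D u v.
Proof. by elim: u v => //= a u IH v; rewrite -scalemxAl IH. Qed.

Lemma wordmB D u v w : wordm D u (v - w) = wordm D u v - wordm D u w.
Proof. by rewrite -[- w]scaleN1r wordmD wordmZ scaleN1r. Qed.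

Lemma wordm_sum D u (I : Type) (r : seq I) (P : pred I) (F : I -> 'rV[R]_B) :
  wordm D u (\sum_(i <- r | P i) F i) = \sum_(i <- r | P i) wordm D u (F i).
Proof.
apply: (big_morph (wordm D u) (wordmD D u)).
by have := wordmZ D u 0 0; rewrite !scale0r.
Qed.

Lemma mul_symbol_mx D a w j :
  (w *m symbol_mx Phi D a) 0 j = if Phi j == a then (w *m D) 0 j else 0.
Proof.
rewrite !mxE; case: ifP => ja; last by rewrite big1// => i _; rewrite mxE ja mulr0.
by apply: eq_bigr => i _; rewrite mxE ja.
Qed.

Lemma sum_mul_symbol_mx D w : \sum_a w *m symbol_mx Phi D a = w *m D.
Proof.
apply/rowP => j; rewrite summxE (bigD1 (Phi j))//= mul_symbol_mx eqxx big1 ?addr0//.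
by move=> a; rewrite eq_sym mul_symbol_mx => /negPf ->.
Qed.

Lemma sum_wordm D n w :
  \sum_(z : n.-tuple 'I_A) wordm D z w = iter n (mulmx^~ D) w.
Proof.
elim: n => [|n IH]; first by rewrite (sum_words0 (fun z => wordm D z w)).
rewrite (sum_words_rcons _ (fun z => wordm D z w)) iterS -IH mulmx_suml.
apply: eq_bigr => z _; rewrite -sum_mul_symbol_mx.
by apply: eq_bigr => a _; rewrite wordm_rcons.
Qed.

Lemma mass_mulmx D w : (forall i, \sum_j D i j = 1) -> mass (w *m D) = mass w.
Proof.
move=> D1; rewrite /mass; under eq_bigr do rewrite mxE.
by rewrite exchange_big/=; apply: eq_bigr => i _; rewrite -mulr_sumr D1 mulr1.
Qed.

Lemma r_E D a w : r_ Phi D a w = mass (w *m symbol_mx Phi D a).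
Proof. by rewrite /r_ mxE; apply: eq_bigr => j _; rewrite [const_mx 1 _ _]mxE mulr1. Qed.

Lemma f_E D a w : f_ Phi D a w = nword D [:: a] w.
Proof. by rewrite /f_ /nword r_E. Qed.

Lemma mass_nword D u w : mass (wordm D u w) != 0 -> mass (nword D u w) = 1.
Proof. by move=> m0; rewrite massZ mulVf. Qed.

Lemma wordm_nword D u w : mass (wordm D u w) != 0 ->
  wordm D u w = mass (wordm D u w) *: nword D u w.
Proof. by move=> m0; rewrite scalerA divff// scale1r. Qed.

Lemma nword_cat D u u' w : mass (wordm D u w) != 0 ->
  nword D (u ++ u') w = nword D u' (nword D u w).
Proof.
move=> m0; rewrite [in RHS]/nword wordmZ massZ scalerA invfM invrK mulrAC.
by rewrite divff// mul1r /nword wordm_cat.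
Qed.

Lemma mass_nword_cat D u u' w : mass (wordm D u w) != 0 ->
  mass (wordm D u' (nword D u w)) = mass (wordm D (u ++ u') w) / mass (wordm D u w).
Proof. by move=> m0; rewrite wordmZ massZ wordm_cat mulrC. Qed.

Lemma wordm_face D u a w j : Phi j != a -> wordm D (rcons u a) w 0 j = 0.
Proof. by move=> /negPf ja; rewrite wordm_rcons mul_symbol_mx ja. Qed.

Lemma nword_face D u a w j : Phi j != a -> nword D (rcons u a) w 0 j = 0.
Proof. by move=> ja; rewrite mxE wordm_face// mulr0. Qed.

Lemma nwordB D u w w' : mass (wordm D u w) != 0 -> mass (wordm D u w') != 0 ->
  nword D u w - nword D u w' =
  (mass (wordm D u w') / mass (wordm D u w)) *: dword D u w' (w - w').
Proof.
move=> m0 m0'; rewrite /dword scalerA mulrAC divff// mul1r.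
rewrite wordmB massB scalerBl -wordm_nword// /nword.
set x := wordm D u w; set y := wordm D u w'.
by rewrite opprB addrA subrK scalerBr scalerA mulVf// scale1r.
Qed.

(** The chain rule, here an algebraic identity for an arbitrary matrix [D]. *)
Lemma dword_cat D u u' w v :
  mass (wordm D u w) != 0 -> mass (wordm D (u ++ u') w) != 0 ->
  dword D (u ++ u') w v = dword D u' (nword D u w) (dword D u w v).
Proof.
move=> m0 m0'.
have m1 : mass (wordm D u' (nword D u w)) != 0.
  by rewrite mass_nword_cat// mulf_neq0// invr_eq0.
have E2 := wordm_nword m1; rewrite mass_nword_cat// -nword_cat// in E2.
set f := nword D (u ++ u') w in E2; set r := mass (wordm D u w) in m0 E2.
set r' := mass (wordm D (u ++ u') w) in m0' E2.
set vM := wordm D (u ++ u') v; set k := mass (wordm D u v).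
have E1 : wordm D u' (dword D u w v) = r^-1 *: (vM - (k * (r' / r)) *: f).
  by rewrite wordmZ wordmB wordmZ E2 -wordm_cat scalerA.
set z := dword D u w v in E1 *.
rewrite [in RHS]/dword mass_nword_cat// -nword_cat// E1 massZ massB massZ -/f -/r -/r'.
rewrite mass_nword// mulr1 /dword -/vM -/f -/r'; clearbody vM f r r' k z.
by apply/rowP => j; rewrite !mxE; field; rewrite m0 m0'.
Qed.

Lemma mass_dword D u w v : mass (wordm D u w) != 0 -> mass (dword D u w v) = 0.
Proof. by move=> m0; rewrite massZ massB massZ mass_nword// mulr1 subrr mulr0. Qed.

Lemma dword_face D u a w v j : Phi j != a -> dword D (rcons u a) w v 0 j = 0.
Proof.
move=> ja; rewrite mxE mxE wordm_face// add0r mxE mxE nword_face//.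
by rewrite mulr0 oppr0 mulr0.
Qed.

Lemma dwordZ D u w k v : dword D u w (k *: v) = k *: dword D u w v.
Proof.
by rewrite /dword wordmZ massZ -scalerA -scalerBr !scalerA mulrC.
Qed.

Lemma f_word_nword D u w : f_word_defined Phi D u w -> mass w = 1 ->
  mass (wordm D u w) != 0 /\ f_word Phi D u w = nword D u w.
Proof.
elim: u w => [|a u IH] w /=.
  by move=> _ w1; rewrite /nword /= w1 oner_eq0 invr1 scale1r.
move=> /andP[ra uw] w1.
have ma : mass (wordm D [:: a] w) != 0 by rewrite /= -r_E.
have w1' : mass (f_ Phi D a w) = 1 by rewrite f_E mass_nword.
have [m0 fE] := IH _ uw w1'; rewrite f_E mass_nword_cat// in m0.
split; first by apply: contra m0 => /eqP m1; rewrite [mass _]m1 mul0r.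
by rewrite /f_word/= [LHS]fE f_E -nword_cat.
Qed.

End Words.

Section StochasticWords.
Variables (R : realType) (A B : nat) (Phi : 'I_B -> 'I_A).
Implicit Types (D : 'M[R]_B) (v w : 'rV[R]_B) (a b : 'I_A) (u : seq 'I_A).

Local Notation wordm := (@wordm R A B Phi).
Local Notation nword := (@nword R A B Phi).

Definition l1norm v : R := \sum_j `|v 0 j|.

Lemma l1norm_ge0 v : 0 <= l1norm v.
Proof. by apply: sumr_ge0 => j _. Qed.

Lemma l1normD v w : l1norm (v + w) <= l1norm v + l1norm w.
Proof. by rewrite /l1norm -big_split; apply: ler_sum => j _; rewrite mxE ler_normD. Qed.

Lemma l1normZ k v : l1norm (k *: v) = `|k| * l1norm v.
Proof. by rewrite /l1norm mulr_sumr; apply: eq_bigr => j _; rewrite mxE normrM. Qed.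

Lemma l1normN v : l1norm (- v) = l1norm v.
Proof. by rewrite -scaleN1r l1normZ normrN1 mul1r. Qed.

Lemma norm_coord_le_l1 v j : `|v 0 j| <= l1norm v.
Proof. by rewrite /l1norm (bigD1 j)//= lerDl sumr_ge0. Qed.

Lemma norm_mass_le v : `|mass v| <= l1norm v.
Proof. exact: ler_norm_sum. Qed.

Lemma l1norm_le v (e : R) : (forall j, `|v 0 j| <= e) -> l1norm v <= B%:R * e.
Proof.
move=> ve; apply: (@le_trans _ _ (\sum_(j < B) e)); first exact: ler_sum.
by rewrite sumr_const card_ord mulr_natl.
Qed.

Lemma l1norm_mass v : (forall j, 0 <= v 0 j) -> l1norm v = mass v.
Proof. by move=> v0; apply: eq_bigr => j _; rewrite ger0_norm. Qed.

Lemma l1norm_symbol D a v : stochastic D -> l1norm (v *m symbol_mx Phi D a) <= l1norm v.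
Proof.
move=> [D0 D1].
apply: (@le_trans _ _ (\sum_j \sum_i `|v 0 i| * D i j)).
  apply: ler_sum => j _; rewrite mxE (le_trans (ler_norm_sum _ _ _))//.
  apply: ler_sum => i _; rewrite normrM ler_wpM2l// mxE; case: ifP => _.
    by rewrite ger0_norm.
  by rewrite normr0.
by rewrite exchange_big/=; apply: ler_sum => i _; rewrite -mulr_sumr D1 mulr1.
Qed.

Lemma l1norm_wordm D u v : stochastic D -> l1norm (wordm D u v) <= l1norm v.
Proof.
move=> sD; elim: u v => //= a u IH v.
exact: le_trans (IH _) (l1norm_symbol _ _ sD).
Qed.

Lemma wordm_ge0 D u w : (forall i j, 0 <= D i j) -> (forall j, 0 <= w 0 j) ->
  forall j, 0 <= wordm D u w 0 j.
Proof.
move=> D0; elim: u w => //= a u IH w w0; apply: IH => j.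
rewrite mul_symbol_mx; case: ifP => // _; rewrite mxE.
by apply: sumr_ge0 => i _; rewrite mulr_ge0.
Qed.

Lemma mass_ge0 w : (forall j, 0 <= w 0 j) -> 0 <= mass w.
Proof. by move=> w0; exact: sumr_ge0. Qed.

Lemma mass_wordm_cat_le D u u' w : stochastic D -> (forall j, 0 <= w 0 j) ->
  mass (wordm D (u ++ u') w) <= mass (wordm D u w).
Proof.
move=> sD w0; rewrite wordm_cat -!l1norm_mass; first exact: l1norm_wordm.
  exact: (wordm_ge0 _ sD.1).
by apply: (wordm_ge0 _ sD.1); exact: (wordm_ge0 _ sD.1).
Qed.

Lemma f_word_definedE D u w : stochastic D -> (forall j, 0 <= w 0 j) ->
  mass (wordm D u w) != 0 -> f_word_defined Phi D u w.
Proof.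
move=> sD; elim: u w => //= a u IH w w0 m0.
have wa0 : forall j, 0 <= (w *m symbol_mx Phi D a) 0 j by exact: (wordm_ge0 [:: a] sD.1).
have ra : 0 < r_ Phi D a w.
  rewrite r_E lt_neqAle mass_ge0// andbT eq_sym; apply: contra m0 => /eqP r0.
  rewrite eq_le; apply/andP; split; last by apply: mass_ge0; exact: (wordm_ge0 _ sD.1).
  by rewrite -r0; exact: (@mass_wordm_cat_le D [:: a]).
rewrite gt_eqF//=; apply: IH => [j|].
  by rewrite mxE mulr_ge0// invr_ge0 ltW.
by rewrite /f_ wordmZ massZ mulf_neq0// invr_eq0 gt_eqF.
Qed.

Lemma nword_simplex D u w : stochastic D -> (forall j, 0 <= w 0 j) ->
  mass (wordm D u w) != 0 -> simplex (nword D u w).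
Proof.
move=> sD w0 m0; split; last by rewrite -/(mass _) mass_nword.
move=> j; rewrite mxE mulr_ge0 ?invr_ge0 ?mass_ge0//; exact: (wordm_ge0 _ sD.1).
Qed.

Lemma sum_mass_wordm_cons D u w : \sum_a mass (wordm D (a :: u) w) = mass (wordm D u (w *m D)).
Proof.
rewrite -(sum_mul_symbol_mx Phi) wordm_sum /mass exchange_big/=.
by apply: eq_bigr => j _; rewrite summxE.
Qed.

Lemma sum_mass_wordm_cat D n u w : w *m D = w ->
  \sum_(z : n.-tuple 'I_A) mass (wordm D (z ++ u) w) = mass (wordm D u w).
Proof.
move=> wD; elim: n => [|n IH]; first by rewrite (sum_words0 (fun z => mass (wordm D (z ++
  u) w))).
rewrite (sum_words_cons _ (fun z => mass (wordm D (z ++ u) w))) exchange_big/= -IH.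
by apply: eq_bigr => z _; rewrite (sum_mass_wordm_cons D (z ++ u)) wD.
Qed.

Lemma sum_transition_prob D z w :
  \sum_(i : 'I_B) w 0 i * (\sum_(y : (size z).-tuple 'I_B | map Phi y == z) transition_prob
    D i y)
  = mass (wordm D z w).
Proof.
elim: z w => [|a z IH] w /=.
  apply: eq_bigr => i _; rewrite (eq_bigl xpredT) ?(sum_words0 (transition_prob D i)) ?mulr1//.
  by move=> y; rewrite tuple0.
rewrite -IH.
have E i : \sum_(y : (size z).+1.-tuple 'I_B | map Phi y == a :: z) transition_prob D i y =
    \sum_(j | Phi j == a) D i j *
      \sum_(y : (size z).-tuple 'I_B | map Phi y == z) transition_prob D j y.
  rewrite (sum_tuple_cons _ (fun y => map Phi y == a :: z)) [RHS]big_mkcond/=.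
  apply: eq_bigr => j _.
  rewrite (eq_bigl (fun y : (size z).-tuple 'I_B => (Phi j == a) && (map Phi y == z)))//.
  case: eqP => _ /=; last by rewrite big_pred0.
  by rewrite mulr_sumr.
under eq_bigr do rewrite E mulr_sumr.
rewrite (exchange_big_dep (fun j => Phi j == a))//= big_mkcond/=.
apply: eq_bigr => j _; rewrite mul_symbol_mx; case: ifP => ja; last by rewrite mul0r.
by rewrite mxE mulr_suml; apply: eq_big => [i|i _]; rewrite ?ja// mulrA.
Qed.

Lemma hidden_probE D z (s := stationary_vec D) : (0 < B)%N -> stochastic D ->
  hidden_prob Phi D z = mass (wordm D z s).
Proof.
move=> B0 sD; have [[_ s1] sDs] := stationary_vecP B0 sD.
rewrite /hidden_prob; case: z => [|a z].
  rewrite (eq_bigl xpredT) => [|y]; last by rewrite tuple0.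
  by rewrite (sum_words0 (chain_prob D)) /= [RHS]s1.
rewrite /= -sum_transition_prob (sum_tuple_cons _ (fun y => map Phi y == a :: z)).
(* In [wordm] the row vector is the law of the state before the first letter, in [chain_prob] that
   of the first state; stationarity absorbs the extra transition. *)
apply: eq_bigr => i _; rewrite mul_symbol_mx sDs.
rewrite (eq_bigl (fun y : (size z).-tuple 'I_B => (Phi i == a) && (map Phi y == z)))//.
case: eqP => _ /=; last by rewrite big_pred0// mul0r.
by rewrite mulr_sumr.
Qed.

Lemma cond_entropyE D n (s := stationary_vec D) : (0 < B)%N -> stochastic D ->
  cond_entropy Phi D n = - \sum_(z : n.-tuple 'I_A) \sum_a
    mass (wordm D (rcons z a) s) * ln (mass (wordm D (rcons z a) s) / mass (wordm D z s)).
Proof.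
move=> B0 sD; rewrite /cond_entropy; congr (- _).
rewrite (sum_words_rcons _ (fun z => hidden_prob Phi D z *
  ln (hidden_prob Phi D z / hidden_prob Phi D (take n z)))).
apply: eq_bigr => z _; apply: eq_bigr => a _; rewrite !hidden_probE//.
by rewrite -cats1 take_cat size_tuple ltnn subnn take0 cats0.
Qed.

End StochasticWords.

(** * The limit set and uniform contraction *)

Lemma lipschitz_cvgn (R : realType) (V W : normedModType R) (f : V -> W) (C : R)
    (u : nat -> V) (p : V) :
  (forall x, `|f x - f p| <= C * `|x - p|) ->
  u n @[n --> \oo] --> p -> f (u n) @[n --> \oo] --> f p.
Proof.
move=> fC up; apply/cvgrPdist_lt => e e0.
have C1 : 0 < `|C| + 1 by rewrite ltr_wpDl.
move/cvgrPdist_lt: up => /(_ _ (divr_gt0 e0 C1)); apply: filterS => n.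
rewrite ltr_pdivlMr// (distrC (f p)) (distrC p) => H; apply: le_lt_trans (fC _) _.
apply: le_lt_trans H; rewrite mulrC ler_wpM2l// (le_trans (ler_norm _))// lerDl.
by [].
Qed.

Section RowVectors.
Variables (R : realType) (B : nat).
Implicit Types (v w : 'rV[R]_B).

Lemma norm_coord_le v j : `|v 0 j| <= `|v|.
Proof.
rewrite [leRHS]/Num.norm /= mx_normrE; apply/bigmax_geP; right => /=.
by exists (0, j).
Qed.

Lemma norm_le_l1norm v : `|v| <= l1norm v.
Proof.
rewrite [leLHS]/Num.norm /= mx_normrE; apply/bigmax_leP; split.
  exact: l1norm_ge0.
by move=> [i j] _ /=; rewrite (ord1 i); exact: norm_coord_le_l1.
Qed.

Lemma l1norm_le_norm v : l1norm v <= B%:R * `|v|.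
Proof. by apply: l1norm_le => j; exact: norm_coord_le. Qed.

Lemma closed_seq (S : set 'rV[R]_B) :
  (forall p, (forall e, 0 < e -> exists2 x, S x & `|x - p| < e) -> S p) -> closed S.
Proof.
move=> H p cp; apply: H => e e0.
have [x [Sx px]] := cp _ (nbhsx_ballx p e e0).
by exists x => //; rewrite distrC; move: px; rewrite -ball_normE.
Qed.

Lemma closed_simplex : closed (@simplex R B).
Proof.
apply: closed_seq => p pS; split=> [i|].
  rewrite leNgt; apply/negP => pi0.
  have [|x [x0 _]] := pS (- p 0 i); first by rewrite oppr_gt0.
  move=> /(le_lt_trans (norm_coord_le _ i)); rewrite !mxE ltr_norml => /andP[].
  by have := x0 i; lra.
apply/eqP; rewrite -subr_eq0 -normr_le0; apply/ler_addgt0Pl => e e0; rewrite addr0.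
have Bp : 0 < B%:R + 1 :> R by rewrite ltr_wpDl.
have [|x [_ x1] xp] := pS (e / (B%:R + 1)); first by rewrite divr_gt0.
rewrite -x1 -/(mass p) -/(mass x) -massB (le_trans (norm_mass_le _))//.
apply: le_trans (l1norm_le_norm _) _; rewrite distrC.
move: xp; rewrite ltr_pdivlMr// => /ltW; apply: le_trans.
by rewrite mulrDr mulr1 mulrC lerDl.
Qed.

Lemma simplex_le1 w j : simplex w -> 0 <= w 0 j <= 1.
Proof.
move=> [w0 w1]; rewrite w0 -w1 (bigD1 j)//= lerDl.
exact: sumr_ge0.
Qed.

Lemma compact_simplex : compact (@simplex R B).
Proof.
apply: subclosed_compact closed_simplex _ _; last first.
  move=> w sw; exact: (fun j => simplex_le1 j sw).
apply: (rV_compact (A := fun=> [set x : R | 0 <= x <= 1])) => _.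
rewrite (_ : [set x : R | _] = `[0, 1]%classic); first exact: segment_compact.
by apply/seteqP; split=> x /=; rewrite in_itv.
Qed.

(** Only points of [K] itself are tested near [x]. This matters because the estimates are available
    on the limit set and not on a neighbourhood of it. *)
Lemma compact_uniform (K : set 'rV[R]_B) (P : nat -> 'rV[R]_B -> Prop) :
  compact K ->
  (forall x, K x -> exists m, exists2 e, 0 < e &
     forall y, K y -> `|x - y| < e -> P m y) ->
  (forall m n y, (m <= n)%N -> P m y -> P n y) ->
  exists m, forall y, K y -> P m y.
Proof.
move=> /compact_near_coveringP cK KP Pm.
have [x Kx|m _ mP] := cK nat \oo (fun m y => K y -> P m y) _.
  have [m [e e0 eP]] := KP x Kx.
  exists (ball x e, [set n | (m <= n)%N]) => /=.
    by split; [exact: nbhsx_ballx|exists m].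
  move=> [y n] /= [xy mn] Ky; apply: Pm mn _; apply: eP => //.
  by move: xy; rewrite -ball_normE.
by exists m => y Ky; exact: (mP m (leqnn m)).
Qed.

End RowVectors.

Section LimitSet.
Variables (R : realType) (A B : nat) (Phi : 'I_B -> 'I_A) (D : 'M[R]_B).
Hypothesis sD : stochastic D.
Hypothesis B0 : (0 < B)%N.
Implicit Types (v w p : 'rV[R]_B) (a b : 'I_A) (u : seq 'I_A).

Local Notation wordm := (@wordm R A B Phi D).
Local Notation nword := (@nword R A B Phi D).
Local Notation L := (limit_set Phi D).
Local Notation s := (stationary_vec D).

Let s_simplex : simplex s. Proof. by case: (stationary_vecP B0 sD). Qed.
Let sDs : s *m D = s. Proof. by case: (stationary_vecP B0 sD). Qed.
Let s0 j : 0 <= s 0 j. Proof. by case: s_simplex. Qed.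
Let s1 : mass s = 1. Proof. by case: s_simplex. Qed.

Lemma f_word_simplex u : f_word_defined Phi D u s -> simplex (f_word Phi D u s).
Proof. by move=> /f_word_nword[]// m0 ->; exact: nword_simplex. Qed.

Lemma limit_set_of_seq p (u : nat -> seq 'I_A) :
  (forall k, (k <= size (u k))%N) ->
  (forall k, f_word_defined Phi D (u k) s) ->
  (forall k, `|f_word Phi D (u k) s - p| < k.+1%:R^-1) -> L p.
Proof.
move=> ku du up; exists u; split=> //.
  by move=> P [N _ NP]; exists N => // n /= Nn; apply: NP => /=; exact: leq_trans (ku n).
apply/cvgrPdist_lt => e e0.
have [N _ NP] := near_infty_natSinv_lt (PosNum e0); exists N => // n Nn.
by rewrite distrC (lt_trans (up n))//; exact: NP.
Qed.

Lemma limit_set_approx p (e : R) k : L p -> 0 < e ->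
  exists u, [/\ (k <= size u)%N, f_word_defined Phi D u s & `|f_word Phi D u s - p| < e].
Proof.
move=> [u [su du up]] e0.
have /cvgrPdist_lt/(_ e e0)[N1 _ N1P] := up.
have [N2 _ N2P] := su [set n | (k <= n)%N] (ex_intro2 _ _ k I (fun=> id)).
exists (u (maxn N1 N2)); split=> //.
  by apply: (N2P (maxn N1 N2)); rewrite /= leq_maxr.
by rewrite distrC; apply: (N1P (maxn N1 N2)); rewrite /= leq_maxl.
Qed.

Lemma limit_set_simplex p : L p -> simplex p.
Proof.
move=> Lp; apply: closed_simplex => U /nbhs_ballP[e /= e0 eU].
have [u [_ du up]] := limit_set_approx 0 Lp e0.
exists (f_word Phi D u s); split; first exact: f_word_simplex.
by apply: eU; rewrite -ball_normE /= distrC.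
Qed.

(** The device for proving statements about all long words by contradiction: counterexamples [Q] of
    unbounded length accumulate, in the compact simplex, at a point of the limit set. *)
Lemma limit_set_cluster (Q : seq 'I_A -> Prop) :
  (forall k, exists u, [/\ (k <= size u)%N, f_word_defined Phi D u s & Q u]) ->
  exists2 p, L p & forall (e : R) k, 0 < e -> exists u,
    [/\ (k <= size u)%N, f_word_defined Phi D u s, Q u & `|f_word Phi D u s - p| < e].
Proof.
move=> /choice[u uP].
have [p [ps pc]] : simplex (B := B) `&` cluster ((fun k => f_word Phi D (u k) s) @ \oo) !=set0.
  apply: (@compact_simplex R B) => //; exists 0%N => // k _ /=.
  by apply: f_word_simplex; case: (uP k).
have pQ (e : R) k : 0 < e -> exists v : seq 'I_A,
    [/\ (k <= size v)%N, f_word_defined Phi D v s, Q v & `|f_word Phi D v s - p| < e].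
  move=> e0.
  have [|_ [[n kn <-] np]] := pc [set f_word Phi D (u n) s | n in [set n | (k <= n)%N]] _ _
    (nbhsx_ballx p e e0).
    by exists k => // n /= kn; exists n.
  have [nu du Qu] := uP n; exists (u n); split=> //; first exact: leq_trans nu.
  by rewrite distrC; move: np; rewrite -ball_normE.
exists p => //.
have ik k : 0 < k.+1%:R^-1 :> R by rewrite invr_gt0.
have /choice[v vP] := fun k => pQ _ k (ik k).
by apply: (limit_set_of_seq (u := v)) => k; case: (vP k).
Qed.

Hypothesis r_gt0 : forall a w, L w -> 0 < r_ Phi D a w.

Lemma long_word_gt0 : exists N, forall u a, (N <= size u)%N ->
  f_word_defined Phi D u s -> 0 < r_ Phi D a (f_word Phi D u s).
Proof.
apply: contrapT => H.
have [|p Lp pP] := @limit_set_cluster (fun u => exists a, r_ Phi D a (f_word Phi D u s) <= 0).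
  move=> k; apply: contrapT => Hk; apply: H; exists k => u a ku du.
  by rewrite ltNge; apply/negP => ua; apply: Hk; exists u; split=> //; exists a.
(* The bad letter depends on the word, hence the minimum over all letters; each [r_ Phi D a] is
   [B]-Lipschitz for the sup norm. *)
pose e := \big[Num.min/1]_(a : 'I_A) (r_ Phi D a p / (B%:R + 1)).
have Bp : 0 < B%:R + 1 :> R by rewrite ltr_wpDl.
have e0 : 0 < e.
  rewrite /e; elim/big_rec: _ => [//|a x _ x0]; rewrite lt_min x0 andbT.
  by rewrite divr_gt0// r_gt0.
have [u [_ _ [a ua] up]] := pP e 0%N e0.
have ea : e <= r_ Phi D a p / (B%:R + 1) by exact: bigmin_le_cond.
move: ua; apply/negP; rewrite -ltNge.
have := lt_le_trans up ea; rewrite ltr_pdivlMr// mulrDr mulr1.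
have := norm_mass_le ((f_word Phi D u s - p) *m symbol_mx Phi D a).
move=> /le_trans/(_ (l1norm_symbol _ _ _ sD))/le_trans/(_ (l1norm_le_norm _)).
rewrite mulmxBl massB -!r_E ler_norml mulrC => /andP[+ _].
by have := normr_ge0 (f_word Phi D u s - p); lra.
Qed.

(** Some word [z] of length [N] has positive probability, and beyond length [N] appending a letter
    preserves positivity. So [z ++ u] has positive probability, and by stationarity the probability
    of [u] is the sum of those of all [z' ++ u] with [z'] of length [N]. *)
Lemma word_gt0 u : 0 < mass (wordm u s).
Proof.
have [N NP] := long_word_gt0.
have [z z0] : exists z : N.-tuple 'I_A, mass (wordm z s) != 0.
  apply: contrapT => H; have := sum_mass_wordm_cat Phi N [::] sDs.
  rewrite big1 /= ?s1 => [/eqP|z _]; first by rewrite eq_sym oner_eq0.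
  by rewrite cats0; apply/eqP/negPn/negP => z0; apply: H; exists z.
have zu (v : seq 'I_A) : mass (wordm (z ++ v) s) != 0.
  elim/last_ind: v => [|v a IH]; first by rewrite cats0.
  have dv := f_word_definedE sD s0 IH.
  have [_ fE] := f_word_nword dv s1.
  have := NP _ a _ dv; rewrite size_cat size_tuple leq_addr => /(_ isT).
  rewrite fE r_E -rcons_cat wordm_rcons -scalemxAl massZ.
  by apply: contraTN => /eqP ->; rewrite mulr0 ltxx.
rewrite -(sum_mass_wordm_cat Phi N u sDs) (bigD1 z)//=.
have ge0 (v : seq 'I_A) : 0 <= mass (wordm v s) by apply: mass_ge0; exact: (wordm_ge0 _ _ sD.1).
by rewrite ltr_pwDl ?sumr_ge0// lt_neqAle eq_sym zu ge0.
Qed.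

Lemma word_defined u : f_word_defined Phi D u s.
Proof. by apply: f_word_definedE => //; rewrite gt_eqF ?word_gt0. Qed.

Lemma f_wordE u : f_word Phi D u s = nword u s.
Proof. by have [] := f_word_nword (word_defined u) s1. Qed.

(** Invariance of the limit set: a letter is appended to the approximating words, and [f_a] is
    continuous at [p] because [r_a] is positive there. *)
Lemma limit_set_word_gt0 u p : L p -> 0 < mass (wordm u p) /\ L (nword u p).
Proof.
elim: u p => [|a u IH] p Lp.
  have [_ p1] := limit_set_simplex Lp.
  by rewrite /nword /= [mass _]p1 ltr01 invr1 scale1r.
have ra := r_gt0 a Lp; rewrite r_E in ra.
have La : L (nword [:: a] p).
  case: Lp => v [sv _ vp]; exists (fun k => rcons (v k) a); split.
  - move=> P [M _ MP]; have [N _ NP] := sv [set n | (M <= n)%N] (ex_intro2 _ _ M I (fun=> id)).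
    by exists N => // n Nn; apply: MP; rewrite /= size_rcons leqW//; exact: NP.
  - by move=> k; exact: word_defined.
  - under eq_fun do rewrite f_wordE -cats1 nword_cat ?gt_eqF ?word_gt0// -f_wordE.
    apply: (@cvgZ _ _ _ _ _ (fun k => (mass (f_word Phi D (v k) s *m symbol_mx Phi D a))^-1)).
      apply: cvgV; first by rewrite gt_eqF.
      apply: (lipschitz_cvgn (C := B%:R) (f := fun x => mass (x *m symbol_mx Phi D a)) _
        vp) => x.
      rewrite -massB -mulmxBl (le_trans (norm_mass_le _))//.
      by rewrite (le_trans (l1norm_symbol _ _ _ sD))// l1norm_le_norm.
    apply: (lipschitz_cvgn (C := B%:R) (f := mulmx^~ (symbol_mx Phi D a)) _ vp) => x.
    rewrite -mulmxBl (le_trans (norm_le_l1norm _))//.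
    by rewrite (le_trans (l1norm_symbol _ _ _ sD))// l1norm_le_norm.
have a0 : mass (wordm [:: a] p) != 0 by rewrite gt_eqF.
have [u0 Lu] := IH _ La; rewrite -nword_cat// in Lu; split=> //.
move: u0; rewrite mass_nword_cat//; rewrite -[_ :: u]/([:: a] ++ u).
by rewrite pmulr_lgt0// invr_gt0.
Qed.

End LimitSet.

Section LimitSetCompact.
Variables (R : realType) (A B : nat) (Phi : 'I_B -> 'I_A) (D : 'M[R]_B).
Hypothesis sD : stochastic D.
Hypothesis B0 : (0 < B)%N.
Hypothesis r_gt0 : forall (a : 'I_A) w, limit_set Phi D w -> 0 < r_ Phi D a w.
Implicit Types (v w p : 'rV[R]_B) (a b : 'I_A) (u : seq 'I_A).

Local Notation wordm := (@wordm R A B Phi D).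
Local Notation nword := (@nword R A B Phi D).
Local Notation dword := (@dword R A B Phi D).
Local Notation L := (limit_set Phi D).
Local Notation s := (stationary_vec D).

Lemma closed_limit_set : closed L.
Proof.
apply: closed_seq => p pL.
have ik k : 0 < (k.+1%:R / 2)^-1 :> R by rewrite invr_gt0 divr_gt0.
have H k : exists u : seq 'I_A, [/\ (k <= size u)%N, f_word_defined Phi D u s &
    `|f_word Phi D u s - p| < k.+1%:R^-1].
  have k0 : 0 < k.+1%:R^-1 / 2 :> R by rewrite divr_gt0// invr_gt0.
  have [x Lx xp] := pL _ k0; have [u [ku du ux]] := limit_set_approx k Lx k0.
  exists u; split=> //; rewrite -(subrKA x) (le_lt_trans (ler_normD _ _))//.
  by rewrite [ltRHS]splitr ltrD.
have /choice[u uP] := H.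
by apply: (limit_set_of_seq (u := u)) => k; case: (uP k).
Qed.

Lemma compact_limit_set : compact L.
Proof.
apply: subclosed_compact closed_limit_set (@compact_simplex R B) _.
exact: limit_set_simplex.
Qed.

Lemma closed_face b : closed (face (R := R) Phi b).
Proof.
apply: closed_seq => p pF; split=> [|i ib].
  apply: closed_simplex => U /nbhs_ballP[e /= e0 eU].
  have [x [Sx _] xp] := pF e e0; exists x; split=> //.
  by apply: eU; rewrite -ball_normE /= distrC.
apply/eqP; rewrite -normr_le0; apply/ler_addgt0Pl => e e0; rewrite addr0.
have [x [_ Fx] xp] := pF e e0; rewrite -normrN -[X in `|X|]add0r -(Fx i ib).
have := norm_coord_le (x - p) i; rewrite !mxE => /le_trans; apply; exact: ltW.
Qed.

Lemma compact_limit_face b : compact (L `&` face Phi b).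
Proof.
apply: subclosed_compact (@compact_limit_set) _; last by move=> ? [].
by apply: closedI; [exact: closed_limit_set|exact: closed_face].
Qed.

Lemma limit_set_lower_bound : exists2 c, 0 < c <= 1 &
  forall a p, L p -> c <= mass (p *m symbol_mx Phi D a).
Proof.
have Bp : 0 < B%:R + 1 :> R by rewrite ltr_wpDl.
(* Bounds of this form are monotone in [m], as [compact_uniform] requires, and at most 1, which will
   make the powers of [c] decrease. *)
suff H a : exists m, forall p, L p -> m.+1%:R^-1 <= mass (p *m symbol_mx Phi D a).
  have /choice[m mP] := H; exists (\max_a m a).+1%:R^-1 => [|a p Lp].
    by rewrite invr_gt0 ltr0Sn/= invf_le1 ?ltr0Sn// ler1n.
  apply: le_trans (mP a p Lp); rewrite lef_pV2 ?posrE ?ltr0Sn// ler_nat ltnS.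
  exact: leq_bigmax.
apply: (compact_uniform compact_limit_set) => [p Lp|m n p mn]; last first.
  by apply: le_trans; rewrite lef_pV2 ?posrE ?ltr0Sn// ler_nat ltnS.
have ra := r_gt0 a Lp; rewrite r_E in ra; set r := mass _ in ra.
have r20 : 0 < r / 2 by rewrite divr_gt0.
have [m _ /(_ m (leqnn m))/= mr] := near_infty_natSinv_lt (PosNum r20).
exists m, (r / 2 / (B%:R + 1)); first by rewrite divr_gt0.
move=> y Ly; rewrite ltr_pdivlMr// mulrDr mulr1 => py.
have := le_trans (le_trans (norm_mass_le _) (l1norm_symbol Phi a (p - y) sD))
  (l1norm_le_norm _).
rewrite mulmxBl massB -/r ler_norml mulrC => /andP[_ +].
have := normr_ge0 (p - y); move: mr => /= /ltW mr n0 h.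
apply: (le_trans mr); clearbody r; lra.
Qed.

Lemma limit_set_mass_ge (c : R) : 0 <= c ->
  (forall a p, L p -> c <= mass (p *m symbol_mx Phi D a)) ->
  forall u p, L p -> c ^+ size u <= mass (wordm u p).
Proof.
move=> c0 cP; elim/last_ind => [|u a IH] p Lp.
  by have [_ p1] := limit_set_simplex sD B0 Lp; rewrite /= [mass _]p1.
have [u0 Lu] := limit_set_word_gt0 sD B0 r_gt0 u Lp.
rewrite wordm_rcons (wordm_nword (lt0r_neq0 u0)) -scalemxAl massZ size_rcons exprSr.
by apply: ler_pM => //; [exact: exprn_ge0|exact: IH|exact: cP].
Qed.

Lemma nword_limit_face u a p : L p -> (L `&` face Phi a) (nword (rcons u a) p).
Proof.
move=> Lp; have [_ Lu] := limit_set_word_gt0 sD B0 r_gt0 (rcons u a) Lp.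
split=> //; split; first exact: limit_set_simplex Lu.
by move=> j ja; rewrite nword_face.
Qed.

(** The point of [L] must lie in the face of the last letter, although last letters may vary along a
    sequence of words. A state [i] with positive mass at the cluster point [p] forces the nearby
    words to end in [Phi i], and this places [p] in that face. *)
Lemma long_word_near_limit_set (e : R) : 0 < e ->
  exists N, forall u a, (N <= size u)%N ->
    exists2 p, (L `&` face Phi a) p & forall j, `|nword (rcons u a) s 0 j - p 0 j| <= e.
Proof.
move=> e0; apply: contrapT => H.
pose Q (v : seq 'I_A) := exists u a, v = rcons u a /\
   ~ exists2 p, (L `&` face Phi a) p & forall j, `|nword v s 0 j - p 0 j| <= e.
have [|p Lp pP] := @limit_set_cluster _ _ _ Phi D sD B0 Q.
  move=> k; apply: contrapT => Hk; apply: H; exists k => u a ku.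
  apply: contrapT => Hu; apply: Hk; exists (rcons u a); split.
  - by rewrite size_rcons leqW.
  - exact: word_defined.
  - by exists u, a.
have [p0 p1] := limit_set_simplex sD B0 Lp.
have [i pi0] : exists i, 0 < p 0 i.
  apply: contrapT => Hi; move: p1; rewrite big1 => [/esym/eqP|i _]; first by rewrite oner_eq0.
  by apply/eqP; rewrite eq_le p0 andbT leNgt; apply/negP => pi0; apply: Hi; exists i.
have fE u : f_word Phi D u s = nword u s by exact: f_wordE.
(* A limit point charging state i is only approached by words ending in Phi i. *)
have last_i (v : seq 'I_A) e' : e' <= p 0 i -> Q v -> `|f_word Phi D v s - p| < e' ->
    exists2 u, v = rcons u (Phi i) &
      ~ exists2 p, (L `&` face Phi (Phi i)) p & forall j, `|nword v s 0 j - p 0 j| <= e.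
  move=> e'p [u [a [-> Hu]]]; rewrite fE => /(le_lt_trans (norm_coord_le _ i)).
  rewrite !mxE; have [ia _|ia] := eqVneq (Phi i) a; first by exists u; rewrite ia.
  by rewrite (wordm_face _ _ _ ia) mulr0 sub0r normrN ger0_norm// => /lt_le_trans/(_ e'p);
    rewrite ltxx.
have pF : face Phi (Phi i) p.
  split=> // j ji; apply/eqP; rewrite -normr_le0; apply/ler_addgt0Pl => e' e'0; rewrite addr0.
  have me0 : 0 < Num.min e' (p 0 i) by rewrite lt_min e'0.
  have [v [_ _ Qv vp]] := pP _ 0%N me0.
  have [|u vE _] := last_i v _ _ Qv vp; first by rewrite ge_min lexx orbT.
  have := le_lt_trans (norm_coord_le _ j) vp.
  rewrite fE vE !mxE (wordm_face _ _ _ ji) mulr0 sub0r normrN => /ltW/le_trans; apply.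
  by rewrite ge_min lexx.
have me0 : 0 < Num.min e (p 0 i) by rewrite lt_min e0.
have [v [_ _ Qv vp]] := pP _ 0%N me0.
have [|u vE] := last_i v _ _ Qv vp; first by rewrite ge_min lexx orbT.
apply; exists p => // j; have := le_lt_trans (norm_coord_le _ j) vp.
by rewrite fE !mxE => /ltW/le_trans; apply; rewrite ge_min lexx.
Qed.

End LimitSetCompact.

(** * Euclidean norms and contraction of the derivatives *)

Section EuclideanNorm.
Variables (R : realType) (B : nat).
Implicit Types v w : 'rV[R]_B.

Lemma l2norm_ge0 v : 0 <= l2norm v. Proof. exact: sqrtr_ge0. Qed.

Lemma l2norm_sqr v : l2norm v ^+ 2 = \sum_i v 0 i ^+ 2.
Proof. by rewrite sqr_sqrtr// sumr_ge0// => i _; exact: sqr_ge0. Qed.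

Lemma l2normZ k v : l2norm (k *: v) = `|k| * l2norm v.
Proof.
rewrite /l2norm -sqrtr_sqr -sqrtrM ?sqr_ge0// mulr_sumr.
by congr Num.sqrt; apply: eq_bigr => i _; rewrite mxE exprMn.
Qed.

Lemma norm_coord_le_l2 v j : `|v 0 j| <= l2norm v.
Proof.
rewrite -(ler_pXn2r (_ : 0 < 2)%N) ?nnegrE ?l2norm_ge0// l2norm_sqr.
by rewrite real_normK ?num_real// (bigD1 j)//= lerDl sumr_ge0// => i _; exact: sqr_ge0.
Qed.

Lemma l1norm_le_l2 v : l1norm v <= B%:R * l2norm v.
Proof. by apply: l1norm_le => j; exact: norm_coord_le_l2. Qed.

Lemma l2norm_le_l1 v : l2norm v <= l1norm v.
Proof.
rewrite -(ler_pXn2r (_ : 0 < 2)%N) ?nnegrE ?l2norm_ge0 ?l1norm_ge0// l2norm_sqr.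
rewrite expr2 {1}/l1norm mulr_suml; apply: ler_sum => j _.
by rewrite -real_normK ?num_real// expr2 ler_wpM2l// norm_coord_le_l1.
Qed.

Lemma l2norm_eq0 v : l2norm v = 0 -> v = 0.
Proof.
move=> v0; apply/rowP => j; apply/eqP; rewrite mxE -normr_le0 -v0.
exact: norm_coord_le_l2.
Qed.

Lemma dot_le_l2 v w : \sum_i v 0 i * w 0 i <= l2norm v * l2norm w.
Proof.
have [/l2norm_eq0 ->|v0] := eqVneq (l2norm v) 0.
  rewrite big1 => [|i _]; first by rewrite mulr_ge0 ?l2norm_ge0.
  by rewrite mxE mul0r.
have [/l2norm_eq0 ->|w0] := eqVneq (l2norm w) 0.
  rewrite big1 => [|i _]; first by rewrite mulr_ge0 ?l2norm_ge0.
  by rewrite mxE mulr0.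
have vp : 0 < l2norm v by rewrite lt_neqAle eq_sym v0 l2norm_ge0.
have wp : 0 < l2norm w by rewrite lt_neqAle eq_sym w0 l2norm_ge0.
set a := l2norm v in vp *; set b := l2norm w in wp *.
(* As [a] and [b] are the norms of [v] and [w], this sum is [2 a b] times [a b] minus the scalar
   product. *)
have : 0 <= \sum_i (b * v 0 i - a * w 0 i) ^+ 2 by apply: sumr_ge0 => i _; exact: sqr_ge0.
rewrite (eq_bigr (fun i => b ^+ 2 * v 0 i ^+ 2 - 2 * a * b * (v 0 i * w 0 i) + a ^+ 2 * w 0
  i ^+ 2)); last first.
  by move=> i _; ring.
rewrite big_split sumrB/= -!mulr_sumr -!l2norm_sqr -/a -/b => H.
have ab0 : 0 < 2 * a * b by rewrite !mulr_gt0.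
rewrite -subr_ge0 -(pmulr_rge0 _ ab0).
by apply: le_trans H _; rewrite le_eqVlt; apply/orP; left; apply/eqP; ring.
Qed.

Lemma l2normD v w : l2norm (v + w) <= l2norm v + l2norm w.
Proof.
rewrite -(ler_pXn2r (_ : 0 < 2)%N) ?nnegrE ?addr_ge0 ?l2norm_ge0// sqrrD !l2norm_sqr.
rewrite (eq_bigr (fun i => v 0 i ^+ 2 + (v 0 i * w 0 i) *+ 2 + w 0 i ^+ 2)); last first.
  by move=> i _; rewrite mxE sqrrD.
rewrite !big_split/= lerD2r lerD2l mulr2n.
by rewrite lerD// dot_le_l2.
Qed.

End EuclideanNorm.

Section UniformContraction.
Variables (R : realType) (A B : nat) (Phi : 'I_B -> 'I_A) (D : 'M[R]_B).
Hypothesis sD : stochastic D.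
Hypothesis B0 : (0 < B)%N.
Hypothesis r_gt0 : forall (a : 'I_A) w, limit_set Phi D w -> 0 < r_ Phi D a w.
Variable c : R.
Hypothesis c01 : 0 < c <= 1.
Hypothesis c_le : forall a p, limit_set Phi D p -> c <= mass (p *m symbol_mx Phi D a).
Hypothesis contracting : forall b p, limit_set Phi D p -> face Phi b p ->
  eventually_contracting Phi D b p.
Implicit Types (v w p : 'rV[R]_B) (a b : 'I_A) (u : seq 'I_A).

Local Notation wordm := (@wordm R A B Phi D).
Local Notation nword := (@nword R A B Phi D).
Local Notation dword := (@dword R A B Phi D).
Local Notation L := (limit_set Phi D).

Let c0 : 0 < c. Proof. by case/andP: c01. Qed.
Let c1 : c <= 1. Proof. by case/andP: c01. Qed.

Let mass_ge u p : L p -> c ^+ size u <= mass (wordm u p).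
Proof. exact: (limit_set_mass_ge sD B0 r_gt0 (ltW c0) c_le). Qed.

Let mass_gt0 u p : L p -> 0 < mass (wordm u p).
Proof. by case/(limit_set_word_gt0 sD B0 r_gt0 u). Qed.

(** Here [w] may have any mass, for use at [h *: v + p] with [v] arbitrary. The empty word is
    excluded since [nword [::]] still normalizes. *)
Lemma f_word_nword_prefix u w : (0 < size u)%N ->
  (forall k, mass (wordm (take k.+1 u) w) != 0) -> f_word Phi D u w = nword u w.
Proof.
elim: u w => // a [|a' u] IH w _ m0; first by rewrite /f_word /= f_E.
have ma : mass (wordm [:: a] w) != 0 by have := m0 0%N; rewrite /= ?take0.
have -> : f_word Phi D [:: a, a' & u] w = f_word Phi D (a' :: u) (nword [:: a] w).
  by rewrite /f_word /= (f_E _ _ a w).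
rewrite IH//.
  by rewrite -nword_cat.
move=> k; rewrite mass_nword_cat// mulf_neq0 ?invr_eq0//.
exact: (m0 k.+1).
Qed.

(** By [nwordB] the difference quotient is exactly [m / (m + h k)] times [dword u p v], so only a
    scalar limit has to be computed. *)
Lemma diff_f_word u p v : (0 < size u)%N -> L p ->
  differentiable (f_word Phi D u) p -> 'd (f_word Phi D u) p v = dword u p v.
Proof.
move=> u0 Lp df; rewrite -deriveE//; apply: cvg_lim => //.
set m := mass (wordm u p); set k := mass (wordm u v).
have m0 : m != 0 by rewrite gt_eqF ?mass_gt0.
have : (fun h => (m / (m + h * k)) *: dword u p v) @ (0^' : set_system R) --> dword u p v.
  rewrite -[X in _ --> X]scale1r; apply: cvgZ; last exact: cvg_cst.
  have : m / (m + h * k) @[h --> (0 : R^o)] --> m / (m + 0 * k).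
    apply: cvgM; first exact: cvg_cst.
    apply: cvgV; first by rewrite mul0r addr0.
    apply: cvgD; first exact: cvg_cst.
    by apply: cvgM; [exact: cvg_id|exact: cvg_cst].
  rewrite mul0r addr0 divff//; apply: cvg_trans; apply: cvg_app.
  exact: cvg_within.
apply: cvg_trans; apply: near_eq_cvg.
(* For [h] below this bound no prefix of [u] loses its mass at [h *: v + p], since at [p] all these
   masses are at least [c ^+ size u]. *)
have e0 : 0 < c ^+ size u / (l1norm v + 1) by rewrite divr_gt0 ?exprn_gt0// ltr_wpDl
  ?l1norm_ge0.
near=> h.
have h0 : h != 0 by near: h; exact: nbhs_dnbhs_neq.
have mh u' : (size u' <= size u)%N -> mass (wordm u' (h *: v + p)) != 0.
  move=> u'u; rewrite wordmD massD wordmZ massZ.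
  have hk : `|h * mass (wordm u' v)| < c ^+ size u.
    rewrite normrM (@le_lt_trans _ _ (`|h| * (l1norm v + 1)))//.
      rewrite ler_wpM2l// (le_trans (norm_mass_le _))//.
      by rewrite (le_trans (l1norm_wordm _ _ _ sD))// lerDl.
    by rewrite -ltr_pdivlMr ?ltr_wpDl ?l1norm_ge0//; near: h; exact: dnbhs0_lt.
  have uc : c ^+ size u <= mass (wordm u' p).
    by apply: le_trans (mass_ge u' Lp); rewrite ler_wiXn2l// ltW.
  by rewrite gt_eqF//; move: hk; rewrite ltr_norml => /andP[]; lra.
have pE x : (forall k, mass (wordm (take k.+1 u) x) != 0) -> f_word Phi D u x = nword u x.
  exact: f_word_nword_prefix.
rewrite /= /shift/= pE => [|j]; last by apply: mh; rewrite size_take_min geq_minr.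
rewrite (pE p) => [|j]; last by rewrite gt_eqF ?mass_gt0.
rewrite nwordB ?mh// addrK dwordZ !scalerA wordmD wordmZ massD massZ -/m -/k.
have := mh u (leqnn _); rewrite wordmD massD wordmZ massZ -/m -/k => mhk.
by congr (_ *: _); field; rewrite m0 mhk h0.
Unshelve. all: by end_near. Qed.

Let mass_neq0 u p : L p -> mass (wordm u p) != 0.
Proof. by move=> Lp; rewrite gt_eqF ?mass_gt0. Qed.

Let l1norm_nword u p : L p -> l1norm (nword u p) = 1.
Proof.
move=> Lp; have [n0 n1] := limit_set_simplex sD B0 (limit_set_word_gt0 sD B0 r_gt0 u Lp).2.
by rewrite l1norm_mass.
Qed.

Lemma l1norm_dword u p v n : L p -> (size u <= n)%N ->
  l1norm (dword u p v) <= 2 / c ^+ n * l1norm v.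
Proof.
move=> Lp un; have m0 := mass_gt0 u Lp.
have cm : c ^+ n <= mass (wordm u p).
  by apply: le_trans (mass_ge u Lp); rewrite ler_wiXn2l// ltW.
rewrite l1normZ gtr0_norm ?invr_gt0// mulrC mulrAC ler_pM ?l1norm_ge0//.
- by rewrite invr_ge0 ltW.
- apply: le_trans (l1normD _ _) _; rewrite l1normN l1normZ l1norm_nword// mulr1 mulr_natl
  mulr2n.
  have H := l1norm_wordm Phi u v sD.
  by apply: lerD => //; apply: le_trans (norm_mass_le _) H.
- by rewrite lef_pV2 ?posrE ?exprn_gt0.
Qed.

Lemma face_opnorm_bound b p u : (0 < size u)%N -> L p ->
  differentiable (f_word Phi D u) p ->
  forall v, face_direction Phi b v ->
    l2norm (dword u p v) <= face_opnorm Phi b ('d (f_word Phi D u) p) * l2norm v.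
Proof.
move=> u0 Lp df v vb.
have [/l2norm_eq0 ->|v0] := eqVneq (l2norm v) 0.
  by rewrite -[X in dword u p X](scale0r 0) dwordZ scale0r -(scale0r (0 : 'rV_B)) !l2normZ
    normr0 !mul0r mulr0.
have vp : 0 < l2norm v by rewrite lt_neqAle eq_sym v0 l2norm_ge0.
rewrite -ler_pdivrMr// mulrC -[X in X * _]gtr0_norm ?invr_gt0// -l2normZ -dwordZ.
set v' := _ *: v.
have v'1 : l2norm v' <= 1 by rewrite l2normZ gtr0_norm ?invr_gt0// mulVf.
(* [sup] dominates its set only if the set is bounded, which the crude estimate [l1norm_dword]
   ensures. *)
rewrite /face_opnorm; apply: ub_le_sup.
  exists (2 / c ^+ size u * B%:R) => _ [w [_ w1] <-].
  rewrite diff_f_word// (le_trans (l2norm_le_l1 _))//.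
  apply: le_trans (l1norm_dword _ Lp (leqnn _)) _.
  apply: ler_wpM2l; first by rewrite divr_ge0// exprn_ge0// ltW.
  by rewrite (le_trans (l1norm_le_l2 _))// ler_piMr.
exists v'; last by rewrite diff_f_word.
split=> //; case: vb => v1 v2; split.
  by move=> i ib; rewrite mxE v1// mulr0.
by rewrite -/(mass _) massZ [mass v]v2 mulr0.
Qed.

(** The base point enters [dword] only through a mass and through [nword], and the variation of
    [nword] is given exactly by [nwordB]. *)
Lemma dword_perturb u p p' v n : L p -> L p' -> (size u <= n)%N ->
  l2norm (dword u p' v) <= mass (wordm u p) / mass (wordm u p') * l2norm (dword u p v) +
   2 * B%:R ^+ 2 / c ^+ n ^+ 2 * `|p - p'| * l2norm v.
Proof.
move=> Lp Lp' un.
have m0 := mass_gt0 u Lp; have m0' := mass_gt0 u Lp'.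
have cm : c ^+ n <= mass (wordm u p).
  by apply: le_trans (mass_ge u Lp); rewrite ler_wiXn2l// ltW.
have -> : dword u p' v = (mass (wordm u p) / mass (wordm u p')) *: dword u p v +
    (mass (wordm u v) / mass (wordm u p)) *: dword u p' (p - p').
  have := nwordB (mass_neq0 u Lp) (mass_neq0 u Lp').
  set x := dword u p' (p - p') => E.
  have -> : (mass (wordm u v) / mass (wordm u p)) *: x =
      (mass (wordm u v) / mass (wordm u p')) *: (nword u p - nword u p').
    by rewrite E scalerA; congr (_ *: _); field; rewrite !mass_neq0.
  rewrite /(dword _ _ v) /(dword _ _ v); set y := wordm u v; set f := nword u p; set f' :=
    nword u p'.
  set m := mass (wordm u p) in m0 *; set m' := mass (wordm u p') in m0' *.
  clearbody y f f' m m'; apply/rowP => j; rewrite !mxE; field.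
  by rewrite !gt_eqF.
apply: le_trans (l2normD _ _) _; rewrite !(l2normZ (_ / _)) gtr0_norm ?divr_gt0// lerD2l.
rewrite normrM normfV (gtr0_norm m0).
have H1 : `|mass (wordm u v)| <= B%:R * l2norm v.
  apply: le_trans (norm_mass_le _) _; apply: le_trans (l1norm_wordm _ _ _ sD) _.
  exact: l1norm_le_l2.
have H2 : (mass (wordm u p))^-1 <= (c ^+ n)^-1 by rewrite lef_pV2 ?posrE ?exprn_gt0.
have H3 : l2norm (dword u p' (p - p')) <= 2 / c ^+ n * (B%:R * `|p - p'|).
  apply: le_trans (l2norm_le_l1 _) _; apply: le_trans (l1norm_dword _ Lp' un) _.
  by rewrite ler_wpM2l ?l1norm_le_norm// divr_ge0// exprn_ge0// ltW.
apply: (@le_trans _ _ ((B%:R * l2norm v) / c ^+ n * (2 / c ^+ n * (B%:R * `|p - p'|)))).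
  apply: ler_pM => //; rewrite ?mulr_ge0 ?invr_ge0 ?l2norm_ge0//; first exact: ltW.
  by apply: ler_pM => //; rewrite invr_ge0 ltW.
rewrite le_eqVlt; apply/orP; left; apply/eqP.
have cn0 : c ^+ n != 0 by rewrite gt_eqF ?exprn_gt0.
by set x := c ^+ n in cn0 *; clearbody x; field.
Qed.

(** The number of letters given by eventual contraction depends on the point. A single [m] bounds it
    and also keeps the ratio away from 1, so that the property is monotone in [m] and compactness
    applies. *)
Lemma locally_uniform_contraction b : exists m, forall p, (L `&` face Phi b) p ->
  exists2 n, (n <= m)%N & forall u, size u = n.+1 ->
    forall v, face_direction Phi b v -> l2norm (dword u p v) <= (1 - m.+1%:R^-1) * l2norm v.
Proof.
apply: (@compact_uniform _ _ _ (fun m p => exists2 n, (n <= m)%N & forall u, size u = n.+1 ->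
    forall v, face_direction Phi b v -> l2norm (dword u p v) <= (1 - m.+1%:R^-1) * l2norm v)
  (compact_limit_face sD B0 (b := b))) => [p [Lp Fp]|m n p mn]; last first.
  move=> [k km H]; exists k => [|u su v vb]; first exact: leq_trans mn.
  apply: le_trans (H u su v vb) _; apply: ler_wpM2r; first exact: l2norm_ge0.
  by rewrite lerD2l lerN2 lef_pV2 ?posrE ?ltr0Sn// ler_nat ltnS.
have [n nP] := contracting Lp Fp.
pose opn (u : n.+1.-tuple 'I_A) := face_opnorm Phi b ('d (f_word Phi D u) p).
pose k := \big[Num.max/0]_u opn u.
have k1 : k < 1 by apply: bigmax_lt => // u _; case: (nP u).
have k0 : 0 <= k by exact: bigmax_ge_id.
set c' := c ^+ n.+1; have c'0 : 0 < c' by rewrite exprn_gt0.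
pose K := B%:R / c' + 2 * B%:R ^+ 2 / c' ^+ 2.
have K0 : 0 <= K by rewrite addr_ge0// !mulr_ge0// ?invr_ge0 ?exprn_ge0// ltW.
have k20 : 0 < (1 - k) / 2 by rewrite divr_gt0// subr_gt0.
(* The gap [1 - k] at [p] is shared: one half absorbs the factor's growth [K * x] at distance [x],
   the other dominates [m.+1%:R^-1]. *)
have [m _ /(_ _ (leqnn m))/= mk] := near_infty_natSinv_lt (PosNum k20).
exists (maxn n m), ((1 - k) / 2 / (K + 1)); first by rewrite divr_gt0// ltr_wpDl.
move=> p' [Lp' Fp'] pp'; exists n => [|u su v vb]; first exact: leq_maxl.
have vp := l2norm_ge0 v; have m0 := mass_gt0 u Lp; have m0' := mass_gt0 u Lp'.
have op : l2norm (dword u p v) <= k * l2norm v.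
  have /eqP su' := su; have [df _] := nP (Tuple su').
  have u0 : (0 < size u)%N by rewrite su.
  apply: le_trans (face_opnorm_bound u0 Lp df vb) _; rewrite ler_wpM2r//.
  exact: (le_bigmax 0 opn (Tuple su')).
have rr : mass (wordm u p) / mass (wordm u p') <= 1 + B%:R / c' * `|p - p'|.
  have cm : c' <= mass (wordm u p') by rewrite /c' -su; exact: mass_ge.
  have -> : mass (wordm u p) / mass (wordm u p') =
      1 + mass (wordm u (p - p')) / mass (wordm u p').
    by rewrite wordmB massB; field; rewrite gt_eqF.
  have H := le_trans (norm_mass_le _) (l1norm_wordm Phi u (p - p') sD).
  have {}H := le_trans H (l1norm_le_norm _).
  rewrite lerD2l mulrAC; apply: (@le_trans _ _ (`|mass (wordm u (p - p'))| / mass (wordm u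
    p'))).
    by rewrite ler_pM2r ?invr_gt0// ler_norm.
  by apply: ler_pM => //; [rewrite invr_ge0 ltW|rewrite lef_pV2 ?posrE].
apply: le_trans (dword_perturb v Lp Lp' (eq_leq su)) _; rewrite -/c'.
have x0 := normr_ge0 (p - p'); set x := `|p - p'| in pp' rr x0 *.
apply: (@le_trans _ _ ((1 + B%:R / c' * x) * (k * l2norm v) +
    2 * B%:R ^+ 2 / c' ^+ 2 * x * l2norm v)).
  by rewrite lerD2r ler_pM// ?divr_ge0 ?l2norm_ge0// ltW.
apply: (@le_trans _ _ ((k + K * x) * l2norm v)).
  rewrite mulrA -mulrDl ler_wpM2r// /K [(_ + _) * x]mulrDl addrA lerD2r.
  rewrite mulrDl mul1r lerD2l; apply: ler_piMr; last exact: ltW.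
  by rewrite mulr_ge0// divr_ge0// ltW.
rewrite ler_wpM2r//; move: pp'; rewrite ltr_pdivlMr ?ltr_wpDl// => pp'.
have mm : (maxn n m).+1%:R^-1 <= m.+1%:R^-1 :> R.
  by rewrite lef_pV2 ?posrE ?ltr0Sn// ler_nat ltnS leq_maxr.
have {}mm := le_lt_trans mm mk; rewrite /= in mm.
have {}pp' : K * x + x < (1 - k) / 2 by move: pp'; rewrite mulrDr mulr1 (mulrC x).
set y := _^-1 in mm *; clearbody y x k K; lra.
Qed.

Lemma dword_face_direction u a p v : L p ->
  face_direction Phi a (dword (rcons u a) p v).
Proof.
move=> Lp; split=> [i ia|]; first exact: dword_face.
by rewrite -/(mass _) mass_dword// mass_neq0.
Qed.

(** The word is cut into blocks whose lengths, at most [m.+1], depend on the current point of the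
    orbit; an incomplete last block costs the constant [C]. Differences of basis vectors span the
    directions of a face, and coordinates suit the scalar norms used later. *)
Lemma uniform_contraction (eta : R) : 0 < eta -> exists2 N, (0 < N)%N &
  forall u, (N <= size u)%N -> forall b p, (L `&` face Phi b) p ->
  forall i i', Phi i = b -> Phi i' = b ->
  forall j, `|dword u p (delta_mx 0 i - delta_mx 0 i') 0 j| <= eta.
Proof.
move=> eta0; have /choice[mb mbP] := locally_uniform_contraction.
pose m := \max_b mb b.
have mP b p : (L `&` face Phi b) p -> exists2 n, (n <= m)%N & forall u, size u = n.+1 ->
    forall v, face_direction Phi b v -> l2norm (dword u p v) <= (1 - m.+1%:R^-1) * l2norm v.
  move=> /(mbP b p)[n nm H]; have mm : (mb b <= m)%N by exact: leq_bigmax.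
  exists n => [|u su v vb]; first exact: leq_trans mm.
  apply: le_trans (H u su v vb) _; apply: ler_wpM2r; first exact: l2norm_ge0.
  by rewrite lerD2l lerN2 lef_pV2 ?posrE ?ltr0Sn// ler_nat ltnS.
set k := 1 - _ in mP.
have k01 : 0 <= k < 1.
  by rewrite subr_ge0 gtrBl invr_gt0 ltr0Sn invf_le1 ?ltr0Sn// ler1n.
have /andP[k0 k1] := k01.
pose C := 2 / c ^+ m.+1 * B%:R.
have C0 : 0 <= C by rewrite !mulr_ge0// invr_ge0 exprn_ge0// ltW.
(* [q] is a number of blocks that the length of [u] guarantees. After one block the base point is in
   [L] and the direction is parallel to the face of the block's last letter, so the induction
   continues there. *)
have main : forall N u, (size u < N)%N -> forall q, (q * m.+1 <= size u)%N ->
    forall b p, (L `&` face Phi b) p -> forall v, face_direction Phi b v ->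
    l2norm (dword u p v) <= C * k ^+ q * l2norm v.
  elim=> // N IH u uN q qu b p Lbp v vb; have vp := l2norm_ge0 v.
  have [um|mu] := leqP m.+1 (size u); last first.
    have -> : q = 0%N by case: q qu => // q; rewrite mulSn; lia.
    rewrite expr0 mulr1; apply: le_trans (l2norm_le_l1 _) _.
    apply: le_trans (l1norm_dword v Lbp.1 (ltnW mu)) _; rewrite /C -[leRHS]mulrA.
    apply: ler_wpM2l; last exact: l1norm_le_l2.
    by rewrite divr_ge0// exprn_ge0// ltW.
  have [n nm nP] := mP b p Lbp.
  have su1 : size (take n.+1 u) = n.+1 by rewrite size_takel// (leq_trans _ um).
  have sd : size (drop n.+1 u) = (size u - n.+1)%N by rewrite size_drop.
  have Lp := Lbp.1; rewrite -(cat_take_drop n.+1 u) dword_cat ?mass_neq0//.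
  have := nP _ su1 v vb.
  move: su1; case/lastP: (take n.+1 u) => // u1 a _ Hk.
  have Lap := nword_limit_face sD B0 r_gt0 u1 a Lp.
  apply: (@le_trans _ _ (C * k ^+ q.-1 * l2norm (dword (rcons u1 a) p v))).
    apply: (IH (drop n.+1 u) _ q.-1 _ a) => //; first by rewrite sd; lia.
      rewrite sd; case: q qu => // q; rewrite mulSn /=; lia.
    exact: dword_face_direction.
  apply: (@le_trans _ _ (C * k ^+ q.-1 * (k * l2norm v))).
    by apply: ler_wpM2l => //; rewrite mulr_ge0 ?exprn_ge0.
  rewrite mulrA ler_wpM2r// -mulrA -exprSr ler_wpM2l//.
  by case: (q) => // /=; rewrite expr1 expr0 ltW.
have : C * 2 * k ^+ q @[q --> \oo] --> 0.
  rewrite -[X in _ --> X](mulr0 (C * 2)); apply: cvgM; first exact: cvg_cst.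
  have kn : `|k| < 1 by rewrite ger0_norm.
  have := @cvg_geometric R 1 k kn; rewrite /geometric/=.
  by under eq_fun do rewrite mul1r.
move=> /cvgrPdist_le/(_ _ eta0)[q _ /(_ q (leqnn q))/=].
rewrite sub0r normrN ger0_norm => [qeta|]; last first.
  by apply: mulr_ge0; [apply: mulr_ge0|apply: exprn_ge0].
(* The successor makes [N] positive; the factor 2 in [C * 2] is for the norm of [v] below. *)
exists (q * m.+1).+1 => // u qu b p Lbp i i' ib ib' j.
set v := _ - _.
have vb : face_direction Phi b v.
  split=> [l lb|].
    rewrite !mxE !eqxx/=; have [li|_] := eqVneq l i; first by move: lb; rewrite li ib eqxx.
    by have [li|_] := eqVneq l i'; [move: lb; rewrite li ib' eqxx|rewrite subrr].
  rewrite -/(mass v) massB /mass.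
  have E l : \sum_(j < B) (delta_mx 0 l : 'rV[R]_B) 0 j = 1.
    by rewrite (bigD1 l)//= mxE !eqxx big1 ?addr0// => t tl; rewrite mxE (negPf tl) andbF.
  by rewrite !E subrr.
have v2 : l2norm v <= 2.
  apply: le_trans (l2norm_le_l1 _) _; apply: le_trans (l1normD _ _) _; rewrite l1normN.
  have E l : l1norm (delta_mx 0 l : 'rV[R]_B) = 1.
    rewrite /l1norm (bigD1 l)//= mxE !eqxx normr1 big1 ?addr0// => t tl.
    by rewrite mxE (negPf tl) andbF normr0.
  by rewrite !E.
apply: le_trans (norm_coord_le_l2 _ _) _; apply: le_trans (main _ u (ltnSn _) q _ b p Lbp v
  vb) _.
  exact: ltnW.
apply: le_trans qeta; rewrite [leRHS]mulrAC ler_wpM2l// mulr_ge0// exprn_ge0//.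
Qed.

End UniformContraction.

(** * Perturbation of the contraction estimates *)

Section Perturbation.
Variables (R : realType) (A B : nat) (Phi : 'I_B -> 'I_A) (D : 'M[R]_B).
Hypothesis sD : stochastic D.
Variables (p q : nat) (Dx : 'M[R]_(p, q) -> 'M[R]_B) (d : R).
Hypothesis d0 : 0 < d.
Implicit Types (w : 'rV[R]_B) (a b : 'I_A) (u v : seq 'I_A).
Implicit Types (F G : 'M[R]_(p, q) -> 'rV[R]_B).

Local Notation majorized := (@majorized R p q d).
Local Notation wordm := (@wordm R A B Phi).
Local Notation nword := (@nword R A B Phi).
Local Notation delta i := (delta_mx 0 i : 'rV[R]_B).

Lemma wordm_coord D' v w j :
  wordm D' v w 0 j = \sum_i w 0 i * wordm D' v (delta i) 0 j.
Proof.
rewrite {1}(row_sum_delta w) wordm_sum summxE.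
by apply: eq_bigr => i _; rewrite wordmZ mxE.
Qed.

Lemma wordm_delta_le1 v i j : 0 <= wordm D v (delta i) 0 j <= 1.
Proof.
have d0' k : 0 <= delta i 0 k by rewrite mxE ler0n.
rewrite (wordm_ge0 _ _ sD.1)//=; apply: le_trans (ler_norm _) _.
apply: le_trans (norm_coord_le_l1 _ _) _; apply: le_trans (l1norm_wordm _ _ _ sD) _.
rewrite l1norm_mass// /mass (bigD1 i)//= mxE !eqxx big1 ?addr0// => k ki.
by rewrite mxE (negPf ki) andbF.
Qed.

Definition rows_close (e1 : R) v := forall i j,
  majorized (fun x => wordm (Dx x) v (delta i) 0 j - wordm D v (delta i) 0 j) e1.

(** [w] need not be [F 0]: the constant terms may differ by up to [e], so a point of [L] can serve
    as reference for an orbit that is only close to [L]. *)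
Definition near_point (e : R) F w := forall i, majorized (fun x => F x 0 i - w 0 i) e.

(** A coordinate of a product is a sum of [B] terms. Each contributes the matrix error [e1],
    weighted by a coordinate of [w], and the point error [e] times an entry of norm at most
    [1 + e1]. *)
Definition spread (e1 e : R) : R := B%:R * (e1 + e * (1 + e1)).

Lemma majorized_wordm_near (e1 e : R) v F w : rows_close e1 v -> simplex w ->
  near_point e F w -> near_point (spread e1 e) (fun x => wordm (Dx x) v (F x)) (wordm D v w).
Proof.
move=> ve sw Fw j.
have -> : spread e1 e = \sum_(i < B) (1 * e1 + e * (1 + e1)).
  by rewrite /spread mul1r sumr_const card_ord mulr_natl.
have : majorized (fun x => \sum_i (w 0 i * (wordm (Dx x) v (delta i) 0 j - wordm D v (delta
  i) 0 j) +
    (F x 0 i - w 0 i) * wordm (Dx x) v (delta i) 0 j)) (\sum_(i < B) (1 * e1 + e * (1 + e1))).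
  apply: majorized_sum => // i _; apply: majorizedD.
    apply: majorized_le (majorizedZ d0 (w 0 i) (ve i j)).
    have /andP[w0 w1] := simplex_le1 i sw.
    by rewrite ger0_norm// ler_wpM2r// (majorized_ge0 (ve i j)).
  apply: majorizedM => //.
  have /andP[W0 W1] := wordm_delta_le1 v i j.
  have := majorizedD (majorized_cst p q d0 (wordm D v (delta i) 0 j)) (ve i j).
  move=> /majorized_le H; apply: majorized_ext (H _ _) => [x _|]; first by rewrite subrKC.
  by rewrite ger0_norm// lerD2r.
apply: majorized_ext => x _.
rewrite [in RHS]wordm_coord [X in _ - X]wordm_coord -sumrB.
by apply: eq_bigr => i _; ring.
Qed.

Lemma majorized_mass_near (e : R) F w : near_point e F w ->
  majorized (fun x => mass (F x) - mass w) (B%:R * e).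
Proof.
move=> Fw; have -> : B%:R * e = \sum_(i < B) e by rewrite sumr_const card_ord mulr_natl.
by apply: majorized_ext (majorized_sum d0 _ (fun i _ => Fw i)) => x _; rewrite sumrB.
Qed.

Lemma majorized_mass_inv (e1 e : R) v F w : rows_close e1 v -> simplex w ->
  near_point e F w -> B%:R * spread e1 e < mass (wordm D v w) ->
  majorized (fun x => (mass (wordm (Dx x) v (F x)))^-1)
    (mass (wordm D v w) - B%:R * spread e1 e)^-1.
Proof.
move=> ve sw Fw lt; apply: majorized_inv => //.
exact: majorized_mass_near (majorized_wordm_near ve sw Fw).
Qed.

Lemma near_point_mass_gt0 (e1 e : R) v F w x : rows_close e1 v -> simplex w ->
  near_point e F w -> B%:R * spread e1 e < mass (wordm D v w) -> cube d x ->
  0 < mass (wordm (Dx x) v (F x)).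
Proof.
move=> ve sw Fw lt xd.
have := majorized_norm (majorized_mass_near (majorized_wordm_near ve sw Fw)) xd.
by rewrite ler_norml => /andP[+ _]; lra.
Qed.

Lemma majorized_nword_near (e1 e m : R) v F w : rows_close e1 v -> simplex w ->
  near_point e F w -> 0 < m <= mass (wordm D v w) -> B%:R * spread e1 e <= m / 4 ->
  near_point (2 * (1 + B%:R) * spread e1 e / m) (fun x => nword (Dx x) v (F x)) (nword D v w).
Proof.
move=> ve sw Fw /andP[m0 mw] lt j.
have H := majorized_wordm_near ve sw Fw; have Hm := majorized_mass_near H.
set t := spread e1 e in lt H Hm *; have t0 := majorized_ge0 (H j).
have lt' : B%:R * t < mass (wordm D v w) by lra.
have Hi := majorized_mass_inv ve sw Fw lt'.
have Wge0 : 0 <= nword D v w 0 j <= 1.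
  apply: simplex_le1; apply: nword_simplex => //; first by case: sw.
  by rewrite gt_eqF//; lra.
(* With [t] the spread, the numerator is off by [t] and the mass by [B t]; both are divided by the
   perturbed mass, whose inverse has norm at most [2 / m]. *)
apply: (@majorized_ext _ _ _ _ (fun x => (wordm (Dx x) v (F x) 0 j - wordm D v w 0 j) *
  (mass (wordm (Dx x) v (F x)))^-1
   - nword D v w 0 j * ((mass (wordm (Dx x) v (F x)) - mass (wordm D v w)) * (mass (wordm
     (Dx x) v (F x)))^-1))).
  move=> x xd; have mx := near_point_mass_gt0 ve sw Fw lt' xd.
  have mx' := lt0r_neq0 mx; have mw' := lt0r_neq0 (lt_le_trans m0 mw).
  by rewrite !mxE; field; rewrite mx' mw'.
apply: majorized_le (majorizedB d0 (majorizedM d0 (H j) Hi) (majorizedZ d0 _ (majorizedM d0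
  Hm Hi))).
have /andP[W0 W1] := Wge0; rewrite (ger0_norm W0).
have mt : m / 2 <= mass (wordm D v w) - B%:R * t by lra.
set r := mass (wordm D v w) - B%:R * t in mt *; set i := r^-1.
have i0 : 0 <= i by rewrite invr_ge0; lra.
have im : i <= 2 / m.
  by rewrite -[leRHS]invrK invf_div lef_pV2 ?posrE; lra.
have Bt0 : 0 <= B%:R * t by rewrite mulr_ge0.
apply: (@le_trans _ _ (t * i + 1 * (B%:R * t * i))).
  by rewrite lerD2l ler_wpM2r// mulr_ge0.
rewrite [leLHS](_ : _ = (1 + B%:R) * t * i); last by ring.
rewrite [leRHS](_ : _ = (1 + B%:R) * t * (2 / m)); last by ring.
by rewrite ler_wpM2l// mulr_ge0// addr_ge0.
Qed.

End Perturbation.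

Section ContractionStep.
Variables (R : realType) (A B : nat) (Phi : 'I_B -> 'I_A) (D : 'M[R]_B).
Hypothesis sD : stochastic D.
Hypothesis B0 : (0 < B)%N.
Variables (p q : nat) (Dx : 'M[R]_(p, q) -> 'M[R]_B) (d : R).
Hypothesis d0 : 0 < d.
Implicit Types (w : 'rV[R]_B) (a b : 'I_A) (u v : seq 'I_A).
Implicit Types (F G : 'M[R]_(p, q) -> 'rV[R]_B).

Local Notation majorized := (@majorized R p q d).
Local Notation wordm := (@wordm R A B Phi).
Local Notation nword := (@nword R A B Phi).
Local Notation dword := (@dword R A B Phi).
Local Notation delta i := (delta_mx 0 i : 'rV[R]_B).
Local Notation near_point := (@near_point R B p q d).
Local Notation rows_close := (@rows_close R A B Phi D p q Dx d).

(** With [t] the spread and [k = 2 (1 + B) t / m <= 1] the error of [nword], the numerator of a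
    difference quotient is off by at most [2 t + 2 B t + 2 B t + 2 k], which is
    [t * contraction_cst m]. *)
Definition contraction_cst (m : R) : R := 2 + 4 * B%:R + 4 * (1 + B%:R) / m.

Lemma spread_ge (e1 e : R) : 0 <= e1 -> 0 <= e -> e1 <= spread B e1 e.
Proof.
move=> e10 e0; rewrite /spread mulrDr -[leLHS]addr0 lerD ?mulr_ge0 ?addr_ge0//.
by rewrite ler_peMl// ler1n.
Qed.

(* The difference quotient of [nword] along [delta i - delta i'], with the
   denominator taken at a point where it is at least as large as at [w']. *)
Lemma majorized_quotient (e1 e m eta : R) v F F' w w' (i i' j : 'I_B) :
  rows_close e1 v -> simplex w -> simplex w' -> near_point e F w -> near_point e F' w' ->
  0 < m <= 1 -> m <= mass (wordm D v w') <= mass (wordm D v w) ->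
  0 < eta -> `|dword D v w' (delta i - delta i') 0 j| <= eta ->
  B%:R * spread B e1 e <= m / 4 -> 2 * (1 + B%:R) * spread B e1 e <= m ->
  spread B e1 e * contraction_cst m <= eta * m / 4 ->
  majorized (fun x => (mass (wordm (Dx x) v (F x)))^-1 *
     (wordm (Dx x) v (delta i - delta i') 0 j -
      mass (wordm (Dx x) v (delta i - delta i')) * nword (Dx x) v (F' x) 0 j)) (2 * eta).
Proof.
move=> ve sw sw' Fw Fw' /andP[m0 m1] /andP[mw' ww'] eta0 weta Bt Bt2 tK.
have e0 := majorized_ge0 (Fw j); have e10 := majorized_ge0 (ve i j).
have e1t := spread_ge e10 e0; set t := spread B e1 e in Bt Bt2 tK e1t.
have t0 : 0 <= t by exact: le_trans e1t.
pose Q x := wordm (Dx x) v (delta i - delta i') : 'rV[R]_B.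
set Q0 := wordm D v (delta i - delta i').
pose f x := nword (Dx x) v (F' x) 0 j; set f0 := nword D v w' 0 j.
have B1 : 1 <= B%:R :> R by rewrite ler1n.
set r := mass (wordm D v w) in ww'; set r' := mass (wordm D v w') in mw' ww'.
have HQ k : majorized (fun x => Q x 0 k - Q0 0 k) (2 * e1).
  have -> : 2 * e1 = e1 + e1 by ring.
  apply: majorized_ext (majorizedB d0 (ve i k) (ve i' k)) => x _.
  by rewrite /Q /Q0 !wordmB !mxE; ring.
have HmQ := majorized_mass_near d0 HQ.
have Hf : majorized (fun x => f x - f0) (2 * (1 + B%:R) * t / m).
  by apply: majorized_nword_near => //; rewrite m0.
set k := 2 * (1 + B%:R) * t / m in Hf; have k0 : 0 <= k := majorized_ge0 Hf.
have k1 : k <= 1 by rewrite ler_pdivrMr// mul1r.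
have /andP[f00 f01] : 0 <= f0 <= 1.
  apply: simplex_le1; apply: nword_simplex => //; first by case: sw'.
  by rewrite gt_eqF// (lt_le_trans m0).
have mQ0 : `|mass Q0| <= 2.
  apply: le_trans (norm_mass_le _) _; apply: le_trans (l1norm_wordm _ _ _ sD) _.
  apply: le_trans (l1normD _ _) _; rewrite l1normN.
  have E l : l1norm (delta l) = 1.
    rewrite /l1norm (bigD1 l)//= mxE !eqxx normr1 big1 ?addr0// => l' ll.
    by rewrite mxE (negPf ll) andbF normr0.
  by rewrite !E.
have Hnum : majorized (fun x => (Q x 0 j - mass (Q x) * f x) - (Q0 0 j - mass Q0 * f0))
    (2 * e1 + ((B%:R * (2 * e1)) * k + (`|f0| * (B%:R * (2 * e1)) + `|mass Q0| * k))).
  have := majorizedB d0 (HQ j) (majorizedD (majorizedM d0 HmQ Hf)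
    (majorizedD (majorizedZ d0 f0 HmQ) (majorizedZ d0 (mass Q0) Hf))).
  by apply: majorized_ext => x _; ring.
(* The derivative at [w'] yields [eta * r']; the assumption that [w] has the larger mass turns this
   into [eta * r], matching the denominator. *)
have num0 : `|Q0 0 j - mass Q0 * f0| <= eta * r.
  have r'0 : 0 < r' by exact: lt_le_trans mw'.
  have -> : Q0 0 j - mass Q0 * f0 = r' * dword D v w' (delta i - delta i') 0 j.
    by rewrite [dword _ _ _ _ 0 j]mxE mulrA divff ?gt_eqF// mul1r /f0 !mxE.
  rewrite normrM (gtr0_norm r'0) mulrC.
  by apply: ler_pM => //; exact: ltW.
have Htot := majorizedD (majorized_cst p q d0 (Q0 0 j - mass Q0 * f0)) Hnum.
have lt' : B%:R * t < r by lra.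
have Hinv := majorized_mass_inv sD d0 ve sw Fw lt'.
have := majorizedM d0 Hinv Htot; rewrite -/r -/t => /majorized_le H.
apply: majorized_ext (H _ _) => [x _|]; first by rewrite subrKC.
have r0 : 0 < r by lra.
have rt : 3 / 4 * r <= r - B%:R * t by lra.
have rt0 : 0 < r - B%:R * t by lra.
rewrite mulrC ler_pdivrMr//.
have tail : 2 * e1 + (B%:R * (2 * e1) * k + (`|f0| * (B%:R * (2 * e1)) + `|mass Q0| * k))
  <= eta * m / 4.
  apply: le_trans tK.
  have -> : t * contraction_cst m = 2 * t + ((B%:R * (2 * t)) * 1 + (1 * (B%:R * (2 * t)) +
    2 * k)).
    by rewrite /contraction_cst /k; field; rewrite gt_eqF.
  have Be : B%:R * (2 * e1) <= B%:R * (2 * t) by rewrite !ler_wpM2l.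
  have Be0 : 0 <= B%:R * (2 * e1) by rewrite !mulr_ge0.
  apply: lerD; first by rewrite ler_wpM2l.
  apply: lerD; first exact: ler_pM.
  apply: lerD; last by rewrite ler_wpM2r.
  by apply: ler_pM => //; rewrite ger0_norm.
have em : eta * m / 4 <= eta * r / 4 by rewrite ler_pM2r// ler_pM2l//; lra.
have er : 0 <= eta * r by rewrite mulr_ge0 ?ltW.
(* The quotient of [5 / 4 * eta * r] by [3 / 4 * r] is below [2 * eta]: the factor 2 is the price of
   the perturbation. *)
apply: (@le_trans _ _ (eta * r + eta * r / 4)).
  by apply: (lerD num0); apply: le_trans tail em.
apply: (@le_trans _ _ (2 * eta * (3 / 4 * r))); last by rewrite ler_wpM2l// mulr_ge0// ltW.
rewrite [leRHS](_ : _ = 3 / 2 * (eta * r)); last by field.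
by lra.
Qed.

(** As masses and coordinates off the face agree, [w - w'] is a combination of the fixed directions
    [delta i - delta i0]. The varying data enter only as coefficients, so contraction is required in
    finitely many directions. *)
Lemma nwordB_face D' v b w w' i0 : Phi i0 = b ->
  mass (wordm D' v w) != 0 -> mass (wordm D' v w') != 0 ->
  mass w = mass w' -> (forall i, Phi i != b -> w 0 i = w' 0 i) ->
  forall j, nword D' v w 0 j - nword D' v w' 0 j =
    \sum_(i | Phi i == b) (w 0 i - w' 0 i) * ((mass (wordm D' v w))^-1 *
     (wordm D' v (delta i - delta i0) 0 j -
      mass (wordm D' v (delta i - delta i0)) * nword D' v w' 0 j)).
Proof.
move=> i0b m0 m0' mm off j.
have E : w - w' = \sum_(i | Phi i == b) (w 0 i - w' 0 i) *: (delta i - delta i0).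
  rewrite (eq_bigr (fun i => (w 0 i - w' 0 i) *: delta i - (w 0 i - w' 0 i) *: delta i0));
    last first.
    by move=> i _; rewrite scalerBr.
  have offB (i : 'I_B) : Phi i != b -> w 0 i - w' 0 i = 0 by move=> ib; rewrite off// subrr.
  rewrite sumrB -scaler_suml.
  have -> : \sum_(i | Phi i == b) (w 0 i - w' 0 i) = 0.
    have : mass (w - w') = 0 by rewrite massB mm subrr.
    rewrite /mass (bigID (fun i => Phi i == b))/= [X in _ + X]big1 ?addr0.
      by move=> H; rewrite -[RHS]H; apply: eq_bigr => i _; rewrite !mxE.
    by move=> i ib; rewrite !mxE offB.
  rewrite scale0r subr0 {1}(row_sum_delta (w - w')) (bigID (fun i => Phi i == b))/=.
  rewrite [X in _ + X]big1 ?addr0; last by move=> i ib; rewrite !mxE offB ?scale0r.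
  by apply: eq_bigr => i _; rewrite !mxE.
have -> : nword D' v w 0 j - nword D' v w' 0 j = (nword D' v w - nword D' v w') 0 j.
  by rewrite [RHS]mxE; congr (_ + _); rewrite [RHS]mxE.
have cancel (y : R) : mass (wordm D' v w') / mass (wordm D' v w) *
    ((mass (wordm D' v w'))^-1 * y) = (mass (wordm D' v w))^-1 * y.
  by field; rewrite m0 m0'.
rewrite nwordB// [LHS]mxE [dword _ _ _ _ 0 j]mxE cancel.
have coordBZ (X f : 'rV[R]_B) (k : R) : (X - k *: f) 0 j = X 0 j - k * f 0 j.
  by rewrite !mxE.
rewrite coordBZ E.
rewrite wordm_sum summxE.
have -> : mass (\sum_(i | Phi i == b) wordm D' v ((w 0 i - w' 0 i) *: (delta i - delta i0))) =
   \sum_(i | Phi i == b) mass (wordm D' v ((w 0 i - w' 0 i) *: (delta i - delta i0))).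
  by rewrite /mass exchange_big/=; apply: eq_bigr => k _; rewrite summxE.
rewrite mulr_suml -sumrB mulr_sumr; apply: eq_bigr => i _.
have coordZ (X : 'rV[R]_B) (k : R) : (k *: X) 0 j = k * X 0 j by rewrite mxE.
by rewrite wordmZ massZ coordZ; ring.
Qed.

Lemma majorized_contraction (e1 e m eta K : R) v b F F' w w' :
  rows_close e1 v -> simplex w -> simplex w' -> near_point e F w -> near_point e F' w' ->
  0 < m <= 1 -> m <= mass (wordm D v w) -> m <= mass (wordm D v w') ->
  0 < eta -> (forall i i', Phi i = b -> Phi i' = b -> forall j,
     `|dword D v w (delta i - delta i') 0 j| <= eta /\
     `|dword D v w' (delta i - delta i') 0 j| <= eta) ->
  B%:R * spread B e1 e <= m / 4 -> 2 * (1 + B%:R) * spread B e1 e <= m ->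
  spread B e1 e * contraction_cst m <= eta * m / 4 ->
  (forall x, cube d x -> mass (F x) = mass (F' x)) ->
  (forall x i, cube d x -> Phi i != b -> F x 0 i = 0 /\ F' x 0 i = 0) ->
  (exists i0, Phi i0 = b) ->
  (forall i, majorized (fun x => F x 0 i - F' x 0 i) K) ->
  forall j, majorized (fun x => nword (Dx x) v (F x) 0 j - nword (Dx x) v (F' x) 0 j)
    (B%:R * (K * (2 * eta))).
Proof.
move=> ve sw sw' Fw Fw' m01 mw mw' eta0 weta Bt Bt2 tK mF off [i0 i0b] FK j.
(* Which mass is larger is decided at the reference points, where masses are numbers; norms do not
   see the sign of the exchanged difference. *)
wlog ww' : w w' F F' sw sw' Fw Fw' mw mw' weta mF off FK /
    mass (wordm D v w') <= mass (wordm D v w).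
  move=> W; have [ww'|/ltW ww'] := leP (mass (wordm D v w')) (mass (wordm D v w)).
    exact: (W w w' F F').
  have := majorizedN d0 (W w' w F' F sw' sw Fw' Fw mw' mw _ _ _ _ ww').
  have H1 i i' : Phi i = b -> Phi i' = b -> forall j,
     `|dword D v w' (delta i - delta i') 0 j| <= eta /\
     `|dword D v w (delta i - delta i') 0 j| <= eta.
    by move=> ib ib' k; case: (weta i i' ib ib' k).
  have H2 x : cube d x -> mass (F' x) = mass (F x) by move=> /mF.
  have H3 x i : cube d x -> Phi i != b -> F' x 0 i = 0 /\ F x 0 i = 0.
    by move=> xd ib; case: (off x i xd ib).
  have H4 i : majorized (fun x => F' x 0 i - F x 0 i) K.
    by apply: majorized_ext (majorizedN d0 (FK i)) => x _; rewrite opprB.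
  by move=> /(_ H1 H2 H3 H4); apply: majorized_ext => x _; rewrite opprB.
have [m0 m1] := andP m01.
have K0 : 0 <= K := majorized_ge0 (FK j).
have lt1 : B%:R * spread B e1 e < mass (wordm D v w) by lra.
have lt2 : B%:R * spread B e1 e < mass (wordm D v w') by lra.
have := majorized_sum d0 (index_enum 'I_B) (P := fun i => Phi i == b) (fun i ib =>
  majorizedM d0 (FK i) (majorized_quotient (i := i) (i' := i0) (j := j) ve sw sw' Fw Fw' m01
    (introT andP (conj mw' ww')) eta0 (weta i i0 (eqP ib) i0b j).2 Bt Bt2 tK)).
move=> /majorized_le H; apply: majorized_ext (H _ _) => [x xd|].
  rewrite -(nwordB_face i0b)//.
  - by rewrite gt_eqF// (near_point_mass_gt0 sD d0 ve sw Fw lt1).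
  - by rewrite gt_eqF// (near_point_mass_gt0 sD d0 ve sw' Fw' lt2).
  - exact: mF.
  - by move=> i ib; case: (off x i xd ib) => -> ->.
rewrite sumr_const -[leLHS]mulr_natl ler_wpM2r//.
  by rewrite mulr_ge0// mulr_ge0// ltW.
by rewrite ler_nat (leq_trans (max_card _))// card_ord.
Qed.

End ContractionStep.

(** * Analytic germs and the stationary vector *)

Section SimpleEigenvalue.
Variables (F : fieldType) (n : nat).
Implicit Types (D : 'M[F]_n) (v w : 'rV[F]_n).

(** Geometric multiplicity is at most algebraic multiplicity: an invertible [P] kills the last
    [n - r] rows of [x - D], so these rows of [P (X - D)] are divisible by [X - x], and the
    determinant by its power. *)
Lemma corank_le_mup D (x : F) : (n - \rank (x%:M - D)%R <= mup x (char_poly D))%N.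
Proof.
set M := x%:M - D; set r := \rank M.
rewrite mup_geq ?monic_neq0 ?char_poly_monic//.
pose P := invmx (col_ebase M).
have PM (i j : 'I_n) : (r <= i)%N -> (P *m M) i j = 0.
  move=> ri; rewrite -(mulmx_ebase M) -mulmxA mulKmx ?col_ebase_unit//.
  rewrite mxE big1// => k _; rewrite mxE -/r.
  by rewrite (ltnNge _ r) ri andbF mul0r.
pose Pp := map_mx polyC P; pose Q := Pp *m char_poly_mx D.
have QE (i j : 'I_n) : (r <= i)%N -> Q i j = ('X - x%:P) * Pp i j.
  move=> ri.
  have -> : Q = (('X - x%:P)%:M *m Pp) + map_mx polyC (P *m M).
    rewrite /Q /Pp /M map_mxM map_mxB map_scalar_mx -scalar_mxC -mulmxDr.
    congr (_ *m _); rewrite addrA /char_poly_mx; congr (_ - _).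
    by rewrite -raddfD/= subrK.
  by rewrite mul_scalar_mx [LHS]mxE [X in X + _]mxE [X in _ + X]mxE PM// polyC0 addr0.
pose t : 'rV[{poly F}]_n := \row_i (if (r <= i)%N then 'X - x%:P else 1).
pose Q' := \matrix_(i, j) (if (r <= i)%N then Pp i j else Q i j).
have QQ' : Q = diag_mx t *m Q'.
  apply/matrixP => i j; rewrite mul_diag_mx [RHS]mxE [t _ _]mxE [Q' _ _]mxE; case: ifP =>
    ri; last by rewrite mul1r.
  exact: QE.
have detQ : \det Q = (\det P)%:P * char_poly D by rewrite det_mulmx det_map_mx.
have detP : \det P != 0 by rewrite det_inv invr_eq0 -unitfE -unitmxE col_ebase_unit.
have : ('X - x%:P) ^+ (n - r) %| \det Q.
  rewrite QQ' det_mulmx det_diag dvdp_mulr//.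
  rewrite (bigID (fun i : 'I_n => (r <= i)%N))/= dvdp_mulr//.
  rewrite (eq_bigr (fun=> 'X - x%:P)) => [|i ri]; last by rewrite mxE ri.
  rewrite -(big_mkord (fun i => (r <= i)%N) (fun=> 'X - x%:P)).
  have <- : \prod_(r <= i < n) ('X - x%:P) = \prod_(0 <= i < n | (r <= i)%N) ('X - x%:P).
    by rewrite (big_nat_widenl _ 0).
  by rewrite prodr_const_nat.
by rewrite detQ mul_polyC dvdpZr.
Qed.

Lemma simple_left_eigenvector D (x : F) v w :
  mup x (char_poly D) = 1%N -> v != 0 -> v *m D = x *: v -> w *m D = x *: w ->
  exists a, w = a *: v.
Proof.
move=> mupx v0 vD wD; apply/sub_rVP.
have ker (u : 'rV[F]_n) : u *m D = x *: u -> (u <= kermx (x%:M - D))%MS.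
  by move=> uD; apply/sub_kermxP; rewrite mulmxBr mul_mx_scalar uD subrr.
have vk := ker v vD; have wk := ker w wD.
apply: submx_trans wk _.
rewrite -(mxrank_leqif_sup vk).2 rank_rV v0 eqn_leq mxrank_ker.
rewrite (leq_trans (corank_le_mup D x)) ?mupx// andbT.
by have := mxrankS vk; rewrite rank_rV v0 mxrank_ker.
Qed.

End SimpleEigenvalue.

Section Germs.
Variables (R : realType) (p q : nat).
Implicit Types (F G : 'M[R]_(p, q) -> R) (c : R).

(* [F] is analytic at 0 with value [c]: the non-constant part of its power
   series is arbitrarily small on small cubes. *)
Definition germ F c := forall e : R, 0 < e ->
  \forall d \near (0 : R)^'+, majorized d (fun x => F x - c) e.

Lemma germ_ext F G c : (forall x, F x = G x) -> germ F c -> germ G c.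
Proof.
move=> FG Fc e e0; apply: filterS (Fc e e0) => d.
by apply: majorized_ext => x _; rewrite FG.
Qed.

Lemma germ_cst c : germ (fun=> c) c.
Proof.
move=> e e0; near=> d; have d0 : 0 < d by near: d; exact: nbhs_right_gt.
by apply: majorized_ext (majorized0 p q d0 (ltW e0)) => x _; rewrite subrr.
Unshelve. all: by end_near. Qed.

Lemma germD F G c c' : germ F c -> germ G c' -> germ (fun x => F x + G x) (c + c').
Proof.
move=> Fc Gc e e0; have e20 : 0 < e / 2 by rewrite divr_gt0.
apply: filterS2 (Fc _ e20) (Gc _ e20) => d Fd Gd.
by rewrite (splitr e); apply: majorized_ext (majorizedD Fd Gd) => x _; ring.
Qed.

Lemma germM F G c c' : germ F c -> germ G c' -> germ (fun x => F x * G x) (c * c').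
Proof.
move=> Fc Gc e e0; pose k := `|c| + `|c'| + 1.
have k0 : 0 < k by rewrite ltr_wpDl// addr_ge0.
pose e1 := Num.min 1 (e / k).
have e10 : 0 < e1 by rewrite lt_min ltr01 divr_gt0.
have e11 : e1 <= 1 by rewrite ge_min lexx.
have e1k : e1 * k <= e by rewrite -ler_pdivlMr// ge_min lexx orbT.
apply: filterS3 (Fc _ e10) (Gc _ e10) (nbhs_right_gt 0) => d Fd Gd d0.
have := majorizedD (majorizedM d0 Fd (majorizedD (majorized_cst p q d0 c') Gd))
  (majorizedZ d0 c Gd).
move=> /majorized_le H; apply: majorized_ext (H _ _) => [x _|]; first by ring.
apply: le_trans e1k; rewrite /k.
have := ler_wpM2l (ltW e10) e11; have := normr_ge0 c; lra.
Qed.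

Lemma germZ F c k : germ F c -> germ (fun x => k * F x) (k * c).
Proof. by move=> Fc; apply: germM => //; exact: germ_cst. Qed.

Lemma germN F c : germ F c -> germ (fun x => - F x) (- c).
Proof.
move=> /(germZ (-1)); rewrite mulN1r; apply: germ_ext => x; exact: mulN1r.
Qed.

Lemma germB F G c c' : germ F c -> germ G c' -> germ (fun x => F x - G x) (c - c').
Proof. by move=> Fc Gc; apply: germD => //; exact: germN. Qed.

Lemma germ_sum (I : Type) (r : seq I) (P : pred I) (F : I -> _ -> R) (c : I -> R) :
  (forall i, germ (F i) (c i)) ->
  germ (fun x => \sum_(i <- r | P i) F i x) (\sum_(i <- r | P i) c i).
Proof.
move=> Fc; elim: r => [|i r IH].
  by rewrite big_nil; apply: germ_ext (germ_cst 0) => x; rewrite big_nil.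
rewrite big_cons; case: ifP => Pi; last by apply: germ_ext IH => x; rewrite big_cons Pi.
by apply: germ_ext (germD (Fc i) IH) => x; rewrite big_cons Pi.
Qed.

Lemma germ_prod (I : Type) (r : seq I) (F : I -> _ -> R) (c : I -> R) :
  (forall i, germ (F i) (c i)) ->
  germ (fun x => \prod_(i <- r) F i x) (\prod_(i <- r) c i).
Proof.
move=> Fc; elim: r => [|i r IH].
  by rewrite big_nil; apply: germ_ext (germ_cst 1) => x; rewrite big_nil.
by rewrite big_cons; apply: germ_ext (germM (Fc i) IH) => x; rewrite big_cons.
Qed.

Lemma germ_norm_le F c (e : R) : germ F c -> 0 < e ->
  \forall d \near (0 : R)^'+, forall x, cube d x -> `|F x - c| <= e.
Proof.
by move=> Fc e0; apply: filterS (Fc e e0) => d Fd x; exact: majorized_norm Fd.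
Qed.

Lemma germ_inv_gt0 F c : 0 < c -> germ F c -> germ (fun x => (F x)^-1) c^-1.
Proof.
(* [1 / F - 1 / c = - (F - c) / (c F)]: the first bound gives [1 / F] norm at most [2 / c], the
   second then gives [e]. *)
move=> c0 Fc e e0; pose e1 := Num.min (c / 2) (e * c ^+ 2 / 2).
have e10 : 0 < e1 by rewrite lt_min !divr_gt0// mulr_gt0// exprn_gt0.
have e1c : e1 <= c / 2 by rewrite ge_min lexx.
have e1e : e1 <= e * c ^+ 2 / 2 by rewrite ge_min lexx orbT.
apply: filterS2 (Fc _ e10) (nbhs_right_gt 0) => d Fd d0.
have e1c' : e1 < c by lra.
have Hi := majorized_inv d0 e1c' Fd.
have := majorizedM d0 (majorizedZ d0 (- c^-1) Fd) Hi.
move=> /majorized_le H; apply: majorized_ext (H _ _) => [x xd|].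
  have Fx : 0 < F x by have := majorized_norm Fd xd; rewrite ler_norml => /andP[]; lra.
  by field; rewrite !gt_eqF.
rewrite normrN gtr0_norm ?invr_gt0//.
have i2 : (c - e1)^-1 <= 2 / c by rewrite -[leRHS]invrK invf_div lef_pV2 ?posrE; lra.
apply: (@le_trans _ _ (c^-1 * (e * c ^+ 2 / 2) * (2 / c))).
  have ci : 0 <= c^-1 by rewrite invr_ge0 ltW.
  apply: ler_pM => //; first by rewrite mulr_ge0// ltW.
    by rewrite invr_ge0; lra.
  by rewrite ler_wpM2l.
by rewrite le_eqVlt; apply/orP; left; apply/eqP; field; rewrite gt_eqF.
Qed.

Lemma germ_inv F c : c != 0 -> germ F c -> germ (fun x => (F x)^-1) c^-1.
Proof.
rewrite neq_lt => /orP[c0|]; last exact: germ_inv_gt0.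
move=> /germN Fc; rewrite -[c]opprK invrN.
have := germN (germ_inv_gt0 (_ : 0 < - c) Fc); rewrite oppr_gt0 => /(_ c0).
by apply: germ_ext => x; rewrite invrN opprK.
Qed.

Lemma germ_det n (M : 'M[R]_(p, q) -> 'M[R]_n) (M0 : 'M[R]_n) :
  (forall i j, germ (fun x => M x i j) (M0 i j)) -> germ (fun x => \det (M x)) (\det M0).
Proof.
move=> HM; apply: germ_sum => s; apply: germZ; apply: germ_prod => i; exact: HM.
Qed.

Lemma germ_adj n (M : 'M[R]_(p, q) -> 'M[R]_n) (M0 : 'M[R]_n) i j :
  (forall i j, germ (fun x => M x i j) (M0 i j)) ->
  germ (fun x => (\adj (M x)) i j) ((\adj M0) i j).
Proof.
move=> HM; rewrite mxE; apply: germ_ext; first by move=> x; rewrite mxE.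
rewrite /cofactor; apply: germZ; apply: germ_det => k l.
by rewrite !mxE; apply: germ_ext (HM _ _) => x; rewrite !mxE.
Qed.

End Germs.

Section StationaryVector.
Variables (R : realType) (B : nat).
Hypothesis B0 : (0 < B)%N.
Implicit Types (D : 'M[R]_B) (w : 'rV[R]_B).

(* [I - D + 1 e], where [e] is the uniform probability row vector: the
   stationary vectors of [D] are the solutions of [w *m bordered D = e]. *)
Definition bordered D : 'M[R]_B := 1%:M - D + const_mx B%:R^-1.

Definition solved_vec D : 'rV[R]_B := const_mx B%:R^-1 *m invmx (bordered D).

Let B1 : B%:R != 0 :> R. Proof. by rewrite pnatr_eq0 -lt0n. Qed.

Let mass_e : mass (const_mx B%:R^-1 : 'rV[R]_B) = 1.
Proof.
rewrite /mass; under eq_bigr do rewrite mxE.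
by rewrite sumr_const card_ord -[_ *+ _]mulr_natl divff.
Qed.

Lemma mul_bordered D w : w *m bordered D = w - w *m D + mass w *: const_mx B%:R^-1.
Proof.
rewrite mulmxDr mulmxBr mulmx1; congr (_ + _); apply/rowP => j.
by rewrite !mxE /mass mulr_suml; apply: eq_bigr => i _; rewrite mxE.
Qed.

Lemma mass_mul_bordered D w : (forall i, \sum_j D i j = 1) ->
  mass (w *m bordered D) = mass w.
Proof.
by move=> D1; rewrite mul_bordered massD massB massZ mass_mulmx// mass_e subrr add0r mulr1.
Qed.

Lemma solved_vec_stationary D : (forall i, \sum_j D i j = 1) ->
  bordered D \in unitmx -> solved_vec D *m D = solved_vec D /\ mass (solved_vec D) = 1.
Proof.
move=> D1 uD; have E : solved_vec D *m bordered D = const_mx B%:R^-1 by rewrite mulmxKV.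
have m1 : mass (solved_vec D) = 1 by rewrite -(mass_mul_bordered _ D1) E.
split=> //; move: E; rewrite mul_bordered m1 scale1r => /(canRL (addrK _))/eqP.
by rewrite subrr subr_eq0 eq_sym => /eqP.
Qed.

Lemma stationary_solved_vec D : stochastic D -> bordered D \in unitmx ->
  stationary_vec D = solved_vec D.
Proof.
move=> sD uD; have [[_ m1] wD] := stationary_vecP B0 sD.
have : stationary_vec D *m bordered D = const_mx B%:R^-1.
  by rewrite mul_bordered wD subrr add0r [mass _]m1 scale1r.
by rewrite /solved_vec => <-; rewrite mulmxK.
Qed.

(** A left kernel vector has mass 0, because [bordered D] preserves mass, and so it is fixed by [D].
    By simplicity the stationary vector, of mass 1, would be a multiple of it. *)
Lemma bordered_unit D : stochastic D -> simple_eigenvalue D 1 -> bordered D \in unitmx.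
Proof.
move=> sD simple1; rewrite unitmxE unitfE; apply/negP => /det0P[v v0 vD].
have m0 : mass v = 0 by rewrite -(mass_mul_bordered _ sD.2) vD /mass big1// => i _; rewrite mxE.
have vD1 : v *m D = 1 *: v.
  move: vD; rewrite mul_bordered m0 scale0r addr0 scale1r => /eqP.
  by rewrite subr_eq0 eq_sym => /eqP.
have [[_ s1] sDs] := stationary_vecP B0 sD.
have [|a sa] := simple_left_eigenvector (w := stationary_vec D) simple1 v0 vD1.
  by rewrite scale1r.
by move: s1; rewrite -/(mass _) sa massZ m0 mulr0 => /esym/eqP; rewrite oner_eq0.
Qed.

Lemma germ_solved_vec p q (Dx : 'M[R]_(p, q) -> 'M[R]_B) D j :
  (forall i j, germ (fun x => Dx x i j) (D i j)) -> bordered D \in unitmx ->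
  germ (fun x => solved_vec (Dx x) 0 j) (solved_vec D 0 j).
Proof.
move=> HD uD; have dD : \det (bordered D) != 0 by rewrite -unitfE -unitmxE.
have Hb i k : germ (fun x => bordered (Dx x) i k) (bordered D i k).
  rewrite !mxE; apply: (@germ_ext _ _ _ (fun x => (i == k)%:R - Dx x i k + B%:R^-1)).
    by move=> x; rewrite !mxE.
  by apply: germD (germ_cst _ _ _); apply: germB => //; exact: germ_cst.
have E D' : \det (bordered D') != 0 ->
    solved_vec D' 0 j = \sum_i B%:R^-1 * ((\det (bordered D'))^-1 * (\adj (bordered D')) i j).
  move=> dD'; rewrite mxE; apply: eq_bigr => i _.
  by rewrite /invmx unitmxE unitfE dD' [in LHS]mxE [X in _ * X]mxE.
rewrite E//.
have H : germ (fun x => \sum_i B%:R^-1 * ((\det (bordered (Dx x)))^-1 * (\adj (bordered (Dx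
  x))) i j))
   (\sum_i B%:R^-1 * ((\det (bordered D))^-1 * (\adj (bordered D)) i j)).
  apply: germ_sum => i; apply: germZ; apply: germM; last exact: germ_adj.
  by apply: germ_inv => //; exact: germ_det.
(* The adjugate formula represents [solved_vec] only where the determinant is nonzero, since [invmx]
   takes a default value elsewhere; the cube is shrunk accordingly. *)
move=> e e0; have dD2 : 0 < `|\det (bordered D)| / 2 by rewrite divr_gt0// normr_gt0.
apply: filterS2 (H e e0) (germ_norm_le (germ_det Hb) dD2) => d He Hd.
apply: majorized_ext He => x xd; rewrite E//.
apply: contraTneq (Hd x xd) => ->; rewrite sub0r normrN -ltNge.
by move: dD2; set y := `|\det _|; lra.
Qed.

End StationaryVector.

Section Parametrization.
Variables (R : realType) (B : nat) (k : 'I_B -> 'I_B) (D : 'M[R]_B).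
Implicit Types (x : 'M[R]_(B, B.-1)).

(** The dependent entry of each row compensates the free ones, so row sums are preserved for every
    [x], whereas entries may become negative. *)
Definition param_mx x : 'M[R]_B := \matrix_(i, j)
  (D i j + if unlift (k i) j is Some l then x i l else - \sum_l x i l).

Lemma param_mx_row_sum x i : \sum_j param_mx x i j = \sum_j D i j.
Proof.
under eq_bigr do rewrite mxE.
rewrite big_split/= [X in _ + X](@bigD1_ord _ _ _ _ (k i))//= unlift_none.
rewrite [X in _ + (_ + X)](eq_bigr (fun l => x i l)) => [|l _]; last by rewrite liftK.
by rewrite addNr addr0.
Qed.

Lemma param_mx_free_entries D' : stochastic D -> stochastic D' ->
  param_mx (free_entries k D' - free_entries k D) = D'.
Proof.
move=> [_ D1] [_ D1']; apply/matrixP => i j; rewrite mxE.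
have [l jl|->] := unliftP (k i) j; first by rewrite !mxE jl subrKC.
under eq_bigr do rewrite !mxE.
have := D1' i; have := D1 i; rewrite !(@bigD1_ord _ _ _ _ (k i))//= sumrB.
set y := \sum_(l < B.-1) _; set z := \sum_(l < B.-1) _; lra.
Qed.

Lemma majorized_param_mx (d : R) i j : 0 < d ->
  majorized d (fun x => param_mx x i j - D i j) (B%:R * d).
Proof.
move=> d0; have B1 : (0 < B)%N := leq_ltn_trans (leq0n i) (ltn_ord i).
case E : (unlift (k i) j) => [l|].
  apply: (@majorized_le _ _ _ _ _ d); first by rewrite ler_peMl// ?ler1n// ltW.
  apply: majorized_ext (majorized_coord d0 i l) => x _.
  by rewrite mxE E addrAC subrr add0r.
have := majorizedN d0 (majorized_sum d0 (index_enum 'I_B.-1) (P := xpredT)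
  (fun l _ => majorized_coord d0 i l)).
rewrite sumr_const card_ord -[_ *+ _]mulr_natl => /majorized_le H.
apply: majorized_ext (H _ _) => [x _|]; first by rewrite mxE E addrAC subrr add0r.
by apply: ler_wpM2r; [exact: ltW|rewrite ler_nat leq_pred].
Qed.

Lemma germ_param_mx i j : germ (fun x => param_mx x i j) (D i j).
Proof.
move=> e e0; have B1 : (0 < B)%N := leq_ltn_trans (leq0n i) (ltn_ord i).
have e10 : 0 < e / B%:R by rewrite divr_gt0// ltr0n.
apply: filterS2 (nbhs_right_gt 0) (nbhs_right_le e10) => d d0 de.
apply: majorized_le (majorized_param_mx _ _ d0).
by rewrite mulrC -ler_pdivlMr// ltr0n.
Qed.

End Parametrization.

Section GermWords.
Variables (R : realType) (A B : nat) (Phi : 'I_B -> 'I_A) (D : 'M[R]_B).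
Variables (p q : nat) (Dx : 'M[R]_(p, q) -> 'M[R]_B).
Hypothesis germ_Dx : forall i j, germ (fun x => Dx x i j) (D i j).
Implicit Types (F : 'M[R]_(p, q) -> 'rV[R]_B) (w : 'rV[R]_B).

Local Notation wordm := (@wordm R A B Phi).

Lemma germ_wordm u F w : (forall j, germ (fun x => F x 0 j) (w 0 j)) ->
  forall j, germ (fun x => wordm (Dx x) u (F x) 0 j) (wordm D u w 0 j).
Proof.
elim: u F w => //= a u IH F w Fw; apply: IH => j.
rewrite mul_symbol_mx; apply: germ_ext => [x|]; first by rewrite mul_symbol_mx.
case: ifP => _; last exact: germ_cst.
rewrite mxE; apply: germ_ext => [x|]; first by rewrite mxE.
by apply: germ_sum => i; exact: germM.
Qed.

Lemma germ_mass F w : (forall j, germ (fun x => F x 0 j) (w 0 j)) ->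
  germ (fun x => mass (F x)) (mass w).
Proof. by move=> Fw; apply: germ_sum. Qed.

Lemma germ_nword u F w : (forall j, germ (fun x => F x 0 j) (w 0 j)) ->
  mass (wordm D u w) != 0 ->
  forall j, germ (fun x => nword Phi (Dx x) u (F x) 0 j) (nword Phi D u w 0 j).
Proof.
move=> Fw m0 j; rewrite mxE; apply: germ_ext => [x|]; first by rewrite mxE.
apply: germM; last exact: germ_wordm.
by apply: germ_inv => //; apply: germ_mass; exact: germ_wordm.
Qed.

Lemma rows_close_near (e : R) n : 0 < e -> \forall d \near (0 : R)^'+,
  forall v : n.-tuple 'I_A, rows_close Phi D Dx d e v.
Proof.
move=> e0; apply: filter_forall => v; apply: filter_forall => i; apply: filter_forall => j.
apply: germ_wordm => // l.
exact: germ_cst.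
Qed.

End GermWords.

(** * Perturbed orbits and the entropy rate *)

Section Orbit.
Variables (R : realType) (A B : nat) (Phi : 'I_B -> 'I_A) (D : 'M[R]_B).
Hypothesis sD : stochastic D.
Hypothesis B0 : (0 < B)%N.
Hypothesis r_gt0 : forall (a : 'I_A) w, limit_set Phi D w -> 0 < r_ Phi D a w.
Variables (p q : nat) (Dx : 'M[R]_(p, q) -> 'M[R]_B) (sx : 'M[R]_(p, q) -> 'rV[R]_B) (d : R).
Hypothesis d0 : 0 < d.
Implicit Types (w : 'rV[R]_B) (a b : 'I_A) (u v z : seq 'I_A) (x : 'M[R]_(p, q)).

Local Notation majorized := (@majorized R p q d).
Local Notation wordm := (@wordm R A B Phi).
Local Notation nword := (@nword R A B Phi).
Local Notation dword := (@dword R A B Phi).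
Local Notation delta i := (delta_mx 0 i : 'rV[R]_B).
Local Notation near_point := (@near_point R B p q d).
Local Notation rows_close := (@rows_close R A B Phi D p q Dx d).
Local Notation L := (limit_set Phi D).
Local Notation eta := ((4 * B%:R)^-1 : R).

Variables (c : R) (N : nat) (e1 e : R) (N1 : nat).
Hypothesis c01 : 0 < c <= 1.
Hypothesis c_le : forall a w, L w -> c <= mass (w *m symbol_mx Phi D a).
Hypothesis N0 : (0 < N)%N.
Hypothesis contr : forall u, size u = N -> forall b w, (L `&` face Phi b) w ->
  forall i i', Phi i = b -> Phi i' = b ->
  forall j, `|dword D u w (delta i - delta i') 0 j| <= eta.
Let m := c ^+ N.
Hypothesis e10 : 0 <= e1.
Hypothesis e01 : 0 < e <= 1.
Hypothesis spread1 : B%:R * spread B e1 e <= m / 4.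
Hypothesis spread2 : 2 * (1 + B%:R) * spread B e1 e <= m.
Hypothesis spread3 : spread B e1 e * contraction_cst B m <= eta * m / 4.
Hypothesis spread4 : 2 * (1 + B%:R) * spread B e1 0 / m <= e / 2.
Hypothesis close_N : forall v, size v = N -> rows_close e1 v.

Local Notation orbit z := (fun x => nword (Dx x) z (sx x)).

(** The shadowing invariant: over the whole cube the orbit is within [e], in norm, of one fixed
    point of [L] in the face of the last letter. *)
Definition good z b := [/\ exists z', z = rcons z' b,
  exists2 w, (L `&` face Phi b) w & near_point e (orbit z) w &
  forall x, cube d x -> mass (wordm (Dx x) z (sx x)) != 0].

Hypothesis good_base : forall z, (N1 <= size z < N1 + N)%N -> exists b, good z b.

Let c0 : 0 < c. Proof. by case/andP: c01. Qed.
Let m0 : 0 < m. Proof. exact: exprn_gt0. Qed.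
Let m1 : m <= 1. Proof. by have /andP[_ c1] := c01; apply: exprn_ile1 => //; exact: ltW. Qed.
Let m01 : 0 < m <= 1. Proof. by rewrite m0 m1. Qed.
Let Bp : 0 < B%:R :> R. Proof. by rewrite ltr0n. Qed.
Let eta0 : 0 < eta. Proof. by rewrite invr_gt0 mulr_gt0. Qed.

Let mass_ge v w : size v = N -> L w -> m <= mass (wordm D v w).
Proof. by move=> vN Lw; rewrite /m -vN; exact: (limit_set_mass_ge sD B0 r_gt0 (ltW c0)
  c_le). Qed.

(** The reason for the value of [eta]: the left side is the bound of [majorized_contraction], so a
    block halves differences. *)
Let half K : B%:R * (K * (2 * eta)) = K / 2.
Proof. by field; rewrite gt_eqF. Qed.

Lemma face_inhabited b w : simplex w -> face Phi b w -> exists i, Phi i = b.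
Proof.
move=> [_ w1] [_ wb]; apply: contrapT => H; move: w1.
rewrite big1 => [/esym/eqP|i _]; first by rewrite oner_eq0.
by apply: wb; apply/eqP => ib; apply: H; exists i.
Qed.

Lemma good_mass z b x : good z b -> cube d x -> mass (nword (Dx x) z (sx x)) = 1.
Proof. by move=> [_ _ zx] xd; rewrite mass_nword// zx. Qed.

Lemma good_off z b x i : good z b -> Phi i != b -> nword (Dx x) z (sx x) 0 i = 0.
Proof. by move=> [[z' ->] _ _] ib; rewrite nword_face. Qed.

(** Two errors of [e / 2]: the perturbed map contracts the distance from the orbit to [w], and at
    the fixed point [w] it differs from the unperturbed map by at most [e / 2] ([spread4]). *)
Lemma good_step z b v a : good z b -> size (rcons v a) = N -> good (z ++ rcons v a) a.
Proof.
move=> gz vN; have [_ [w Lw zw] zx] := gz.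
have sw : simplex w := limit_set_simplex sD B0 Lw.1.
have wm := mass_ge vN Lw.1.
have lt : B%:R * spread B e1 e < mass (wordm D (rcons v a) w).
  by have := m0; have := spread1; lra.
split; first by exists (z ++ v); rewrite rcons_cat.
- exists (nword D (rcons v a) w); first exact: (nword_limit_face sD B0 r_gt0 v a Lw.1).
  move=> j.
  have near0 : near_point 0 (fun=> w) w.
    by move=> i; apply: majorized_ext (majorized0 p q d0 (lexx 0)) => x _; rewrite subrr.
  have e0 : 0 <= e by have /andP[/ltW] := e01.
  have neare : near_point e (fun=> w) w.
    by move=> i; exact: majorized_le (near0 i).
  have s00 : spread B e1 0 <= spread B e1 e.
    rewrite /spread ler_pM2l// mul0r addr0 lerDl mulr_ge0 ?addr_ge0//.
  have H1 : majorized (fun x => nword (Dx x) (rcons v a) (nword (Dx x) z (sx x)) 0 j -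
      nword (Dx x) (rcons v a) w 0 j) (B%:R * (e * (2 * eta))).
    apply: (@majorized_contraction _ _ _ _ _ sD B0 _ _ _ _ d0 e1 e m eta e _ b
      (orbit z) (fun=> w) w w) => //.
    - exact: close_N.
    - by move=> i i' ib ib' k; split; exact: (contr vN Lw ib ib').
    - by move=> x xd; rewrite (good_mass gz xd); case: sw.
    - by move=> x i xd ib; rewrite (good_off _ gz ib); split=> //; have [_ H] := Lw.2; exact: H.
    - exact: face_inhabited sw Lw.2.
  have H2 : majorized (fun x => nword (Dx x) (rcons v a) w 0 j - nword D (rcons v a) w 0 j)
      (2 * (1 + B%:R) * spread B e1 0 / m).
    apply: (majorized_nword_near sD d0 (F := fun=> w) (close_N vN) sw near0).
      by rewrite m0.
    by apply: le_trans spread1; rewrite (ler_pM2l Bp).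
  have := majorizedD H1 (majorized_le spread4 H2); rewrite half -splitr.
  apply: majorized_ext => x xd; rewrite nword_cat ?zx//; ring.
- move=> x xd; have mz := zx x xd.
  have := near_point_mass_gt0 sD d0 (close_N vN) sw zw lt xd.
  rewrite mass_nword_cat//; apply: contraTN => /eqP ->.
  by rewrite mul0r ltxx.
Qed.

Lemma split_word z : (N1 + N <= size z)%N ->
  exists z' v a, [/\ z = z' ++ rcons v a, size (rcons v a) = N & (N1 <= size z')%N].
Proof.
move=> zN; have NN : (N <= size z)%N by apply: leq_trans zN; rewrite leq_addl.
have sd : size (drop (size z - N) z) = N by rewrite size_drop subKn.
have E := cat_take_drop (size z - N) z.
move: sd E; case/lastP: (drop _ z) => [/esym N00|v a sv E].
  by move: N0; rewrite N00.
exists (take (size z - N) z), v, a; split => //.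
by rewrite size_takel ?leq_subr// -(leq_add2r N) subnK.
Qed.

(** Final blocks of [N] letters are removed until the length falls into the window of [N]
    consecutive lengths covered by [good_base]. *)
Lemma good_all z : (N1 <= size z)%N -> exists b, good z b.
Proof.
have [n] := ubnP (size z); elim: n z => // n IH z zn zN1.
have [zN|zN] := ltnP (size z) (N1 + N); first by apply: good_base; rewrite zN1.
have [z' [v [a [zE vN z'N]]]] := split_word zN.
have [|b gb] := IH z' _ z'N; last by exists a; rewrite zE; exact: good_step gb vN.
move: zn; rewrite zE size_cat vN ltnS; apply: leq_trans.
by rewrite -[X in (X < _)%N]addn0 ltn_add2l.
Qed.

Variable lam : R.
Hypothesis lam01 : 0 < lam < 1.
Hypothesis lamN : 2^-1 <= lam ^+ N.
(** For words shorter than [N1 + N] two orbits differ by at most 3: twice [e <= 1], and 1 between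
    coordinates of two points of the simplex. *)
Definition orbit_cst : R := 3 / lam ^+ (N1 + N).

(** The orbits of [a0 :: z] and [z] read the same final blocks; each block halves their difference,
    which [lam ^+ N >= 1 / 2] turns into a power of [lam]. *)
Lemma orbit_cauchy z a0 j : (N1 <= size z)%N ->
  majorized (fun x => nword (Dx x) (a0 :: z) (sx x) 0 j - nword (Dx x) z (sx x) 0 j)
    (orbit_cst * lam ^+ size z).
Proof.
have /andP[l0 l1] := lam01.
have [n] := ubnP (size z); elim: n z j => // n IH z j zn zN1.
have [zN|zN] := ltnP (size z) (N1 + N).
  have [b [_ [w Lw zw] _]] := good_all zN1.
  have [|b' [_ [w' Lw' zw'] _]] := @good_all (a0 :: z); first exact: leqW.
  have := majorizedD (majorizedB d0 (zw' j) (zw j)) (majorized_cst p q d0 (w' 0 j - w 0 j)).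
  move=> /majorized_le H; apply: majorized_ext (H _ _) => [x _|]; first by ring.
  have /andP[w0 w1] := simplex_le1 j (limit_set_simplex sD B0 Lw.1).
  have /andP[w0' w1'] := simplex_le1 j (limit_set_simplex sD B0 Lw'.1).
  apply: (@le_trans _ _ 3).
    have := e01 => /andP[_ ee].
    have : `|w' 0 j - w 0 j| <= 1 by rewrite ler_norml; apply/andP; split; lra.
    lra.
  rewrite /orbit_cst mulrAC ler_pdivlMr ?exprn_gt0// ler_pM2l//.
  by apply: ler_wiXn2l; rewrite ?ltW// ltnW.
have [z' [v [a [zE vN z'N]]]] := split_word zN.
have z'n : (size z' < n)%N.
  move: zn; rewrite zE size_cat vN ltnS; apply: leq_trans.
  by rewrite -[X in (X < _)%N]addn0 ltn_add2l.
have [b gz] := good_all z'N.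
have [|b' gz'] := @good_all (a0 :: z'); first exact: leqW.
(* The two shortened words end in the same letter, so both reference points lie in one face and
   contraction between them applies. *)
have bb' : b' = b.
  have [[z1 z1E] _ _] := gz; have [[z2 z2E] _ _] := gz'.
  move: z2E; rewrite z1E -rcons_cons => /eqP.
  by rewrite eqseq_rcons => /andP[_ /eqP].
rewrite bb' in gz'; have IH' i := IH z' i z'n z'N.
have [_ [w Lw zw] zx] := gz; have [_ [w' Lw' zw'] zx'] := gz'.
have sw : simplex w := limit_set_simplex sD B0 Lw.1.
have sw' : simplex w' := limit_set_simplex sD B0 Lw'.1.
have H : majorized (fun x => nword (Dx x) (rcons v a) (nword (Dx x) (a0 :: z') (sx x)) 0 j -
      nword (Dx x) (rcons v a) (nword (Dx x) z' (sx x)) 0 j)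
      (B%:R * (orbit_cst * lam ^+ size z' * (2 * eta))).
  apply: (@majorized_contraction _ _ _ _ _ sD B0 _ _ _ _ d0 e1 e m eta _ _ b
      (orbit (a0 :: z')) (orbit z') w' w) => //.
  - exact: close_N.
  - exact: mass_ge vN Lw'.1.
  - exact: mass_ge vN Lw.1.
  - by move=> i i' ib ib' k; split; [exact: (contr vN Lw' ib ib')|exact: (contr vN Lw ib ib')].
  - by move=> x xd; rewrite (good_mass gz xd) (good_mass gz' xd).
  - by move=> x i xd ib; rewrite (good_off _ gz ib) (good_off _ gz' ib).
  - exact: face_inhabited sw Lw.2.
rewrite half in H; apply: majorized_le (majorized_ext _ H); last first.
  by move=> x xd; rewrite zE -cat_cons !nword_cat ?zx ?zx'.
rewrite zE size_cat vN exprD mulrA ler_wpM2l//.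
by apply: mulr_ge0; [rewrite divr_ge0// exprn_ge0// ltW|rewrite exprn_ge0// ltW].
Qed.

Hypothesis close_1 : forall a, rows_close e1 [:: a].
Hypothesis sxD : forall x, cube d x -> sx x *m Dx x = sx x.

Definition prob z x : R := mass (wordm (Dx x) z (sx x)).

Definition cprob z a x : R := mass (wordm (Dx x) [:: a] (nword (Dx x) z (sx x))).

(** The expression of [cond_entropyE], extended to parameters [x] for which [Dx x] is not
    stochastic. *)
Definition pentropy n x : R := - \sum_(z : n.-tuple 'I_A) \sum_a
  prob (rcons z a) x * ln (prob (rcons z a) x / prob z x).

Lemma cprobE z a x : (N1 <= size z)%N -> cube d x ->
  prob (rcons z a) x / prob z x = cprob z a x.
Proof.
by move=> /good_all[b [_ _ zx]] xd; rewrite /cprob mass_nword_cat ?zx// cats1.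
Qed.

Let mc : m <= c.
Proof.
have /andP[_ c1] := c01; rewrite /m -(prednK N0) exprS.
by apply: ler_piMr; [exact: ltW|apply: exprn_ile1 => //; exact: ltW].
Qed.

Lemma cprob_near z a : (N1 <= size z)%N ->
  exists2 r, c <= r & majorized (fun x => cprob z a x - r) (m / 4).
Proof.
move=> /good_all[b [_ [w Lw zw] _]]; have sw : simplex w := limit_set_simplex sD B0 Lw.1.
exists (mass (wordm D [:: a] w)); first by apply: c_le; exact: Lw.1.
apply: (majorized_le spread1); apply: majorized_mass_near => //.
exact: (majorized_wordm_near sD d0 (@close_1 a) sw zw).
Qed.

Lemma cprob_gt0 z a x : (N1 <= size z)%N -> cube d x -> 0 < cprob z a x.
Proof.
move=> /(cprob_near a)[r cr H] xd; have := majorized_norm H xd.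
by rewrite ler_norml => /andP[+ _]; have := mc; have := m0; lra.
Qed.

Lemma majorized_cprob_inv z a : (N1 <= size z)%N ->
  majorized (fun x => (cprob z a x)^-1) (2 / c).
Proof.
move=> /(cprob_near a)[r cr H]; have m4 : m / 4 <= c / 4 by rewrite ler_pM2r.
have [cp mp] := (c0, m0); have r2 : c / 2 <= r - m / 4 by lra.
have c2 : 0 < c / 2 by lra.
apply: majorized_le (majorized_inv d0 _ H); last by lra.
by rewrite -[leRHS]invrK invf_div lef_pV2 ?posrE// (lt_le_trans c2).
Qed.

(** The factor [B] twice counts matrix entries, each of norm at most [1 + e1]; [2 / c] bounds the
    inverse of a conditional probability. *)
Definition cprob_cst : R := B%:R * (B%:R * (orbit_cst * (1 + e1))) * (2 / c).

Lemma majorized_cprob_ratio z a b : (N1 <= size z)%N ->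
  majorized (fun x => (cprob (b :: z) a x - cprob z a x) * (cprob z a x)^-1)
    (cprob_cst * lam ^+ size z).
Proof.
move=> zN.
have H : majorized (fun x => \sum_(j < B) \sum_(i < B)
    (nword (Dx x) (b :: z) (sx x) 0 i - nword (Dx x) z (sx x) 0 i) *
    wordm (Dx x) [:: a] (delta i) 0 j)
    (\sum_(j < B) \sum_(i < B) orbit_cst * lam ^+ size z * (1 + e1)).
  apply: majorized_sum => // j _; apply: majorized_sum => // i _.
  apply: majorizedM => //; first exact: orbit_cauchy.
  have /andP[W0 W1] := wordm_delta_le1 Phi sD [:: a] i j.
  have := majorizedD (majorized_cst p q d0 (wordm D [:: a] (delta i) 0 j)) (@close_1 a i j).
  move=> /majorized_le H; apply: majorized_ext (H _ _) => [x _|]; first by rewrite subrKC.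
  by rewrite ger0_norm// lerD2r.
have := majorizedM d0 H (majorized_cprob_inv a zN).
rewrite !sumr_const card_ord -!mulrnA -[_ *+ (B * B)]mulr_natl natrM.
move=> /majorized_le {}H; apply: majorized_ext (H _ _) => [x _|]; last first.
  by rewrite le_eqVlt; apply/orP; left; apply/eqP; rewrite /cprob_cst; ring.
congr (_ * _); rewrite /cprob -massB -wordmB; apply: eq_bigr => j _.
rewrite [RHS]wordm_coord; apply: eq_bigr => i _; congr (_ * _).
by rewrite [RHS]mxE; congr (_ + _); rewrite [RHS]mxE.
Qed.

(** The difference is taken as one logarithm [ln (1 + F)] with [F] the relative error, which
    preserves the geometric factor. *)
Lemma majorized_ln_cprob_cauchy z a b : (N1 <= size z)%N ->
  cprob_cst * lam ^+ size z <= 2^-1 ->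
  majorized (fun x => ln (cprob (b :: z) a x) - ln (cprob z a x))
    (2 * (cprob_cst * lam ^+ size z)).
Proof.
move=> zN small; apply: majorized_ext (majorized_ln1p d0 small (majorized_cprob_ratio a b zN)).
move=> x xd; have r0 := cprob_gt0 a zN xd.
have r0' : 0 < cprob (b :: z) a x by apply: cprob_gt0 => //; exact: leqW.
rewrite -ln_div ?posrE//; congr ln; field.
by rewrite gt_eqF.
Qed.

Lemma pentropyE n x : (N1 <= n)%N -> cube d x ->
  pentropy n x = - \sum_(z : n.-tuple 'I_A) \sum_a prob (rcons z a) x * ln (cprob z a x).
Proof.
move=> nN xd; congr (- _); apply: eq_bigr => z _; apply: eq_bigr => a _.
by rewrite cprobE// size_tuple.
Qed.

(** By [sxD] the weight of [rcons z a] splits over a letter [b] in front. Both entropies then carry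
    the same weights and only differences of logarithms remain. *)
Lemma pentropyB n x : (N1 <= n)%N -> cube d x -> pentropy n.+1 x - pentropy n x =
  - \sum_(z : n.-tuple 'I_A) \sum_b \sum_a
     prob (b :: rcons z a) x * (ln (cprob (b :: z) a x) - ln (cprob z a x)).
Proof.
move=> nN xd; rewrite (pentropyE (leqW nN) xd) (pentropyE nN xd) opprK addrC -opprB.
congr (- _).
rewrite (sum_words_cons _ (fun z => \sum_a prob (rcons z a) x * ln (cprob z a x))).
rewrite exchange_big/= -sumrB; apply: eq_bigr => z _.
have E a : prob (rcons z a) x = \sum_b prob (b :: rcons z a) x.
  by rewrite /prob sum_mass_wordm_cons sxD.
under [X in _ - X]eq_bigr do rewrite E mulr_suml.
rewrite [X in _ - X]exchange_big/= -sumrB; apply: eq_bigr => b _.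
by rewrite -sumrB; apply: eq_bigr => a _; rewrite mulrBr.
Qed.

Variables (t : R) (Ks : 'rV[R]_B).
Hypothesis t0 : 0 <= t.
Hypothesis Ds_le : forall i j, majorized (fun x => Dx x i j) (D i j + t).
Hypothesis sx_le : forall j, majorized (fun x => sx x 0 j) (Ks 0 j).
(** An entrywise bound for the norms of [Dx]. Its rows sum to [g], so total norms over words of
    length [n] grow like [g ^ n]. *)
Let E : 'M[R]_B := D + const_mx t.
Let g := 1 + B%:R * t.

Lemma majorized_prob z : majorized (prob z) (mass (wordm E z Ks)).
Proof.
suff H (F : 'M[R]_(p, q) -> 'rV[R]_B) (K : 'rV[R]_B) : (forall j, majorized (fun x => F x 0
  j) (K 0 j)) ->
    forall j, majorized (fun x => wordm (Dx x) z (F x) 0 j) (wordm E z K 0 j).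
  by apply: majorized_sum => // j _; exact: H.
elim: z F K => //= a z IH F K FK; apply: IH => j.
rewrite mul_symbol_mx; apply: majorized_ext => [x _|]; first by rewrite mul_symbol_mx.
case: ifP => _; last exact: majorized0.
rewrite mxE; apply: majorized_ext => [x _|]; first by rewrite mxE.
apply: majorized_sum => // i _; apply: majorizedM => //.
by rewrite !mxE.
Qed.

Lemma mass_iter_mulmx n w : mass (iter n (mulmx^~ E) w) = g ^+ n * mass w.
Proof.
elim: n => [|n IH]; first by rewrite expr0 mul1r.
rewrite iterS exprS -mulrA -IH; set v := iter n _ w.
rewrite /mass mulr_sumr; under eq_bigr do rewrite mxE.
rewrite exchange_big/=; apply: eq_bigr => i _; rewrite -mulr_sumr mulrC.
congr (_ * _); under eq_bigr do rewrite !mxE.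
by rewrite big_split/= sD.2 sumr_const card_ord -[_ *+ _]mulr_natl.
Qed.

Lemma majorized_pentropyB n : (N1 <= n)%N -> cprob_cst * lam ^+ n <= 2^-1 ->
  majorized (fun x => pentropy n.+1 x - pentropy n x)
    (2 * cprob_cst * g ^+ 2 * mass Ks * (g * lam) ^+ n).
Proof.
move=> nN small.
have H : majorized (fun x => - \sum_(z : n.-tuple 'I_A) \sum_b \sum_a
     prob (b :: rcons z a) x * (ln (cprob (b :: z) a x) - ln (cprob z a x)))
     (\sum_(z : n.-tuple 'I_A) \sum_b \sum_a
       mass (wordm E (b :: rcons z a) Ks) * (2 * (cprob_cst * lam ^+ n))).
  apply: majorizedN => //; apply: majorized_sum => // z _.
  apply: majorized_sum => // b _; apply: majorized_sum => // a _.
  apply: majorizedM => //; first exact: majorized_prob.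
  have := @majorized_ln_cprob_cauchy z a b; rewrite size_tuple; exact.
apply: majorized_ext (majorized_le _ H) => [x xd|]; first by rewrite pentropyB.
rewrite le_eqVlt; apply/orP; left; apply/eqP.
(* The words [b :: rcons z a] run over all words of length [n + 2], whose matrix products add up to
   the power of [E] with that exponent. *)
have S : \sum_(z : n.-tuple 'I_A) \sum_b \sum_a mass (wordm E (b :: rcons z a) Ks) =
    g ^+ n.+2 * mass Ks.
  rewrite -mass_iter_mulmx -(sum_wordm Phi).
  rewrite (sum_words_cons _ (fun z => wordm E z Ks)).
  rewrite /mass; under [RHS]eq_bigr do rewrite summxE.
  rewrite [RHS]exchange_big [LHS]exchange_big/=; apply: eq_bigr => b _.
  rewrite (exchange_big_dep xpredT)//=; under [RHS]eq_bigr do rewrite summxE.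
  rewrite [RHS]exchange_big/=.
  by rewrite (sum_words_rcons _ (fun z => \sum_j wordm E (b :: z) Ks 0 j)) [LHS]exchange_big.
under eq_bigr do (under eq_bigr do rewrite -mulr_suml); under eq_bigr do rewrite -mulr_suml.
by rewrite -mulr_suml S exprMn !exprS; ring.
Qed.

Lemma majorized_sum_ex (I : Type) (r : seq I) (F : I -> _ -> R) :
  (forall i, exists K, majorized (F i) K) ->
  exists K, majorized (fun x => \sum_(i <- r) F i x) K.
Proof.
move=> /choice[K FK]; exists (\sum_(i <- r) K i).
by apply: majorized_sum => // i _; exact: FK.
Qed.

Lemma majorized_pentropy n : (N1 <= n)%N -> exists K, majorized (pentropy n) K.
Proof.
move=> nN.
have [K H] : exists K, majorized (fun x => \sum_(z : n.-tuple 'I_A) \sum_a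
    prob (rcons z a) x * ln (cprob z a x)) K.
  apply: majorized_sum_ex => z; apply: majorized_sum_ex => a.
  have [|r cr Hr] := @cprob_near z a; first by rewrite size_tuple.
  eexists; apply: majorizedM => //; first exact: majorized_prob.
  by apply: (majorized_ln d0 _ _ Hr); have := mc; have := c0; lra.
exists K; apply: majorized_ext (majorizedN d0 H) => x xd.
by rewrite pentropyE.
Qed.

Hypothesis glam : g * lam < 1.

Lemma majorized_entropy_limit : exists K (F : 'M[R]_(p, q) -> R), majorized F K /\
  forall x, cube d x -> pentropy n x @[n --> \oo] --> F x.
Proof.
have /andP[l0 l1] := lam01.
have Bt0 : 0 <= B%:R * t by rewrite mulr_ge0.
have gl0 : 0 <= g * lam by rewrite mulr_ge0 ?ltW// ltr_wpDr.
have gl01 : 0 <= g * lam < 1 by rewrite gl0.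
have Ks0 : 0 <= mass Ks by apply: mass_ge0 => j; exact: majorized_ge0 (sx_le j).
have C0 : 0 <= cprob_cst.
  have oc0 : 0 <= orbit_cst by rewrite divr_ge0// exprn_ge0// ltW.
  have c20 : 0 <= 2 / c by rewrite divr_ge0// ltW.
  have B00 : 0 <= B%:R :> R by [].
  by rewrite /cprob_cst; do !apply: mulr_ge0 => //; rewrite addr_ge0.
(* From [n] on, all orbits are shadowed and the relative errors are small enough for the logarithmic
   series; the telescoping sum starts there. *)
have [n [nN small]] : exists n, (N1 <= n)%N /\ forall k, (n <= k)%N -> cprob_cst * lam ^+ k
  <= 2^-1.
  have : cprob_cst * lam ^+ k @[k --> \oo] --> 0.
    rewrite -[X in _ --> X](mulr0 cprob_cst); apply: cvgM; first exact: cvg_cst.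
    have ll : `|lam| < 1 by rewrite gtr0_norm.
    have := @cvg_geometric R 1 lam ll; rewrite /geometric/=.
    by under eq_fun do rewrite mul1r.
  have h0 : 0 < 2^-1 :> R by [].
  move=> /cvgrPdist_le/(_ _ h0)[n0 _ n0P]; exists (maxn N1 n0); split; first exact: leq_maxl.
  move=> k kn; have := n0P k (leq_trans (leq_maxr _ _) kn).
  by rewrite /= sub0r normrN ger0_norm// mulr_ge0// exprn_ge0// ltW.
set C := 2 * cprob_cst * g ^+ 2 * mass Ks.
have g0 : 0 <= g by rewrite addr_ge0.
have CC0 : 0 <= C by rewrite /C; do !apply: mulr_ge0 => //; exact: exprn_ge0.
pose f k := pentropy (n + k)%N.
have fB k : majorized (fun x => f k.+1 x - f k x) (C * (g * lam) ^+ (n + k)).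
  rewrite /f addnS; apply: majorized_pentropyB.
    by apply: leq_trans nN _; rewrite leq_addr.
  by apply: small; rewrite leq_addr.
pose K k := C * (g * lam) ^+ (n + k).
have K0 k : 0 <= K k by apply: mulr_ge0 => //; exact: exprn_ge0.
have KL k : \sum_(0 <= i < k) K i <= C * (1 - g * lam)^-1.
  rewrite /K -mulr_sumr ler_wpM2l//; apply: le_trans (geometric_sum_le k gl01).
  apply: ler_sum => i _; rewrite ler_wiXn2l// ?leq_addl//; exact: ltW.
have cf x : cube d x -> cvgn (f^~ x).
  move=> xd.
  have E' : f^~ x = (fun k => series (fun k => f k.+1 x - f k x) k + f 0%N x).
    by apply/funext => k; rewrite /series/= telescope_sumr// subrK.
  rewrite E'; apply: is_cvgD; last exact: is_cvg_cst.
  apply: normed_cvg; apply: nondecreasing_is_cvgn.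
    by apply: nondecreasing_series => k _ _ /=.
  exists (C * (1 - g * lam)^-1) => _ [k _ <-]; apply: le_trans (KL k).
  by apply: ler_sum => i _ /=; exact: majorized_norm (fB i) xd.
have [K1 HK1] := majorized_pentropy nN.
exists (K1 + C * (1 - g * lam)^-1), (fun x => limn (f^~ x)); split.
  apply: (majorized_lim (f := f) _ fB KL); first by rewrite /f addn0.
  by move=> x xd; exact: cf.
move=> x xd; rewrite -(cvg_shiftn n (fun n => pentropy n x)).
have := cf x xd; rewrite /f; under eq_fun do rewrite addnC.
by [].
Qed.

End Orbit.

(** * Choice of the constants and conclusion *)

Lemma bernoulli_ge (R : realType) (x : R) n : 0 <= x <= 1 -> 1 - n%:R * x <= (1 - x) ^+ n.
Proof.
move=> /andP[x0 x1]; elim: n => [|n IH]; first by rewrite mul0r subr0.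
rewrite exprS; apply: (@le_trans _ _ ((1 - x) * (1 - n%:R * x))); last first.
  by apply: ler_wpM2l => //; rewrite subr_ge0.
rewrite -natr1; have : 0 <= n%:R * x * x by rewrite !mulr_ge0.
lra.
Qed.

Section Constants.
Variables (R : realType) (B : nat) (m eta : R).
Hypotheses (B0 : (0 < B)%N) (m0 : 0 < m) (eta0 : 0 < eta).

Lemma perturbation_constants : exists e1 e : R, [/\ 0 < e1, 0 < e <= 1,
  B%:R * spread B e1 e <= m / 4, 2 * (1 + B%:R) * spread B e1 e <= m &
  spread B e1 e * contraction_cst B m <= eta * m / 4 /\
  2 * (1 + B%:R) * spread B e1 0 / m <= e / 2].
Proof.
have b1 : 1 <= B%:R :> R by rewrite ler1n.
have K0 : 0 < contraction_cst B m.
  by rewrite /contraction_cst !addr_gt0 ?divr_gt0 ?mulr_gt0 ?addr_gt0 ?ltr0n.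
set b := B%:R in b1 *; set K := contraction_cst B m in K0 *.
have b0 : 0 < b by lra.
(* A common threshold: the three conditions on the spread all follow from [spread B e' e <= t]. *)
pose t := Num.min (m / 4 / b) (Num.min (m / (2 * (1 + b))) (eta * m / 4 / K)).
have bb : 0 < 2 * (1 + b) by lra.
have t0 : 0 < t by rewrite !lt_min !divr_gt0// mulr_gt0.
have t1 : b * t <= m / 4 by rewrite mulrC -ler_pdivlMr// ge_min lexx.
have t2 : 2 * (1 + b) * t <= m by rewrite mulrC -ler_pdivlMr// !ge_min lexx orbT.
have t3 : t * K <= eta * m / 4 by rewrite -ler_pdivlMr// !ge_min lexx !orbT.
pose e := Num.min 1 (t / (4 * b)).
have b4 : 0 < 4 * b by lra.
have e0 : 0 < e by rewrite lt_min ltr01 divr_gt0.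
have e1 : e <= 1 by rewrite ge_min lexx.
have e2 : e * (4 * b) <= t by rewrite -ler_pdivlMr// ge_min lexx orbT.
(* The matrix tolerance is chosen after [e], since the error of one perturbed block must be at most
   [e / 2]. The point error and the matrix error each use half of [t]. *)
pose e' := Num.min 1 (Num.min (t / (2 * b)) (e / 2 * m / (2 * (1 + b) * b))).
have b2 : 0 < 2 * b by lra.
have bbb : 0 < 2 * (1 + b) * b by rewrite mulr_gt0.
have e'0 : 0 < e' by rewrite !lt_min ltr01 !divr_gt0// mulr_gt0// divr_gt0.
have e'1 : e' <= 1 by rewrite ge_min lexx.
have e'2 : e' * (2 * b) <= t by rewrite -ler_pdivlMr// !ge_min lexx orbT.
have e'3 : e' * (2 * (1 + b) * b) <= e / 2 * m by rewrite -ler_pdivlMr// !ge_min lexx !orbT.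
have st : spread B e' e <= t.
  rewrite /spread -/b.
  have : e * (1 + e') <= e * 2 by rewrite ler_pM2l//; lra.
  rewrite -(ler_pM2l b0) => H.
  by rewrite mulrDr; lra.
exists e', e; split=> //.
- by rewrite e0.
- by apply: le_trans t1; rewrite ler_pM2l.
- by apply: le_trans t2; rewrite ler_pM2l.
- split; first by apply: le_trans t3; rewrite ler_pM2r.
  by rewrite ler_pdivrMr// /spread mul0r addr0 -/b mulrA mulrC.
Qed.

End Constants.

Section Analyticity.
Variables (R : realType) (B : nat).

Lemma cube_near p q (d : R) : 0 < d ->
  \forall x \near (0 : 'M[R]_(p, q)), cube d x.
Proof.
move=> d0; have := nbhsx_ballx (0 : 'M[R]_(p, q)) d d0; apply: filterS => x [_ xd] i j.
by have := xd i j; rewrite -ball_normE /= mxE sub0r normrN => /ltW.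
Qed.

Lemma analytic_at_majorized (F : 'M[R]_B -> R) (D0 : 'M[R]_B) :
  (forall k, exists2 d, 0 < d & exists K G, majorized d G K /\
     forall D, stochastic D -> cube d (free_entries k D - free_entries k D0) ->
       F D = G (free_entries k D - free_entries k D0)) ->
  analytic_at F D0.
Proof.
move=> H k; have [d d0 [K [G [GK FG]]]] := H k.
have [c cP] := majorized_power_series d0 GK.
exists c; split.
  by apply: filterS (cube_near _ _ d0) => x /cP[].
have := nbhsx_ballx D0 d d0; apply: filterS => D [_ Dd] sD.
have xd : cube d (free_entries k D - free_entries k D0).
  move=> i j; have := Dd i (lift (k i) j).
  by rewrite -ball_normE /= !mxE distrC => /ltW.
by rewrite FG// (cP _ xd).2.
Qed.

End Analyticity.

Section Main.
Variables (R : realType) (A B : nat) (Phi : 'I_B -> 'I_A) (D : 'M[R]_B).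
Hypothesis sD : stochastic D.
Hypothesis B0 : (0 < B)%N.
Hypothesis simple1 : simple_eigenvalue D 1.
Hypothesis r_gt0 : forall (a : 'I_A) w, limit_set Phi D w -> 0 < r_ Phi D a w.
Hypothesis contracting : forall b w, limit_set Phi D w -> face Phi b w ->
  eventually_contracting Phi D b w.
Implicit Types (z u v : seq 'I_A).

Local Notation L := (limit_set Phi D).
Local Notation s := (stationary_vec D).

Lemma entropy_rate_majorized k : exists2 d, 0 < d & exists K G, majorized d G K /\
  forall D', stochastic D' -> cube d (free_entries k D' - free_entries k D) ->
    entropy_rate Phi D' = G (free_entries k D' - free_entries k D).
Proof.
have [c c01 c_le] := limit_set_lower_bound sD B0 r_gt0.
have Bp : 0 < B%:R :> R by rewrite ltr0n.
have eta0 : 0 < (4 * B%:R)^-1 :> R by rewrite invr_gt0 mulr_gt0.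
have [N N0 NP] := uniform_contraction sD B0 r_gt0 c01 c_le contracting eta0.
have c0 : 0 < c by case/andP: c01.
have m0 : 0 < c ^+ N by rewrite exprn_gt0.
have [e1 [e [e10 e01 sp1 sp2 [sp3 sp4]]]] := perturbation_constants B0 m0 eta0.
have e0 : 0 < e by case/andP: e01.
have e20 : 0 < e / 2 by rewrite divr_gt0.
(* Half of [e] is for the distance from the unperturbed orbit to [L], half for its variation over
   the cube. *)
have [N1 N1P] := long_word_near_limit_set sD B0 r_gt0 e20.
(* Bernoulli's inequality then gives [lam ^+ N >= 1 - N / (2 N)], the factor gained by one block. *)
pose lam : R := 1 - (2 * N%:R)^-1.
have Np : 1 <= N%:R :> R by rewrite ler1n.
have N2 : 0 < 2 * N%:R :> R by rewrite mulr_gt0// ltr0n.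
have x0 : 0 < (2 * N%:R)^-1 :> R by rewrite invr_gt0.
have x1 : (2 * N%:R)^-1 <= 2^-1 :> R by rewrite lef_pV2 ?posrE//; lra.
have lam01 : 0 < lam < 1 by rewrite /lam; apply/andP; split; lra.
have lamN : 2^-1 <= lam ^+ N.
  apply: le_trans (bernoulli_ge N _); last by apply/andP; split; lra.
  by rewrite le_eqVlt; apply/orP; left; apply/eqP; field; rewrite pnatr_eq0 -lt0n.
have uD := bordered_unit B0 sD simple1.
pose Dx := param_mx k D; pose sx x := solved_vec (Dx x).
have gD i j : germ (fun x => Dx x i j) (D i j) by exact: germ_param_mx.
have gs j : germ (fun x => sx x 0 j) (s 0 j).
  by rewrite stationary_solved_vec//; exact: germ_solved_vec.
have word0 z : mass (wordm Phi D z s) != 0 by rewrite gt_eqF// word_gt0.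
have det0 : 0 < `|\det (bordered D)| / 2.
  by rewrite divr_gt0// normr_gt0 -unitfE -unitmxE.
have gb : germ (fun x => \det (bordered (Dx x))) (\det (bordered D)).
  apply: germ_det => i j; rewrite !mxE.
  apply: (@germ_ext _ _ _ (fun x => (i == j)%:R - Dx x i j + B%:R^-1)).
    by move=> x; rewrite !mxE.
  by apply: germD (germ_cst _ _ _); apply: germB => //; exact: germ_cst.
(* For [d] below this bound, [g * lam = lam + B ^ 2 d lam < 1], as entries of [Dx] vary by at most
   [B d] in norm. *)
have lam1 : 0 < (1 - lam) / (B%:R * B%:R).
  by rewrite divr_gt0 ?mulr_gt0//; move: lam01 => /andP[]; lra.
(* The conditions involve only finitely many words, so they hold together for small [d]. The window
   of lengths starts at [N1.+1] because [N1] counts the letters before the last one. *)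
have : \forall d \near (0 : R)^'+, [/\ 0 < d, d < (1 - lam) / (B%:R * B%:R),
    (forall v : N.-tuple 'I_A, rows_close Phi D Dx d e1 v) /\
    (forall v : 1.-tuple 'I_A, rows_close Phi D Dx d e1 v),
    (forall (i : 'I_N) (z : (N1.+1 + i).-tuple 'I_A),
      near_point d (e / 2) (fun x => nword Phi (Dx x) z (sx x)) (nword Phi D z s) /\
      forall x, cube d x -> mass (wordm Phi (Dx x) z (sx x)) != 0) &
    (forall x, cube d x -> bordered (Dx x) \in unitmx) /\
    near_point d 1 sx s].
  near=> d; split.
  - by near: d; exact: nbhs_right_gt.
  - by near: d; exact: nbhs_right_lt.
  - by split; near: d; exact: rows_close_near.
  - move=> i z; split; move: i z; near: d.
      do 3!apply: filter_forall => ?; exact: germ_nword.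
    apply: filter_forall => i; apply: filter_forall => z.
    have w2 : 0 < mass (wordm Phi D z s) / 2 by rewrite divr_gt0// word_gt0.
    have := germ_norm_le (germ_mass (germ_wordm Phi gD z gs)) w2.
    apply: filterS => d' H x xd.
    by have := H x xd; rewrite ler_norml => /andP[+ _] => H'; rewrite gt_eqF//; lra.
  - split; last by near: d; apply: filter_forall => j; exact: gs.
    near: d; have := germ_norm_le gb det0; apply: filterS => d' H x xd.
    rewrite unitmxE unitfE; apply: contraTneq (H x xd) => ->.
    by rewrite sub0r normrN -ltNge; move: det0; set y := `|\det _|; lra.
move=> /filter_ex[d [d0 dlam [closeN close1] base [unitD near_s]]].
exists d => //.
have closeN' v : size v = N -> rows_close Phi D Dx d e1 v.
  by move=> /eqP vN; exact: (closeN (Tuple vN)).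
have contr u : size u = N -> forall b w, (L `&` face Phi b) w ->
    forall i i', Phi i = b -> Phi i' = b ->
    forall j, `|dword Phi D u w (delta_mx 0 i - delta_mx 0 i') 0 j| <= (4 * B%:R)^-1.
  by move=> uN; apply: NP; rewrite uN.
have good_base z : (N1.+1 <= size z < N1.+1 + N)%N ->
    exists b, good Phi D Dx sx d e z b.
  move=> /andP[zN zN'].
  have iN : (size z - N1.+1 < N)%N by rewrite ltn_subLR.
  have zs : size z == (N1.+1 + Ordinal iN)%N by rewrite /= subnKC.
  have zw : near_point d (e / 2) (fun x => nword Phi (Dx x) z (sx x)) (nword Phi D z s).
    exact: (base (Ordinal iN) (Tuple zs)).1.
  have zx : forall x, cube d x -> mass (wordm Phi (Dx x) z (sx x)) != 0.
    exact: (base (Ordinal iN) (Tuple zs)).2.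
  move: zN {zN' iN zs} zw zx; case/lastP: z => // u a.
  rewrite size_rcons ltnS => uN zw zx; exists a; split => //; first by exists u.
  have [w Lw uw] := N1P u a uN; exists w => // j.
  have := majorizedD (zw j) (majorized_cst _ _ d0 (nword Phi D (rcons u a) s 0 j - w 0 j)).
  move=> /majorized_le H; apply: majorized_ext (H _ _) => [x _|]; first by ring.
  by rewrite [leRHS]splitr lerD2l.
have sxP x : cube d x -> sx x *m Dx x = sx x.
  move=> /unitD uDx; have [] // := solved_vec_stationary B0 _ uDx.
  by move=> i; rewrite param_mx_row_sum sD.2.
have Dle i j : majorized d (fun x => Dx x i j) (D i j + B%:R * d).
  have := majorizedD (majorized_cst _ _ d0 (D i j)) (majorized_param_mx k D i j d0).
  rewrite ger0_norm ?sD.1//; apply: majorized_ext => x _; exact: subrKC.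
have sle j : majorized d (fun x => sx x 0 j) ((\row_j (`|s 0 j| + 1) : 'rV[R]_B) 0 j).
  rewrite mxE; have := majorizedD (majorized_cst _ _ d0 (s 0 j)) (near_s j).
  by apply: majorized_ext => x _; exact: subrKC.
have t0 : 0 <= B%:R * d by rewrite mulr_ge0// ltW.
have glam : (1 + B%:R * (B%:R * d)) * lam < 1.
  move: dlam; rewrite ltr_pdivlMr ?mulr_gt0// => dlam.
  have B2d : 0 <= B%:R * (B%:R * d) by rewrite mulr_ge0.
  have : B%:R * (B%:R * d) * lam <= B%:R * (B%:R * d) * 1.
    by rewrite ler_wpM2l//; move: lam01 => /andP[_ /ltW].
  rewrite mulrDl mul1r mulr1; move: dlam; rewrite [d * _]mulrC -mulrA; lra.
have [K [G [GK Gcvg]]] := majorized_entropy_limit sD B0 r_gt0 d0 c01 c_le N0 contr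
  (ltW e10) e01 sp1 sp2 sp3 sp4 closeN' good_base lam01 lamN
  (fun a => close1 [tuple a]) sxP t0 Dle sle glam.
exists K, G; split=> // D' sD' xd.
apply: cvg_lim => //.
set x := free_entries k D' - _ in xd *.
have DE : Dx x = D' by exact: param_mx_free_entries.
have sE : stationary_vec D' = sx x.
  by rewrite /sx DE; apply: stationary_solved_vec => //; rewrite -DE; exact: unitD.
apply: cvg_trans (Gcvg x xd); apply: near_eq_cvg; apply: nearW => n.
by rewrite cond_entropyE// sE /pentropy /prob DE.
Unshelve. all: by end_near. Qed.

End Main.

Theorem theorem6p1 (R : realType) (A B : nat) (Phi : 'I_B -> 'I_A)
    (Dhat : 'M[R]_B) (Dhat_stochastic : stochastic Dhat)
    (simple1 : simple_eigenvalue Dhat 1)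
    (r_gt0 : forall (a : 'I_A) (w : 'rV[R]_B),
       limit_set Phi Dhat w -> 0 < r_ Phi Dhat a w)
    (contracting : forall (b : 'I_A) (w : 'rV[R]_B),
       convex_hull (limit_set Phi Dhat `&` face Phi b) w ->
       eventually_contracting Phi Dhat b w) :
  analytic_at (entropy_rate Phi) Dhat.
Proof.
(* For [B = 0] the characteristic polynomial is the constant 1, which has no root, so 1 would not be
   an eigenvalue. *)
have B0 : (0 < B)%N.
  case: (posnP B) => // B0; move: simple1; rewrite /simple_eigenvalue mupNroot//.
  rewrite /root /char_poly; move: (char_poly_mx Dhat); rewrite B0 => M.
  by rewrite det_mx00 hornerC oner_eq0.
apply: analytic_at_majorized => k; apply: entropy_rate_majorized => // b w Lw Fw.
by apply: contracting => M [_]; apply; split.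
Qed.
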